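(* Let $D$ be a long virtual knot diagram with at least one classical crossing. Suppose that $D$ is minimal with respect to the number of virtual crossings and that $\deg_s\zeta(D)$ is equal to the number of virtual crossings of $D$. Let $K$ be a long classical knot diagram. Then the product $D*K$ is minimal with respect to the number of virtual crossings.
   Context: **Long virtual knots.** A long virtual knot diagram is a smooth immersion $f:\mathbb{R}\to\mathbb{R}^2$ such that (1) outside some big circle $f(t)=(t,0)$; (2) each intersection point is double and transverse; (3) each intersection point is endowed either with a classical crossing structure (a choice of overpass and underpass) or with a virtual crossing structure. The diagram is oriented by increasing $t$. A long classical knot diagram is one without virtual crossings. Two diagrams are equivalent, i.e. represent the same long virtual knot, if they are related by planar isotopy and a finite sequence of generalized Reidemeister moves: the classical moves $\Omega_1,\Omega_2,\Omega_3$, their purely virtual versions $\Omega_1',\Omega_2',\Omega_3'$, and the semivirtual move $\Omega'$ (a third move with one classical and two virtual crossings, moving a strand with two consecutive virtual crossings past a classical crossing). A diagram is minimal (with respect to the number of virtual crossings) if no long virtual knot diagram equivalent to it has fewer virtual crossings. The product $D_1*D_2$ is the usual product of long knots: the diagram obtained by concatenation, traversing $D_1$ first and then $D_2$. **Arcs and long arcs.** An arc of a diagram is a connected component of the set obtained from the diagram by deleting all virtual crossings, where at each classical crossing the two undercrossing edges are regarded as disjoint from each other (as usually drawn), while the overcrossing strand is not broken. Two arcs $a,a'$ belong to the same long arc if there are arcs $a=a_1,\dots,a_{m+1}=a'$ and virtual crossings $c_1,\dots,c_m$ such that $a_i,a_{i+1}$ are incident to $c_i$ from opposite sides for $i=1,\dots,m$.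 The initial long arc $\gamma_-$ (coming from $t=-\infty$) and the final long arc $\gamma_+$ (going to $t=+\infty$) are regarded as forming one united long arc $\gamma=\gamma_-\cup\gamma_+$, traversed along $\gamma_+$ first and then along $\gamma_-$. Hence, for a diagram $D$ with $n\ge 1$ classical crossings, there are exactly $n$ long arcs, and each classical crossing $v$ is paired with the long arc emanating from $v$ (the one starting at the outgoing underpass edge at $v$). Number the classical crossings $v_1,\dots,v_n$ in any way and let $\gamma^j$ be the long arc emanating from $v_j$. **Early over/undercrossings.** A classical crossing $v$ is an early overcrossing (respectively early undercrossing) if, traversing the diagram by increasing $t$, the first passage through $v$ is along its overpass (respectively underpass). **Incidence coefficients.** Let $T=\mathbb{Z}[p,p^{-1},q,q^{-1}]/\big((p-1)(p-q),\,(q-1)(p-q)\big)$. For a classical crossing $v$ and an arc $a$, define $$[v:a]=\varepsilon_1\cdot 1+\varepsilon_2\,(t^{\operatorname{sgn} v}-1)+\varepsilon_3\,(-t^{\operatorname{sgn} v})\in T,$$ where $t=p$ if $v$ is an early overcrossing and $t=q$ if $v$ is an early undercrossing; $\operatorname{sgn} v\in\{\pm1\}$ is the local writhe number of $v$; and $\varepsilon_i\in\{0,1\}$ with $\varepsilon_1=1$ iff $a$ emanates from $v$ (outgoing underpass edge), $\varepsilon_2=1$ iff $a$ passes over $v$, $\varepsilon_3=1$ iff $a$ comes into $v$ (incoming underpass edge). If $v$ and $a$ are not incident, $[v:a]=0$. **Degrees of arcs.** The function $\deg:\{\text{arcs of }D\}\to\mathbb{Z}$ is defined by: (1) $\deg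 a=0$ if $a$ is the first arc of its long arc; (2) if $a,b$ are neighbouring arcs on a long arc, separated by a virtual crossing, with $a$ preceding $b$, then $\deg b=\deg a+1$ if passing from $a$ to $b$ one crosses the (oriented) transversal strand from its left to its right, and $\deg b=\deg a-1$ otherwise. For the united long arc $\gamma$, the first arc is the first arc of $\gamma_+$, and the last arc of $\gamma_+$ and the first arc of $\gamma_-$ have the same degree. **The polynomial.** Let $A(D)$ be the $n\times n$ matrix with entries $$A_{ij}=\sum_{a\subset\gamma^j}[v_i:a]\,s^{\deg a}\in T[s,s^{-1}],$$ the sum running over the arcs $a$ contained in $\gamma^j$, and put $\zeta(D)=\det A(D)\in T[s,s^{-1}]$. This does not depend on the numbering of the classical crossings. For a nonzero element of $T[s,s^{-1}]$, $\deg_s$ denotes the largest exponent of $s$ occurring with nonzero coefficient in $T$; the zero polynomial has degree $-\infty$. *)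

(* Defs.v *)
From HB Require Import structures.
From mathcomp Require Import all_boot all_order all_algebra.
From mathcomp Require Import generic_quotient ring_quotient.
From mathcomp Require Import lra zify.
From Stdlib Require Import Relation_Operators.
From mathcomp Require Import all_classical all_reals all_analysis.
Set Implicit Arguments.
Unset Strict Implicit.
Unset Printing Implicit Defensive.
Import Order.TTheory GRing.Theory Num.Theory numFieldNormedType.Exports.
Local Open Scope classical_set_scope.
Local Open Scope quotient_scope.
Local Open Scope ring_scope.

Section GeneratedIdeal.
Variables (R : comNzRingType) (gs : seq R).

Definition gen_ideal : {pred R} :=
  [pred x | `[< exists c : nat -> R, x = \sum_(i < size gs) c i * gs`_i >]].

Lemma gen_ideal_closed (h : 1 \notin gen_ideal) :
  idealr_closed gen_ideal.
Proof.
split=> //.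
  apply/asboolP; exists (fun=> 0); rewrite big1 // => i _; exact: mul0r.
move=> a x y /asboolP[c ->] /asboolP[d ->]; apply/asboolP.
exists (fun i => a * c i + d i).
rewrite mulr_sumr -big_split; apply: eq_bigr => i _.
by rewrite mulrDl mulrA.
Qed.

Definition proper_gen_ideal (h : 1 \notin gen_ideal) : idealr R :=
  HB.pack (gen_ideal : R -> bool)
    (isIdealr.Build R (gen_ideal : R -> bool) (gen_ideal_closed h)).

Lemma gen_ideal_proper (S : nzRingType) (phi : {rmorphism R -> S}) :
  (forall g, g \in gs -> phi g = 0) -> 1 \notin gen_ideal.
Proof.
move=> phi0; apply/negP => /asboolP[c /(congr1 phi)/eqP].
rewrite rmorph1 rmorph_sum big1 ?oner_eq0 // => i _.
by rewrite rmorphM (phi0 gs`_i) ?mem_nth // mulr0.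
Qed.

End GeneratedIdeal.

(* R[X, X^-1], as the quotient of R[Y][X] by the relation X Y = 1. *)
Section Laurent.
Variable R : comNzRingType.

Definition laurent_rel : seq {poly {poly R}} := [:: 'X * 'X%:P - 1].

Let eval11 : {rmorphism {poly {poly R}} -> R} := horner_eval 1 \o horner_eval 1.

Lemma eval11_rel g : g \in laurent_rel -> eval11 g = 0.
Proof.
rewrite inE => /eqP ->; rewrite /= /horner_eval !hornerE subrr //.
Qed.

Lemma laurent_rel_proper : 1 \notin gen_ideal laurent_rel.
Proof. exact: gen_ideal_proper eval11_rel. Qed.

Definition laurent : Type :=
  {ideal_quot (proper_gen_ideal laurent_rel_proper)}.
HB.instance Definition _ :=
  GRing.ComNzRing.copy laurent {ideal_quot (proper_gen_ideal laurent_rel_proper)}.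

Definition lcst (c : R) : laurent := \pi_laurent c%:P%:P.

(* X^k *)
Definition lmonom (k : int) : laurent :=
  \pi_laurent match k with Posz n => 'X ^+ n | Negz n => ('X ^+ n.+1)%:P end.

(* The coefficient of X^k, read off from any representative: the monomial
   X^i Y^j contributes to the exponent i - j. *)
Definition lcoef (z : laurent) (k : int) : R :=
  \sum_(i < size (repr z)) \sum_(j < size (repr z)`_i | i%:Z - j%:Z == k)
    (repr z)`_i`_j.


(* Evaluation at X = 1, used only to see that the ideal defining T_ring is
   proper. *)
Definition laurent_at1 (z : laurent) : R := (repr z).[1].[1].

Lemma laurent_at1_pi P : laurent_at1 (\pi P) = P.[1].[1].
Proof.
have : repr (\pi_laurent P) - P \in proper_gen_ideal laurent_rel_proper.
  by rewrite Quotient.idealrBE reprK.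
move=> /asboolP[c cE].
suff : eval11 (repr (\pi_laurent P) - P) = 0.
  by rewrite raddfB => /eqP; rewrite subr_eq0 => /eqP.
rewrite cE raddf_sum big1 // => i _.
by rewrite [LHS](rmorphM eval11) (eval11_rel (g := laurent_rel`_i)) ?mem_nth // mulr0.
Qed.

Lemma laurent_at1_zmod : zmod_morphism laurent_at1.
Proof.
elim/quotW=> P; elim/quotW=> Q.
have -> : \pi_laurent P - \pi_laurent Q = \pi_laurent (P - Q) by rewrite !piE.
by rewrite !laurent_at1_pi !hornerD !hornerN.
Qed.

Lemma laurent_at1_monoid : monoid_morphism laurent_at1.
Proof.
split; last first.
  elim/quotW=> P; elim/quotW=> Q.
  have -> : \pi_laurent P * \pi_laurent Q = \pi_laurent (P * Q) by rewrite !piE.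
  by rewrite !laurent_at1_pi !hornerM.
have -> : 1 = \pi_laurent 1 by rewrite !piE.
by rewrite laurent_at1_pi !hornerC.
Qed.

HB.instance Definition _ :=
  GRing.isZmodMorphism.Build laurent R laurent_at1 laurent_at1_zmod.
HB.instance Definition _ :=
  GRing.isMonoidMorphism.Build laurent R laurent_at1 laurent_at1_monoid.

End Laurent.

(* -oo for the zero polynomial. *)
Definition deg_s (R : comNzRingType) (z : laurent R) : \bar int :=
  supremum -oo%E [set k%:E%E | k in [set k | lcoef z k != 0]].


Local Notation Zpq := (laurent (laurent int)).

(* Z[p, p^-1, q, q^-1] / ((p - 1)(p - q), (q - 1)(p - q)) *)
Section CoefficientRing.
Let p : Zpq := lcst (lmonom int 1).
Let q : Zpq := lmonom (laurent int) 1.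

Definition T_rel : seq Zpq := [:: (p - 1) * (p - q); (q - 1) * (p - q)].

Let eval1 : {rmorphism Zpq -> int} := @laurent_at1 int \o @laurent_at1 _.

Lemma T_rel_proper : 1 \notin gen_ideal T_rel.
Proof.
have p1 : eval1 p = 1.
  by rewrite /= laurent_at1_pi !hornerC laurent_at1_pi /= !hornerE.
have q1 : eval1 q = 1 by rewrite /= laurent_at1_pi /= !hornerE rmorph1.
apply: (gen_ideal_proper (phi := eval1)) => g; rewrite !inE => /orP[] /eqP ->.
  by rewrite [LHS](rmorphM eval1) (rmorphB eval1 p 1) [X in X - _]p1 (rmorph1 eval1) subrr mul0r.
by rewrite [LHS](rmorphM eval1) (rmorphB eval1 q 1) [X in X - _]q1 (rmorph1 eval1) subrr mul0r.
Qed.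

Definition T_ring : Type := {ideal_quot (proper_gen_ideal T_rel_proper)}.
HB.instance Definition _ :=
  GRing.ComNzRing.copy T_ring {ideal_quot (proper_gen_ideal T_rel_proper)}.

Definition p_pow (k : int) : T_ring := \pi_T_ring (lcst (lmonom int k)).
Definition q_pow (k : int) : T_ring := \pi_T_ring (lmonom (laurent int) k).
End CoefficientRing.

Section Smooth.
Context {R : realType}.

(* For a finite-dimensional domain, [Ck n f] says that [f] is of class C^n. *)
Fixpoint Ck (n : nat) {V W : normedModType R} (f : V -> W) : Prop :=
  if n is m.+1 then
    (forall x, differentiable f x) /\ (forall v, Ck m (fun x => 'D_v f x))
  else continuous f.

Definition smooth {V W : normedModType R} (f : V -> W) := forall n, Ck n f.

Lemma near_smooth {W : normedModType R} (f : R -> W) :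
  (forall x : R, exists2 g : R -> W, smooth g & \forall y \near x, g y = f y) ->
  smooth f.
Proof.
move=> H n; have {}H : forall x : R, exists2 g : R -> W, Ck n g &
    \forall y \near x, g y = f y.
  by move=> x; have [g gs gf] := H x; exists g.
elim: n f H => [|n IHn] f H.
  move=> x; have [g gc gf] := H x.
  rewrite /continuous_at -(nbhs_singleton gf).
  by apply: cvg_trans (gc x); apply: near_eq_cvg.
split=> [x|v].
  have [g [gd _] gf] := H x; apply/derivable1_diffP.
  apply: (near_eq_derivable gf).
  exact/derivable1_diffP.
apply: IHn => x; have [g [_ gd] gf] := H x.
exists (fun x => 'D_v g x); first exact: gd.
by apply: filterS (near_join gf) => y yE; exact: (near_eq_derive v yE).
Qed.

Lemma quotient_translate {W : normedModType R} (f : R -> W) c w x v :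
  (fun h : R => h^-1 *: (((fun t => f (t + c) + w) \o shift x) (h *: v) -
                         (f (x + c) + w))) =
  (fun h : R => h^-1 *: ((f \o shift (x + c)) (h *: v) - f (x + c))).
Proof.
by apply/funext => h /=; rewrite opprD addrACA subrr addr0 addrA.
Qed.

Lemma derive_translate {W : normedModType R} (f : R -> W) c w v :
  (fun x => 'D_v (fun t => f (t + c) + w) x) = (fun x => 'D_v f (x + c)).
Proof.
by apply/funext => x; rewrite /derive quotient_translate.
Qed.

Lemma smooth_translate {W : normedModType R} (f : R -> W) c w :
  smooth f -> smooth (fun t => f (t + c) + w).
Proof.
move=> fs n; move: (fs n); elim: n f w {fs} => [|n IHn] f w /=.
  move=> fc x; apply: cvgD; last exact: cvg_cst.
  apply: (@continuous_comp _ _ _ (fun t => t + c) f); last exact: fc.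
  by apply: cvgD; [exact: cvg_id|exact: cvg_cst].
move=> [fd fC]; split=> [x|v].
  apply/derivable1_diffP; have /derivable1_diffP := fd (x + c).
  by rewrite /derivable quotient_translate.
rewrite derive_translate.
rewrite (_ : (fun x => _) = (fun x => 'D_v f (x + c) + 0)).
  exact: (IHn (fun x => 'D_v f x)).
by apply/funext => x; rewrite addr0.
Qed.

End Smooth.

Section Diagrams.
Context {R : realType}.
Local Notation plane := (R * R)%type.

Definition cross (u v : plane) : R := u.1 * v.2 - u.2 * v.1.

(* [f] is standard outside the circle of radius [r]. *)
Definition long_outside (f : R -> plane) (r : R) := 0 < r /\ forall t,
  (`|t| < r -> (f t).1 ^+ 2 + (f t).2 ^+ 2 < r ^+ 2) /\
  (r <= `|t| -> f t = (t, 0)).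

(* The double points are listed by their pairs of parameters: (overpass,
   underpass) for a classical crossing, in either order for a virtual one.  The
   list [classical] also provides the numbering of the classical crossings.
   [curve_double] says that no parameter occurs twice, hence that no point is
   more than double. *)
Record diagram := Diagram {
  curve : R -> plane;
  classical : seq (R * R);
  virtual : seq (R * R);
  crossings := classical ++ virtual;
  curve_smooth : smooth curve;
  curve_immersed : forall t, derive1 curve t != 0;
  curve_long : exists r, long_outside curve r;
  curve_double : uniq (unzip1 crossings ++ unzip2 crossings);
  curve_crossings : forall t u, t != u /\ curve t = curve u <->
    (t, u) \in crossings \/ (u, t) \in crossings;
  curve_transverse : forall t u, t != u -> curve t = curve u ->
    cross (derive1 curve t) (derive1 curve u) != 0 }.

Definition velocity (D : diagram) (t : R) : plane := derive1 (curve D) t.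


Lemma curve_box (D : diagram) r t : 0 < r ->
  (curve D t).1 ^+ 2 + (curve D t).2 ^+ 2 < r ^+ 2 -> `|(curve D t).1| < r.
Proof.
move=> r0 cr; rewrite -(ltr_pXn2r (n := 2)) ?nnegrE ?normr_ge0 ?ltW //.
by rewrite real_normK ?num_real //; have := sqr_ge0 (curve D t).2; lra.
Qed.

Lemma crossing_box (D : diagram) r t u : long_outside (curve D) r ->
  t != u -> curve D t = curve D u -> `|t| < r.
Proof.
move=> [r0 Dr] tu Dtu; rewrite ltNge; apply/negP => rt.
have Dt := (Dr t).2 rt; have [ru|ru] := ltP `|u| r.
  have := (Dr u).1 ru; rewrite -Dtu Dt /= expr0n addr0 => tr.
  suff : `|t| < r by rewrite ltNge rt.
  by have := @curve_box D r t r0; rewrite Dt /= expr0n addr0; apply.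
by move: Dtu tu; rewrite Dt (Dr u).2 // => -[->]; rewrite eqxx.
Qed.


(* [f] moved to the left by [c], followed by [g] moved to the right by [d]. *)
Definition concat (f g : R -> plane) (c d : R) (t : R) : plane :=
  if t < 0 then f (t + c) - (c, 0) else g (t - d) + (d, 0).

Definition shift_times (c : R) (s : seq (R * R)) :=
  [seq (x.1 + c, x.2 + c) | x <- s].

Lemma mem_shift_times c s t u :
  ((t, u) \in shift_times c s) = ((t - c, u - c) \in s).
Proof.
apply/mapP/idP => [[[x y] xys [-> ->]]|tus]; first by rewrite !addrK.
by exists (t - c, u - c); rewrite //= !subrK.
Qed.

Section Product.
Variables (D1 D2 : diagram) (r1 r2 : R).
Hypotheses (D1r : long_outside (curve D1) r1) (D2r : long_outside (curve D2) r2).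

Let c1 := r1 + 1.
Let c2 := r2 + 1.

Let f := concat (curve D1) (curve D2) c1 c2.
Let cl := shift_times (- c1) (classical D1) ++ shift_times c2 (classical D2).
Let vi := shift_times (- c1) (virtual D1) ++ shift_times c2 (virtual D2).

Lemma outside_left t : -1 < t -> curve D1 (t + c1) = (t + c1, 0).
Proof.
move=> t1; have [r0 D1E] := D1r; apply: (D1E _).2.
by rewrite ger0_norm /c1; lra.
Qed.

Lemma outside_right t : t < 1 -> curve D2 (t - c2) = (t - c2, 0).
Proof.
move=> t1; have [r0 D2E] := D2r; apply: (D2E _).2.
by rewrite ler0_norm /c2; lra.
Qed.

Lemma concat_left t : t < 1 -> f t = curve D1 (t + c1) - (c1, 0).
Proof.
move=> t1; rewrite /f /concat; case: ltP => // t0.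
rewrite outside_left ?outside_right //; last by lra.
by congr pair => /=; lra.
Qed.

Lemma concat_right t : - 1 < t -> f t = curve D2 (t - c2) + (c2, 0).
Proof.
move=> t1; rewrite /f /concat; case: ltP => // t0.
rewrite outside_left ?outside_right //; last by lra.
by congr pair => /=; lra.
Qed.

Lemma near_concat_left (x : R) : x < 1 ->
  nbhs x [set y | curve D1 (y + c1) - (c1, 0) = f y].
Proof.
by move=> x1; apply: filterS (lt_nbhsl x1) => y y1 /=; rewrite concat_left.
Qed.

Lemma near_concat_right (x : R) : -1 < x ->
  nbhs x [set y | curve D2 (y - c2) + (c2, 0) = f y].
Proof.
by move=> x1; apply: filterS (lt_nbhsr x1) => y y1 /=; rewrite concat_right.
Qed.

Lemma concat_smooth : smooth f.
Proof.
apply: near_smooth => x; have [x0|x0] := ltP x 0.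
  exists (fun y => curve D1 (y + c1) - (c1, 0)).
    exact/smooth_translate/curve_smooth.
  by apply: near_concat_left; lra.
exists (fun y => curve D2 (y - c2) + (c2, 0)).
  exact/smooth_translate/curve_smooth.
by apply: near_concat_right; lra.
Qed.

Lemma derive_concat_left t : t < 1 -> derive1 f t = velocity D1 (t + c1).
Proof.
move=> t1; rewrite /velocity !derive1E.
rewrite -(@near_eq_derive R R plane _ f t (1 : R) (near_concat_left t1)).
exact: (congr1 (fun g => g t) (derive_translate (curve D1) c1 (- (c1, 0)) 1)).
Qed.

Lemma derive_concat_right t : -1 < t -> derive1 f t = velocity D2 (t - c2).
Proof.
move=> t1; rewrite /velocity !derive1E.
rewrite -(@near_eq_derive R R plane _ f t (1 : R) (near_concat_right t1)).
exact: (congr1 (fun g => g t) (derive_translate (curve D2) (- c2) (c2, 0) 1)).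
Qed.

Lemma concat_immersed t : derive1 f t != 0.
Proof.
have [t0|t0] := ltP t 0.
  by rewrite derive_concat_left; [exact: curve_immersed|lra].
by rewrite derive_concat_right; [exact: curve_immersed|lra].
Qed.

Lemma concat_fst t : (t < 0 -> (f t).1 < 0) /\ (0 <= t -> 0 <= (f t).1).
Proof.
split=> t0.
  rewrite concat_left /=; last by lra.
  have [r0 D1E] := D1r; have [ltr|ler] := ltP `|t + c1| r1.
    by have := curve_box r0 ((D1E _).1 ltr); rewrite ltr_norml /c1; lra.
  by rewrite (D1E _).2 //=; lra.
rewrite concat_right /=; last by lra.
have [r0 D2E] := D2r; have [ltr|ler] := ltP `|t - c2| r2.
  by have := curve_box r0 ((D2E _).1 ltr); rewrite ltr_norml /c2; lra.
by rewrite (D2E _).2 //=; lra.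
Qed.

Lemma concat_long : exists r, long_outside f r.
Proof.
have [r10 D1E] := D1r; have [r20 D2E] := D2r.
exists (c1 + r1 + c2 + r2); split; first by rewrite /c1 /c2; lra.
move=> t; have [t0|t0] := ltP t 0.
  rewrite concat_left; last by lra.
  rewrite (ltr0_norm t0).
  have [ltr|ler] := ltP `|t + c1| r1.
    have := (D1E _).1 ltr; have := curve_box r10 ((D1E _).1 ltr).
    case: (curve D1 (t + c1)) => x y /=; move: ltr.
    rewrite !ltr_norml /c1 /c2 => /andP[? ?] /andP[? ?] ?.
    by split; [rewrite subr0; nra|move=> ?; exfalso; lra].
  rewrite (D1E _).2 //= /c1 /c2; split=> tr.
    by rewrite subr0 expr0n addr0 /=; nra.
  by congr pair => /=; lra.
rewrite concat_right; last by lra.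
rewrite (ger0_norm t0).
have [ltr|ler] := ltP `|t - c2| r2.
  have := (D2E _).1 ltr; have := curve_box r20 ((D2E _).1 ltr).
  case: (curve D2 (t - c2)) => x y /=; move: ltr.
  rewrite !ltr_norml /c1 /c2 => /andP[? ?] /andP[? ?] ?.
  by split; [rewrite addr0; nra|move=> ?; exfalso; lra].
rewrite (D2E _).2 //= /c1 /c2; split=> tr.
  by rewrite addr0 expr0n addr0 /=; nra.
by congr pair => /=; lra.
Qed.

Lemma mem_concat_crossings t u : (t, u) \in cl ++ vi =
  ((t + c1, u + c1) \in crossings D1) || ((t - c2, u - c2) \in crossings D2).
Proof.
rewrite /crossings !mem_cat !mem_shift_times !opprK.
by rewrite orbACA.
Qed.

Lemma crossing_left t u :
  (t + c1, u + c1) \in crossings D1 -> (t < 0) && (u < 0).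
Proof.
move=> tu; have [neq eqD] := (curve_crossings D1 _ _).2 (or_introl tu).
have := crossing_box D1r neq eqD.
have := crossing_box D1r _ (esym eqD); rewrite eq_sym => /(_ neq).
by rewrite !ltr_norml /c1; lra.
Qed.

Lemma crossing_right t u :
  (t - c2, u - c2) \in crossings D2 -> (0 <= t) && (0 <= u).
Proof.
move=> tu; have [neq eqD] := (curve_crossings D2 _ _).2 (or_introl tu).
have := crossing_box D2r neq eqD.
have := crossing_box D2r _ (esym eqD); rewrite eq_sym => /(_ neq).
by rewrite !ltr_norml /c2; lra.
Qed.

Lemma concat_crossings t u : t != u /\ f t = f u <->
  (t, u) \in cl ++ vi \/ (u, t) \in cl ++ vi.
Proof.
rewrite !mem_concat_crossings; split.
  move=> [tu ftu]; have [t0|t0] := ltP t 0; have [u0|u0] := ltP u 0.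
  - have t1 : t < 1 by lra.
    have u1 : u < 1 by lra.
    move: ftu; rewrite (concat_left t1) (concat_left u1).
    move=> /addIr ftu.
    have [|->|->] := (curve_crossings D1 (t + c1) (u + c1)).1; last 2 first.
    + by left.
    + by right.
    by rewrite (inj_eq (addIr _)).
  - by have := (concat_fst t).1 t0; have := (concat_fst u).2 u0; rewrite ftu; lra.
  - by have := (concat_fst t).2 t0; have := (concat_fst u).1 u0; rewrite ftu; lra.
  - have t1 : -1 < t by lra.
    have u1 : -1 < u by lra.
    move: ftu; rewrite (concat_right t1) (concat_right u1).
    move=> /addIr ftu.
    have [|->|->] := (curve_crossings D2 (t - c2) (u - c2)).1; last 2 first.
    + by left; rewrite orbT.
    + by right; rewrite orbT.
    by rewrite (inj_eq (addIr _)).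
have left x y : (x + c1, y + c1) \in crossings D1 -> x != y /\ f x = f y.
  move=> xy; have /andP[x0 y0] := crossing_left xy.
  have [neq eqD] := (curve_crossings D1 _ _).2 (or_introl xy).
  split; first by rewrite -(inj_eq (addIr c1)).
  have x1 : x < 1 by lra.
  have y1 : y < 1 by lra.
  by rewrite (concat_left x1) (concat_left y1) eqD.
have right x y : (x - c2, y - c2) \in crossings D2 -> x != y /\ f x = f y.
  move=> xy; have /andP[x0 y0] := crossing_right xy.
  have [neq eqD] := (curve_crossings D2 _ _).2 (or_introl xy).
  split; first by rewrite -(inj_eq (addIr (- c2))).
  have x1 : -1 < x by lra.
  have y1 : -1 < y by lra.
  by rewrite (concat_right x1) (concat_right y1) eqD.
move=> [] /orP[] tu; try by [apply: left|apply: right].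
  by have [? ->] := left _ _ tu; rewrite eq_sym.
by have [? ->] := right _ _ tu; rewrite eq_sym.
Qed.

Lemma concat_transverse t u : t != u -> f t = f u ->
  cross (derive1 f t) (derive1 f u) != 0.
Proof.
move=> tu ftu; have [t0|t0] := ltP t 0; have [u0|u0] := ltP u 0.
- have t1 : t < 1 by lra.
  have u1 : u < 1 by lra.
  rewrite (derive_concat_left t1) (derive_concat_left u1).
  apply: curve_transverse; first by rewrite (inj_eq (addIr _)).
  by move: ftu; rewrite (concat_left t1) (concat_left u1) => /addIr.
- by have := (concat_fst t).1 t0; have := (concat_fst u).2 u0; rewrite ftu; lra.
- by have := (concat_fst t).2 t0; have := (concat_fst u).1 u0; rewrite ftu; lra.
- have t1 : -1 < t by lra.
  have u1 : -1 < u by lra.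
  rewrite (derive_concat_right t1) (derive_concat_right u1).
  apply: curve_transverse; first by rewrite (inj_eq (addIr _)).
  by move: ftu; rewrite (concat_right t1) (concat_right u1) => /addIr.
Qed.

Lemma concat_double : uniq (unzip1 (cl ++ vi) ++ unzip2 (cl ++ vi)).
Proof.
pose times (s : seq (R * R)) := unzip1 s ++ unzip2 s.
have shiftE c s : times (shift_times c s) = [seq t + c | t <- times s].
  by rewrite /times /unzip1 /unzip2 map_cat /shift_times -!map_comp.
have : perm_eq (times (cl ++ vi))
    (times (shift_times (- c1) (crossings D1)) ++
     times (shift_times c2 (crossings D2))).
  rewrite /times /cl /vi /crossings /shift_times /unzip1 /unzip2 !map_cat.
  apply/seq.permP => a; rewrite !count_cat; lia.
move=> /perm_uniq; rewrite /times => ->.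
rewrite cat_uniq -!/(times _) !shiftE !map_inj_uniq; try exact: addIr.
rewrite /times !curve_double andbT /=; apply/hasPn => x /mapP[t2 tD2 ->].
apply/negP => /mapP[t1 tD1].
have t10 : t1 - c1 < 0.
  have : exists u, (t1, u) \in crossings D1 \/ (u, t1) \in crossings D1.
    move: tD1; rewrite mem_cat => /orP[] /mapP[[y z] yz /= ->].
      by exists z; left.
    by exists y; right.
  move=> [u [] uD].
    by have := @crossing_left (t1 - c1) (u - c1); rewrite !subrK => /(_ uD)/andP[].
  by have := @crossing_left (u - c1) (t1 - c1); rewrite !subrK => /(_ uD)/andP[].
have t20 : 0 <= t2 + c2.
  have : exists u, (t2, u) \in crossings D2 \/ (u, t2) \in crossings D2.
    move: tD2; rewrite mem_cat => /orP[] /mapP[[y z] yz /= ->].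
      by exists z; left.
    by exists y; right.
  move=> [u [] uD].
    by have := @crossing_right (t2 + c2) (u + c2); rewrite !addrK => /(_ uD)/andP[].
  by have := @crossing_right (u + c2) (t2 + c2); rewrite !addrK => /(_ uD)/andP[].
by move=> /eqP; rewrite gt_eqF //; lra.
Qed.

Definition concat_diagram : diagram :=
  Diagram concat_smooth concat_immersed concat_long concat_double
    concat_crossings concat_transverse.

End Product.

(* The radii used for the translations are chosen arbitrarily: all choices give
   planar isotopic diagrams. *)
Definition product (D1 D2 : diagram) : diagram :=
  concat_diagram (svalP (cid (curve_long D1))) (svalP (cid (curve_long D2))).

End Diagrams.

Arguments diagram : clear implicits.

Section Equivalence.
Context {R : realType}.
Local Notation plane := (R * R)%type.
Local Notation strand := (R * R)%type.
Local Notation diagram := (diagram R).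

(* An ambient isotopy of the plane with compact support, together with an
   orientation-preserving change of parameter.  The isotopy parameter ranges
   over the whole line; only its values at 0 and 1 matter.  The virtual
   crossings need no clause: they are the double points that are not
   classical. *)
Definition planar_isotopic (D D' : diagram) : Prop :=
  exists (H G : R * plane -> plane) (alpha : R -> R),
  [/\ smooth H /\ smooth G,
      (forall s z, G (s, H (s, z)) = z /\ H (s, G (s, z)) = z),
      (forall z, H (0, z) = z) /\
        (exists r, forall s z, r <= `|z| -> H (s, z) = z),
      [/\ smooth alpha, (forall t, 0 < derive1 alpha t) &
        exists r, forall t, r <= `|t| -> alpha t = t] &
      (forall t, curve D' t = H (1, curve D (alpha t))) /\
        (forall t u, ((t, u) \in classical D') =
                     ((alpha t, alpha u) \in classical D))].

(* Each Reidemeister move takes place in a disc.  Since every smoothly embedded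
   disc is carried to a fixed one by a planar isotopy, it suffices to allow the
   moves in the open square ]-1, 1[^2.  A strand [I = (a, b)] is the part of the
   curve with parameters in [`]a, b[]. *)
Definition in_square (z : plane) : bool := (`|z.1| < 1) && (`|z.2| < 1).

Definition dom (I : strand) : interval R := `]I.1, I.2[.

Definition apart (I J : strand) : bool := (I.2 <= J.1) || (J.2 <= I.1).

Definition meets_square_in (D : diagram) (Is : seq strand) : Prop :=
  forall t, in_square (curve D t) = has (fun I => t \in dom I) Is.

Definition agree_off (I : strand) (D D' : diagram) : Prop :=
  (forall t, t \notin dom I -> curve D t = curve D' t) /\
  (forall t u, t \notin dom I -> u \notin dom I ->
     ((t, u) \in classical D) = ((t, u) \in classical D')).

(* The strand joins the vertical sides of the square and, inside the square, is
   the graph of a function of the abscissa (traversed in either direction). *)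
Definition chord (D : diagram) (I : strand) : Prop :=
  [/\ I.1 < I.2, `|(curve D I.1).1| = 1, `|(curve D I.2).1| = 1 &
      forall t, t \in dom I -> (velocity D t).1 != 0].

Variant crossing_kind := Over | Under | Virtual.

(* How [I] behaves with respect to [J] at their intersection points. *)
Definition crosses_as (k : crossing_kind) (D : diagram) (I J : strand) : Prop :=
  forall t u, t \in dom I -> u \in dom J -> curve D t = curve D u ->
  match k return Prop with
  | Over => (t, u) \in classical D
  | Under => (u, t) \in classical D
  | Virtual => (t, u) \notin classical D /\ (u, t) \notin classical D
  end.

(* A strand without self-crossings is replaced by one with a single
   self-crossing, classical or virtual. *)
Definition first_move (D D' : diagram) : Prop :=
  exists I : strand,
  [/\ I.1 < I.2,
      meets_square_in D [:: I] /\ meets_square_in D' [:: I],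
      agree_off I D D',
      {in dom I &, injective (curve D)} &
      exists t0 u0, [/\ t0 \in dom I, u0 \in dom I, t0 < u0 &
        forall t u, t \in dom I -> u \in dom I -> t < u ->
          (curve D' t = curve D' u <-> t = t0 /\ u = u0)]].

(* [I1] is the horizontal axis; [I2], first lying above it, is pushed below it
   over the segment between the abscissas -1/2 and 1/2. *)
Definition second_move (D D' : diagram) : Prop :=
  exists I1 I2 : strand,
  [/\ apart I1 I2 /\ agree_off I2 D D',
      meets_square_in D [:: I1; I2] /\ meets_square_in D' [:: I1; I2],
      [/\ chord D I1, chord D I2 & chord D' I2],
      [/\ forall t, t \in dom I1 -> (curve D t).2 = 0,
          forall t, t \in dom I2 -> 0 < (curve D t).2 &
          forall t, t \in dom I2 ->
            Num.sg (curve D' t).2 = Num.sg (`|(curve D' t).1| - 2^-1)] &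
      exists k, crosses_as k D' I1 I2].

(* The admissible kinds of the crossings of strand 1 with 2, 1 with 3, and
   2 with 3.  In the classical case the strands lie at three different heights;
   in the semivirtual case strand 3 is the one carrying the virtual
   crossings. *)
Definition by_height (h h' : nat) : crossing_kind :=
  if (h' < h)%N then Over else Under.

Variant third_kinds : crossing_kind -> crossing_kind -> crossing_kind -> Prop :=
| ThirdClassical h1 h2 h3 : uniq [:: h1; h2; h3] ->
    third_kinds (by_height h1 h2) (by_height h1 h3) (by_height h2 h3)
| ThirdVirtual : third_kinds Virtual Virtual Virtual
| ThirdSemivirtual k : k <> Virtual -> third_kinds k Virtual Virtual.

Definition third_picture (D : diagram) (I1 I2 I3 : strand)
    (k12 k13 k23 : crossing_kind) : Prop :=
  [/\ meets_square_in D [:: I1; I2; I3],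
      [/\ chord D I1, chord D I2 & chord D I3],
      (forall t, t \in dom I1 -> (curve D t).2 = (curve D t).1) /\
        (forall t, t \in dom I2 -> (curve D t).2 = - (curve D t).1),
      (forall t, t \in dom I3 -> `|(velocity D t).2| < `|(velocity D t).1|) &
      [/\ crosses_as k12 D I1 I2, crosses_as k13 D I1 I3 &
          crosses_as k23 D I2 I3]].

(* [I1] and [I2] are the diagonals of the square; [I3], of slope less than 1 in
   absolute value, is moved from above to below their crossing point. *)
Definition third_move (D D' : diagram) : Prop :=
  exists (I1 I2 I3 : strand) (k12 k13 k23 : crossing_kind),
  [/\ third_kinds k12 k13 k23,
      [/\ apart I1 I2, apart I1 I3, apart I2 I3 & agree_off I3 D D'],
      third_picture D I1 I2 I3 k12 k13 k23,
      third_picture D' I1 I2 I3 k12 k13 k23 &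
      (forall t, t \in dom I3 -> (curve D t).1 = 0 -> 0 < (curve D t).2) /\
        (forall t, t \in dom I3 -> (curve D' t).1 = 0 -> (curve D' t).2 < 0)].

Definition elementary_move (D D' : diagram) : Prop :=
  [\/ planar_isotopic D D', first_move D D', second_move D D' |
      third_move D D'].

Definition equivalent : diagram -> diagram -> Prop :=
  clos_refl_sym_trans diagram elementary_move.

Definition minimal (D : diagram) : Prop :=
  forall D', equivalent D D' -> (size (virtual D) <= size (virtual D'))%N.

End Equivalence.

Section Polynomial.
Context {R : realType}.
Variable D : diagram R.

(* A classical crossing [v] is the pair of its overpass and underpass times. *)
Definition writhe (v : R * R) : int :=
  if 0 < cross (velocity D v.1) (velocity D v.2) then 1 else -1.

Definition early_overcrossing (v : R * R) : bool := v.1 < v.2.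

Definition weight (v : R * R) : T_ring :=
  if early_overcrossing v then p_pow (writhe v) else q_pow (writhe v).

Definition virtual_times : seq R := unzip1 (virtual D) ++ unzip2 (virtual D).

Definition cuts : seq R :=
  sort <=%R (unzip2 (classical D) ++ virtual_times).

(* The arc [a] is the part of the curve with parameters strictly between
   [cuts`_a.-1] (or -oo if [a = 0]) and [cuts`_a] (or +oo if
   [a = size cuts]). *)
Definition arc : predArgType := 'I_(size cuts).+1.

Definition emanates (v : R * R) (a : arc) : bool :=
  (0 < a)%N && (cuts`_a.-1 == v.2).

Definition comes_into (v : R * R) (a : arc) : bool :=
  (a < size cuts)%N && (cuts`_a == v.2).

Definition passes_over (v : R * R) (a : arc) : bool :=
  ((0 < a)%N ==> (cuts`_a.-1 < v.1)) && ((a < size cuts)%N ==> (v.1 < cuts`_a)).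

Definition incidence (v : R * R) (a : arc) : T_ring :=
  (emanates v a)%:R * 1 + (passes_over v a)%:R * (weight v - 1)
    + (comes_into v a)%:R * - weight v.

Definition virtual_neighbours (a b : arc) : bool :=
  (b == a.+1 :> nat) && (cuts`_a \in virtual_times).

(* The last disjunct unites the final long arc with the initial one. *)
Definition same_long_arc : rel arc :=
  connect (fun a b : arc =>
    [|| virtual_neighbours a b, virtual_neighbours b a |
        ((a == ord_max) && (b == ord0)) || ((a == ord0) && (b == ord_max))]).

Definition long_arc (v : R * R) : pred arc :=
  fun a => [exists b : arc, emanates v b && same_long_arc b a].

(* The curve at time [t] goes from the left to the right of the strand through
   the same point at time [u]. *)
Definition left_to_right (u t : R) : bool :=
  cross (velocity D u) (velocity D t) < 0.

Definition degree_step (t : R) : int :=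
  if has (fun c => ((c.1 == t) && left_to_right c.2 c.1) ||
                   ((c.2 == t) && left_to_right c.1 c.2)) (virtual D)
  then 1 else -1.

(* The degree of the [k]-th arc, if that of the first arc of the diagram is
   [d]. *)
Fixpoint degree_from (d : int) (k : nat) : int :=
  if k is k'.+1 then
    if cuts`_k' \in virtual_times then degree_from d k' + degree_step cuts`_k'
    else 0
  else d.

(* The first arc of the diagram has the same degree as its last arc; the latter
   does not depend on [d] as soon as there is a classical crossing. *)
Definition degree (a : arc) : int := degree_from (degree_from 0 (size cuts)) a.

Let v (i : 'I_(size (classical D))) : R * R := tnth (in_tuple (classical D)) i.

Definition zeta_matrix : 'M[laurent T_ring]_(size (classical D)) :=
  \matrix_(i, j) \sum_(a : arc | long_arc (v j) a)
    lcst (incidence (v i) a) * lmonom T_ring (degree a).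

Definition zeta : laurent T_ring := \det zeta_matrix.

End Polynomial.

(* Main.v *)
(* Let h(t) be the sum of the degree steps at the virtual crossings passed before
   time t.  Conjugating A(D) by the powers s^h turns zeta(D) into the determinant
   of the system of equations
     x = w y + (1 - w) s^(h(o) - h(u)) z,
   one for each classical crossing, passed over at time o and under at time u and
   of weight w = p^(+-1) or q^(+-1), where x is the arc starting at u, y the one
   ending at u and z the one containing o.  Virtual crossings enter only through
   h.  One more equation identifies the arcs coming from -oo and going to +oo, so
   that the determinant also makes sense without classical crossings.

   In this form the moves are elementary.  The first move multiplies the
   determinant by 1 or w, the second one cancels two rows with inverse weights,
   and the third one is a row operation, which is correct because
   (1 - w)(p^k - q^k) = 0 in T.  Moves with virtual crossings do not change the
   differences of heights.

   In the original degrees, the column of an arc only contains exponents bounded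
   by the number of its steps +1, and each virtual crossing provides one such
   step: the coefficient of s^k in zeta(D') vanishes if D' has fewer than k
   virtual crossings.  For K classical, the rows of K in D * K contribute a factor
   delta in T that becomes 1 when p = q = 1, and such an element is not a zero
   divisor in T.  Hence the coefficient of s^N in zeta(D * K) is not zero, where N
   is the number of virtual crossings of D, and every diagram equivalent to D * K
   has at least N virtual crossings. *)

(* An equivalence may pass through diagrams without classical crossings, where the empty determinant
   1 would break invariance. With the row that identifies the two unbounded arcs the value there is
   0, as it is for a single classical kink.

   Invariance up to units of T is enough: such a factor contains no power of s, so it does not
   affect which coefficients vanish. Degrees themselves cannot be multiplied, because T has zero
   divisors such as p - 1 and p - q; single coefficients are followed instead, and delta is lifted
   to Laurent polynomials in p and q, where its augmentation can be computed.

   The other obstacle is geometric. Diagrams are smooth curves, so each move has to be turned into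
   data on times: which double points lie in the square, in which order each strand meets them, and
   with which signs. In the standard pictures the strands are monotone for suitable linear forms.
   The intermediate value theorem then gives the crossings, monotonicity gives their uniqueness and
   order, and the slopes give the signs. *)
From HB Require Import structures.
From mathcomp Require Import all_boot all_order all_algebra perm.
From mathcomp Require Import generic_quotient ring_quotient.
From mathcomp Require Import ring lra zify.
From Stdlib Require Import Relation_Operators.
From mathcomp Require Import all_classical all_reals all_analysis.
Require Import Defs.
Set Implicit Arguments.
Unset Strict Implicit.
Unset Printing Implicit Defensive.
Import Order.TTheory GRing.Theory Num.Theory numFieldNormedType.Exports.
Local Open Scope quotient_scope.
Local Open Scope classical_set_scope.
Local Open Scope ring_scope.

(** * Determinants indexed by sequences *)

Section NamedDeterminant.
Variables (I : eqType) (L : comNzRingType).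
Implicit Types (S : seq I) (f g : I -> I -> L).

(** Rows and columns are named by the same sequence, so that crossings can be added, removed and
    reordered without renumbering ordinals. *)
Definition ndet S f : L :=
  \det (\matrix_(i < size S, j < size S)
          f (tnth (in_tuple S) i) (tnth (in_tuple S) j)).

Lemma ndet_tuple n (t : n.-tuple I) f :
  ndet t f = \det (\matrix_(i < n, j < n) f (tnth t i) (tnth t j)).
Proof.
case: t => s s_n; have sE := eqP s_n; subst n.
by rewrite (_ : Tuple s_n = in_tuple s) //; apply: val_inj.
Qed.

Lemma eq_ndet S f g : {in S &, f =2 g} -> ndet S f = ndet S g.
Proof.
move=> fg; congr (\det _); apply/matrixP => i j; rewrite !mxE.
by apply: fg; apply: mem_tnth.
Qed.

(** Rows and columns undergo the same permutation, so its sign occurs twice. *)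
Lemma ndet_perm S S' f : perm_eq S S' -> ndet S f = ndet S' f.
Proof.
move=> SS'; have /tuple_permP[p ->] : perm_eq S (in_tuple S') by [].
rewrite !ndet_tuple.
rewrite [RHS](_ : _ = ndet (in_tuple S') f); last by [].
rewrite ndet_tuple; set A := (X in _ = \det X).
have -> : (\matrix_(i, j) f (tnth [tuple tnth (in_tuple S') (p i0) | i0 < size S'] i)
   (tnth [tuple tnth (in_tuple S') (p i0) | i0 < size S'] j)) = row_perm p (col_perm p A).
  by apply/matrixP => i j; rewrite !mxE !tnth_mktuple.
rewrite row_permE col_permE !det_mulmx !det_perm odd_permV mulrCA.
by rewrite -signr_addb addbb mulr1.
Qed.

Lemma sum_tnth S (F : I -> L) :
  \sum_(i < size S) F (tnth (in_tuple S) i) = \sum_(x <- S) F x.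
Proof. by rewrite [RHS]big_tnth. Qed.

Lemma ndet_mul S f g :
  ndet S f * ndet S g = ndet S (fun x y => \sum_(z <- S) f x z * g z y).
Proof.
rewrite -det_mulmx; congr (\det _); apply/matrixP => i j.
rewrite !mxE -(sum_tnth S (fun z => f _ z * g z _)).
by apply: eq_bigr => k _; rewrite !mxE.
Qed.

Lemma ndet_rowscale S (r : I -> L) f :
  ndet S (fun x y => r x * f x y) = (\prod_(x <- S) r x) * ndet S f.
Proof.
rewrite /ndet.
rewrite (_ : \prod_(x <- S) r x = \det (diag_mx (\row_i r (tnth (in_tuple S) i)))).
  rewrite -det_mulmx mul_diag_mx; congr (\det _).
  by apply/matrixP => i j; rewrite !mxE.
rewrite det_diag big_tnth.
by apply: eq_bigr => i _; rewrite mxE.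
Qed.

Lemma ndet_tr S f : ndet S (fun x y => f y x) = ndet S f.
Proof.
by rewrite /ndet -det_tr; congr (\det _); apply/matrixP => i j; rewrite !mxE.
Qed.

Lemma ndet_colscale S (r : I -> L) f :
  ndet S (fun x y => f x y * r y) = (\prod_(x <- S) r x) * ndet S f.
Proof.
rewrite -ndet_tr -[ndet S f]ndet_tr -ndet_rowscale.
by apply: eq_ndet => x y _ _; rewrite mulrC.
Qed.

Lemma ndet_cat S1 S2 f : (forall x y, x \in S1 -> y \in S2 -> f x y = 0) ->
  ndet (S1 ++ S2) f = ndet S1 f * ndet S2 f.
Proof.
move=> f0; rewrite (_ : S1 ++ S2 = cat_tuple (in_tuple S1) (in_tuple S2)) //.
rewrite ndet_tuple /ndet.
rewrite -(@det_lblock _ _ _ _ (\matrix_(i, j) f (tnth (in_tuple S2) i) (tnth (in_tuple S1) j))).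
congr (\det _); apply/matrixP => i j; rewrite mxE.
case: (split_ordP i) => i' ->; case: (split_ordP j) => j' ->;
  rewrite ?(block_mxEul, block_mxEur, block_mxEdl, block_mxEdr) ?mxE ?tnth_lshift ?tnth_rshift //.
by rewrite f0 // mem_tnth.
Qed.

Lemma ndet_nil f : ndet [::] f = 1.
Proof. exact: det_mx00. Qed.

Lemma ndet1 u f : ndet [:: u] f = f u u.
Proof. by rewrite /ndet [X in \det X]mx11_scalar det_scalar1 mxE. Qed.

Lemma ndet_cons0 u S f : (forall x, x \in S -> f u x = 0) ->
  ndet (u :: S) f = f u u * ndet S f.
Proof.
by move=> f0; rewrite -cat1s ndet_cat ?ndet1 // => x y; rewrite inE => /eqP-> /f0.
Qed.

(** Schur complement at a diagonal entry 1: the unknown [u] is eliminated by substituting its own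
    equation into the others. *)
Lemma ndet_pivot u S f : f u u = 1 ->
  ndet (u :: S) f = ndet S (fun x y => f x y - f x u * f u y).
Proof.
move=> fuu; rewrite -cat1s.
rewrite (_ : [:: u] ++ S = cat_tuple [tuple u] (in_tuple S)) // ndet_tuple /ndet.
set A := (X in _ = \det X).
pose r := \row_j f u (tnth (in_tuple S) j).
pose c := \col_j f (tnth (in_tuple S) j) u.
have -> : \det A = \det (block_mx 1%:M 0 c 1%:M *m block_mx 1%:M r 0 A : 'M[_]_(1 + size S)).
  by rewrite det_mulmx det_lblock det_ublock !det1 !mul1r.
rewrite mulmx_block !mul1mx !mul0mx mulmx1 !addr0.
congr (\det _); apply/matrixP => i j; rewrite mxE.
case: (split_ordP i) => i' ->; case: (split_ordP j) => j' ->;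
  rewrite ?(block_mxEul, block_mxEur, block_mxEdl, block_mxEdr)
    ?tnth_lshift ?tnth_rshift ?ord1 ?tnth0 ?mxE ?fuu ?eqxx //.
by rewrite big_ord1 !mxE addrC subrK.
Qed.

Lemma ndet_id S : uniq S -> ndet S (fun x y => (x == y)%:R) = 1.
Proof.
elim: S => [|u S IHS] /=; first by rewrite ndet_nil.
case/andP=> uS /IHS IH; rewrite ndet_cons0 ?eqxx ?mul1r //.
by move=> x xS; case: eqP => // ux; rewrite ux xS in uS.
Qed.

Lemma ndet_rowop S u v k f g : uniq S -> u \in S -> v \in S -> u != v ->
  (forall x y, x \in S -> y \in S ->
     g x y = f x y + (if x == v then k * f u y else 0)) ->
  ndet S g = ndet S f.
Proof.
move=> US uS vS uv gE.
(* The elementary matrix of the row operation. Since [u] differs from [v], its row [u] is that of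
   the identity, which makes its determinant computable once [u] is in front. *)
pose e x z : L := (x == z)%:R + (if (x == v) && (z == u) then k else 0).
have e1 : ndet S e = 1.
  rewrite (ndet_perm _ (perm_to_rem uS)) ndet_cons0; last first.
    move=> x xS; rewrite /e (negPf uv) addr0.
    by case: eqP => // ux; move: xS; rewrite -ux mem_rem_uniqF.
  rewrite {1}/e eqxx (negPf uv) addr0 mul1r -(ndet_id (rem_uniq u US)).
  apply: eq_ndet => x y _ yS; rewrite /e.
  case: (eqVneq y u) => [yu|_]; last by rewrite andbF addr0.
  by move: yS; rewrite yu mem_rem_uniqF.
rewrite -[RHS]mul1r -e1 ndet_mul; apply: eq_ndet => x y xS yS.
rewrite gE // /e; under eq_bigr do rewrite mulrDl.
rewrite big_split /=; congr (_ + _).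
  by rewrite (bigD1_seq x) //= eqxx mul1r big1 ?addr0 // => i; rewrite eq_sym => /negPf->; rewrite mul0r.
case: (x == v); last by rewrite big1 // => i _; rewrite mul0r.
rewrite (bigD1_seq u) //= eqxx big1 ?addr0 // => i /negPf->; exact: mul0r.
Qed.

End NamedDeterminant.

Lemma ndet_map (I J : eqType) (L : comNzRingType) (phi : J -> I) (S : seq J)
    (f : I -> I -> L) :
  ndet (map phi S) f = ndet S (fun x y => f (phi x) (phi y)).
Proof.
rewrite (_ : map phi S = map_tuple phi (in_tuple S)) // ndet_tuple.
by congr (\det _); apply/matrixP => i j; rewrite !mxE !tnth_map.
Qed.

(** * The formal system of arcs and its moves *)

Section Intervals.
Variable R : realType.
Implicit Types (I J : R * R) (t s z : R).

Lemma mem_dom I t : (t \in dom I) = (I.1 < t) && (t < I.2).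
Proof. by rewrite /dom in_itv. Qed.

Lemma dom_ltr I t s z : t \in dom I -> s \in dom I -> z \notin dom I ->
  (z < t) = (z < s).
Proof.
rewrite !mem_dom => /andP[? ?] /andP[? ?]; rewrite negb_and -!leNgt => zI.
by apply/idP/idP => ?; case/orP: zI => ?; lra.
Qed.

Lemma dom_ltl I t s z : t \in dom I -> s \in dom I -> z \notin dom I ->
  (t < z) = (s < z).
Proof.
rewrite !mem_dom => /andP[? ?] /andP[? ?]; rewrite negb_and -!leNgt => zI.
by apply/idP/idP => ?; case/orP: zI => ?; lra.
Qed.

Lemma apart_sym I J : apart I J = apart J I.
Proof. by rewrite /apart orbC. Qed.

Lemma apart_dom I J t : apart I J -> t \in dom I -> t \notin dom J.
Proof.
rewrite !mem_dom negb_and -!leNgt => /orP[] ? /andP[? ?]; apply/orP; [left|right]; lra.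
Qed.

Lemma dom_between I t s z : t \in dom I -> s \in dom I -> t <= z <= s -> z \in dom I.
Proof. by rewrite !mem_dom; lra. Qed.

End Intervals.

Lemma uniq_map_inj (T U : eqType) (f : T -> U) (s : seq T) :
  uniq (map f s) -> {in s &, injective f}.
Proof.
elim: s => //= x s IHs /andP[xs us] y z; rewrite !inE.
case/predU1P=> [->|ys] /predU1P[->|zs] // fE.
- by move: xs; rewrite fE map_f.
- by move: xs; rewrite -fE map_f.
exact: IHs.
Qed.

Section FormalArcs.
Variables (R : realType) (L : comNzRingType).

(* The relation [x = wt x * y + ct x * z] expressing the arc [x] that starts at
   time [st x] by the arc [y] passing just before time [it x] and the arc [z]
   passing at time [ot x]. *)
Definition garc : Type := ((R * R * R) * (L * L))%type.
HB.instance Definition _ := Equality.copy garc ((R * R * R) * (L * L))%type.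

Definition st (x : garc) : R := x.1.1.1.
Definition it (x : garc) : R := x.1.1.2.
Definition ot (x : garc) : R := x.1.2.
Definition wt (x : garc) : L := x.2.1.
Definition ct (x : garc) : L := x.2.2.

Implicit Types (S : seq garc) (t : R) (x y z u a : garc).

(* Time [t] belongs to [y]: an arc lasts until the next one starts. *)
Definition on S t y : bool :=
  (st y < t) && all (fun z => (st z <= st y) || (t <= st z)) S.

Definition gmat S x y : L :=
  (x == y)%:R - ct x * (on S (ot x) y)%:R - wt x * (on S (it x) y)%:R.

Definition gdet S : L := ndet S (gmat S).

Lemma on_perm S S' t y : perm_eq S S' -> on S t y = on S' t y.
Proof. by move=> SS'; rewrite /on (perm_all _ SS'). Qed.

Lemma gdet_perm S S' : perm_eq S S' -> gdet S = gdet S'.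
Proof.
move=> SS'; rewrite /gdet (ndet_perm _ SS'); apply: eq_ndet => x y _ _.
by rewrite /gmat !(on_perm _ _ SS').
Qed.

Lemma exists_on S t : (exists2 x, x \in S & st x < t) ->
  exists2 y, y \in S & on S t y.
Proof.
elim: S => [[x //]|u S IHS [x xuS xt]].
have [/hasP[x' x'S x't]|] := boolP (has (fun x => st x < t) S).
  have [y yS] := IHS (ex_intro2 _ _ x' x'S x't).
  rewrite /on => /andP[yt /allP ally].
  have [uy|yu] := leP (st u) (st y).
    by exists y; rewrite ?inE ?yS ?orbT //= yt uy; apply/allP.
  have [tu|ut] := leP t (st u).
    by exists y; rewrite ?inE ?yS ?orbT //= yt tu orbT; apply/allP.
  exists u; rewrite ?inE ?eqxx //= ut lexx; apply/allP => z zS.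
  by have /orP[zy|->] := ally z zS; rewrite ?orbT // (le_trans zy (ltW yu)).
move=> /hasPn noS; have xu : x = u.
  by move: xuS; rewrite inE => /predU1P[//|/noS]; rewrite xt.
exists u; rewrite ?inE ?eqxx // /on -xu xt /= lexx; apply/allP => z /noS.
by rewrite -leNgt => ->; rewrite orbT.
Qed.

Lemma on_inj S t y y' : uniq (map st S) -> y \in S -> y' \in S ->
  on S t y -> on S t y' -> y = y'.
Proof.
move=> US yS y'S /andP[yt /allP ally] /andP[y't /allP ally'].
have := ally _ y'S; have := ally' _ yS.
rewrite [t <= st y]leNgt [t <= st y']leNgt yt y't !orbF => yy' y'y.
by apply: (uniq_map_inj US) => //; apply/eqP; rewrite eq_le yy' y'y.
Qed.

Lemma on_cons u S t y :
  on (u :: S) t y = on S t y && ((st u <= st y) || (t <= st u)).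
Proof. by rewrite /on /= -andbA; congr (_ && _); rewrite andbC. Qed.

Lemma on_drop u S a t y : uniq (map st (u :: S)) -> a \in S ->
  on S (st u) a -> y \in S ->
  (on S t y)%:R = (on (u :: S) t y)%:R + (on (u :: S) t u)%:R * (a == y)%:R :> L.
Proof.
move=> /= /andP[uS US] aS ua yS; rewrite !on_cons {3}/on lexx /= andbT.
have [tu|ut] := leP t (st u); first by rewrite /= orbT andbT mul0r addr0.
rewrite /= orbF; have [au /allP alla] := andP ua.
have neq z : z \in S -> st z != st u.
  by move=> zS; apply: contraNneq uS => <-; apply: map_f.
have [|/allPn[z zS]] := boolP (all (fun z => (st z <= st u) || (t <= st z)) S).
  move=> /allP allu; rewrite mul1r.
  have -> : on S t y = (a == y).
    apply/idP/eqP => [/andP[yt /allP ally]|<-].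
      apply: (on_inj US aS yS ua); rewrite /on.
      have yu : st y < st u.
        have := allu y yS; rewrite [t <= _]leNgt yt orbF => yu.
        by rewrite lt_neqAle yu neq.
      rewrite yu; apply/allP => z zS; have := ally z zS.
      by case/orP=> [->//|tz]; rewrite (ltW (lt_le_trans ut tz)) orbT.
    rewrite /on (lt_trans au ut); apply/allP => z zS.
    have /orP[->//|uz] := alla z zS.
    have := allu z zS; case/orP=> [zu|->]; last by rewrite orbT.
    by have := neq z zS; rewrite eq_le zu uz.
  case: eqVneq => [<-|_]; last by rewrite /= add0r.
  by rewrite leNgt au /= add0r.
rewrite negb_or -!ltNge => /andP[uz zt]; rewrite mul0r addr0.
case yt : (on S t y) => //=.
move: yt => /andP[_ /allP/(_ z zS)]; rewrite [t <= _]leNgt zt orbF => zy.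
by rewrite (le_trans (ltW uz) zy).
Qed.

(** Row [u] says [k * (u - a) = 0]. After extraction of [k] it identifies [u] with its predecessor,
    and eliminating [u] leaves the system in which that arc never started. The factor [k] is what
    the first move produces. *)
Lemma ndet_drop u S a k f : uniq (map st (u :: S)) -> a \in S ->
  on S (st u) a ->
  (forall x y, x \in S -> y \in u :: S -> f x y = gmat (u :: S) x y) ->
  (forall y, y \in u :: S -> f u y = k * ((u == y)%:R - (a == y)%:R)) ->
  ndet (u :: S) f = k * gdet S.
Proof.
move=> US aS ua row_S row_u; rewrite /gdet.
have uS : u \notin S by move: US => /= /andP[uS _]; apply: contra uS => /(map_f st).
have neq x : x \in S -> (x == u = false) * (u == x = false).
  by move=> xS; rewrite eq_sym; case: eqP => // ux; rewrite ux xS in uS.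
pose g x y := if x == u then (u == y)%:R - (a == y)%:R else f x y.
rewrite (@eq_ndet _ _ _ _ (fun x y => (if x == u then k else 1) * g x y)); last first.
  move=> x y _ yuS; rewrite /g; case: eqP => [->|_]; first exact: row_u.
  by rewrite mul1r.
rewrite ndet_rowscale big_cons eqxx big1_seq => [|x /= xS]; last by rewrite neq.
rewrite mulr1; congr (_ * _).
rewrite ndet_pivot; last by rewrite /g !eqxx (neq a) // subr0.
apply: eq_ndet => x y xS yS; rewrite /g eqxx !(neq x) // (neq y) // sub0r mulrN opprK.
rewrite !row_S ?inE ?eqxx ?yS ?orbT // /gmat (neq x) // sub0r.
rewrite !(on_drop _ US aS ua yS); ring.
Qed.

Lemma on_start u S a y : uniq (map st (u :: S)) -> a \in S -> on S (st u) a ->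
  y \in u :: S -> on (u :: S) (st u) y = (a == y).
Proof.
move=> US aS ua; rewrite inE => /predU1P[->|yS].
  rewrite /on ltxx; apply/esym; apply/eqP => au.
  by move: ua; rewrite au /on ltxx.
rewrite on_cons lexx orbT andbT; apply/idP/eqP => [|<-//].
by apply: on_inj => //; case/andP: US.
Qed.

(** If the overpass of the kink comes first, it lies on the predecessor [a] and the row is [u - a].
    Otherwise it lies on [u] itself and the row is [wt u * (u - a)]. *)
Lemma gdet_kink S u I : uniq (map st (u :: S)) ->
  (exists2 x, x \in S & st x < st u) ->
  it u = st u -> ct u = 1 - wt u -> st u \in dom I -> ot u \in dom I ->
  ot u != st u -> (forall x, x \in S -> st x \notin dom I) ->
  gdet (u :: S) = (if ot u < st u then 1 else wt u) * gdet S.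
Proof.
move=> US /exists_on[a aS ua] iu cu sI oI ne outI.
apply: (ndet_drop US aS ua) => // y yuS; rewrite /gmat iu cu (on_start US aS ua yuS).
have oy : on (u :: S) (ot u) y = (if ot u < st u then a == y else u == y).
  have [ou|uo|E] := ltgtP (ot u) (st u); last by rewrite E eqxx in ne.
    rewrite -(on_start US aS ua yuS) /on (_ : (st y < _) = (st y < st u)); last first.
      move: yuS; rewrite inE => /predU1P[->|/outI yI]; last exact: dom_ltr yI.
      by rewrite ltxx ltNge (ltW ou).
    congr (_ && _); apply: eq_in_all => z; rewrite inE => /predU1P[->|/outI zI].
      by rewrite lexx (ltW ou).
    by congr (_ || _); rewrite !leNgt (dom_ltr oI sI zI).
  move: yuS; rewrite inE => /predU1P[->|yS].
    rewrite /on uo eqxx /= lexx /=; apply/allP => z zS.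
    have := dom_ltr oI sI (outI z zS); rewrite [_ <= st z]leNgt => ->.
    by have [//|zu] := leP (st z) (st u); rewrite ltNge (ltW zu).
  rewrite on_cons [ot u <= _]leNgt uo orbF.
  have uy : u != y by case/andP: US => + _; apply: contraNneq => ->; apply: map_f.
  rewrite (negPf uy) /on (dom_ltr oI sI (outI y yS)).
  by have [yu|] := ltP (st y) (st u); rewrite ?andbF.
by rewrite oy; case: ifP => _; case: (a == y); case: (u == y); rewrite /=; ring.
Qed.

End FormalArcs.

Arguments st {R L} x.
Arguments it {R L} x.
Arguments ot {R L} x.
Arguments wt {R L} x.
Arguments ct {R L} x.

(** * The second move on formal arcs, and comparison of systems with different times *)

Section FormalMoves.
Variables (R : realType) (L : comNzRingType).
Local Notation garc := (garc R L).
Implicit Types (S : seq garc) (t : R) (x y z u a : garc).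

(** The strand passes twice under the same arc [z]: with [a] the arc before,
    [u1 = wt u1 * a + ct u1 * z] and [u2 = wt u2 * u1 + ct u2 * z]. Substituting the first into the
    second gives [u2 = a], so both rows disappear. *)
Lemma gdet_bigon_lt S u1 u2 I J : uniq (map st (u1 :: u2 :: S)) ->
  (exists2 x, x \in S & st x < st u1) ->
  it u1 = st u1 -> it u2 = st u2 -> st u1 < st u2 ->
  wt u1 * wt u2 = 1 -> ct u2 + wt u2 * ct u1 = 0 -> apart I J ->
  st u1 \in dom I -> st u2 \in dom I -> ot u1 \in dom J -> ot u2 \in dom J ->
  (forall x, x \in S -> [/\ st x \notin dom I, it x \notin dom I, ot x \notin dom I &
     st x \notin dom J]) ->
  gdet (u1 :: u2 :: S) = gdet S.
Proof.
move=> US [b bS bu] i1 i2 lt12 w12 c12 IJ s1 s2 o1 o2 outS.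
have US2 : uniq (map st (u2 :: S)) by case/andP: US.
have [a aS a1] : exists2 a, a \in S & on S (st u1) a.
  by apply: exists_on; exists b.
have a2 : on S (st u2) a.
  have outI z : z \in S -> (st z < st u2) = (st z < st u1).
    by move=> /outS[zI _ _ _]; exact: dom_ltr s2 s1 zI.
  move: a1; rewrite /on (outI a aS) => /andP[-> /allP alla]; apply/allP => z zS.
  by rewrite [st u2 <= _]leNgt outI // -leNgt alla.
have n12 : u1 != u2 by apply: contraTneq lt12 => ->; rewrite ltxx.
have JI : apart J I by rewrite apart_sym.
have o1I := apart_dom JI o1; have o2I := apart_dom JI o2.
set W := u1 :: u2 :: S.
have onW1 t : t \notin dom I -> on W t u1 = false.
  move=> tI; rewrite /on /=; have [ut|//] := ltP (st u1) t.
  by rewrite lexx leNgt lt12 /= leNgt -(dom_ltl s1 s2 tI) ut.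
have onW t y : t \notin dom I -> y \in u2 :: S -> on W t y = on (u2 :: S) t y.
  move=> tI; rewrite /W on_cons inE => /predU1P[->|yS].
    by rewrite (ltW lt12) andbT.
  rewrite on_cons -andbA; congr (_ && _); have [yI _ _ _] := outS y yS.
  rewrite ![t <= _]leNgt (dom_ltl s1 s2 tI).
  by rewrite ![_ <= st y]leNgt (dom_ltr s1 s2 yI) andbb.
have m12 y : y \in u2 :: S -> (u1 == y) = false.
  by move=> y2; apply: contraTF US => /eqP->; rewrite map_cons cons_uniq (map_f st y2).
have on2 y : y \in W -> on W (st u2) y = (y == u1).
  rewrite inE => /predU1P[->|]; first rewrite eqxx.
    rewrite /on /= lt12 !lexx orbT /=; apply/allP => z zS; have [zI _ _ _] := outS z zS.
    by rewrite [st u2 <= _]leNgt (dom_ltr s2 s1 zI); case: ltP => [/ltW->|]; rewrite ?orbT.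
  move=> y2S; rewrite eq_sym m12 //; move: y2S; rewrite inE => /predU1P[->|yS].
    by rewrite /on ltxx.
  have [yI _ _ _] := outS y yS; apply/negP => /andP[y2 /andP[]].
  by rewrite [st u2 <= _]leNgt lt12 orbF leNgt -(dom_ltr s2 s1 yI) y2.
have on1 y : y \in u2 :: S -> on W (st u1) y = (a == y).
  move=> yS; have US1 : uniq (map st (u1 :: u2 :: S)) by [].
  apply: (on_start US1); first by rewrite inE aS orbT.
    by rewrite on_cons a1 (ltW lt12) orbT.
  by rewrite inE yS orbT.
have u1W : u1 \in W by rewrite inE eqxx.
have u2W : u2 \in W by rewrite !inE eqxx orbT.
rewrite /gdet ndet_pivot; last first.
  by rewrite /gmat i1 eqxx onW1 // {1}/on ltxx !mulr0 !subr0.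
rewrite -[RHS]mul1r; apply: (ndet_drop US2 aS a2) => [x y xS yS|y yS].
  have [_ iI oI _] := outS x xS.
  rewrite {2}/gmat !onW1 // [x == u1]eq_sym m12 ?inE ?xS ?orbT // !mulr0 !subr0 mul0r subr0.
  by rewrite /gmat !onW.
have oE : on W (ot u1) y = on W (ot u2) y.
  have sJ z : z \in W -> st z \notin dom J.
    rewrite !inE => /or3P[/eqP->|/eqP->|/outS[]//].
      exact: apart_dom IJ s1.
    exact: apart_dom IJ s2.
  have yW : y \in W by rewrite inE yS orbT.
  rewrite /on (dom_ltr o1 o2 (sJ y yW)); congr (_ && _); apply: eq_in_all => z zW.
  by congr (_ || _); rewrite !leNgt (dom_ltr o1 o2 (sJ z zW)).
have yW : y \in W by rewrite inE yS orbT.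
rewrite /gmat i1 i2 !on2 // on1 // oE (onW1 _ o2I) eqxx [y == u1]eq_sym !(m12 y yS).
rewrite [u2 == u1]eq_sym (negPf n12) /=.
rewrite !mulr0 !sub0r !subr0 mulr1.
transitivity ((u2 == y)%:R - (ct u2 + wt u2 * ct u1) * (on W (ot u2) y)%:R
   - (wt u1 * wt u2) * (a == y)%:R); first by ring.
by rewrite c12 w12 mul0r subr0 !mul1r.
Qed.

Lemma gdet_bigon S u1 u2 I J : uniq (map st (u1 :: u2 :: S)) ->
  (exists2 x, x \in S & st x < st u1) ->
  it u1 = st u1 -> it u2 = st u2 ->
  wt u1 * wt u2 = 1 -> ct u2 + wt u2 * ct u1 = 0 -> apart I J ->
  st u1 \in dom I -> st u2 \in dom I -> ot u1 \in dom J -> ot u2 \in dom J ->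
  (forall x, x \in S -> [/\ st x \notin dom I, it x \notin dom I, ot x \notin dom I &
     st x \notin dom J]) ->
  gdet (u1 :: u2 :: S) = gdet S.
Proof.
move=> US bS i1 i2 w12 c12 IJ s1 s2 o1 o2 outS.
have [lt12|lt21|eq12] := ltgtP (st u1) (st u2).
- exact: gdet_bigon_lt lt12 w12 c12 IJ s1 s2 o1 o2 outS.
- rewrite (@gdet_perm _ _ _ (u2 :: u1 :: S)); last first.
    exact/permPl/(perm_catCA [:: u1] [:: u2]).
  apply: (gdet_bigon_lt _ _ _ _ lt21 _ _ IJ s2 s1 o2 o1 outS) => //.
  + by move: US; rewrite /= !inE !negb_or [st u1 == _]eq_sym => /andP[/andP[-> ->] /andP[-> ->]].
  + case: bS => x xS xu; exists x => //; have [xI _ _ _] := outS x xS.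
    by rewrite (dom_ltr s2 s1 xI).
  + by rewrite mulrC.
  (* The coefficient condition is symmetric in the two rows: multiply it by [wt u1], the inverse of
     [wt u2]. *)
  by rewrite -[ct u1]mul1r -w12 -mulrA -mulrDr addrC c12 mulr0.
by move: US; rewrite /= eq12 inE eqxx.
Qed.

(** [st u] is the only start inside the interval, so the current arc there depends only on the side
    of [st u]. [on_dom_gt] is the other side. *)
Lemma on_dom_le S u I t y : u \in S -> y \in S -> st u \in dom I -> t \in dom I ->
  (forall x, x \in S -> x != u -> st x \notin dom I) -> t <= st u ->
  on S t y = on S (st u) y.
Proof.
move=> uS yS sI tI outI tu.
have lt z : z \in S -> (st z < t) = (st z < st u).
  move=> zS; case: (eqVneq z u) => [->|/(outI z zS) zI]; last exact: dom_ltr zI.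
  by rewrite ltxx ltNge tu.
rewrite /on lt //; congr (_ && _); apply: eq_in_all => z zS.
by congr (_ || _); rewrite !leNgt lt.
Qed.

Lemma on_dom_gt S u I t y : u \in S -> y \in S -> st u \in dom I -> t \in dom I ->
  (forall x, x \in S -> x != u -> st x \notin dom I) -> st u < t ->
  on S t y = (y == u).
Proof.
move=> uS yS sI tI outI ut; apply/idP/eqP => [|->].
  move=> /andP[yt /allP/(_ u uS)]; rewrite [t <= _]leNgt ut orbF => uy.
  apply/eqP; apply: contraLR (yt) => /(outI y yS) yI.
  by rewrite (dom_ltr tI sI yI) -leNgt.
rewrite /on ut; apply/allP => z zS.
case: (eqVneq z u) => [->|/(outI z zS) zI]; first by rewrite lexx.
by rewrite [t <= _]leNgt (dom_ltr tI sI zI); case: ltP => [/ltW->|]; rewrite ?orbT.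
Qed.

Lemma on_congr (Z : seq (garc * garc)) t t' p :
  {in Z &, forall p q, (st p.1 < st q.1) = (st p.2 < st q.2)} ->
  {in Z, forall q, (st q.1 < t) = (st q.2 < t')} -> p \in Z ->
  on (unzip1 Z) t p.1 = on (unzip2 Z) t' p.2.
Proof.
move=> mono tt' pZ; rewrite /on tt' // /unzip1 /unzip2 !all_map.
congr (_ && _); apply: eq_in_all => q qZ /=.
by rewrite !leNgt tt' // mono.
Qed.

Lemma unzip1_start_inj (Z : seq (garc * garc)) :
  uniq (map st (unzip1 Z)) -> {in Z &, forall p q, (p.1 == q.1) = (p == q)}.
Proof.
rewrite /unzip1 -map_comp => UZ p q pZ qZ.
by apply/eqP/eqP => [E|->//]; apply: (uniq_map_inj UZ) => //=; rewrite E.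
Qed.

Lemma unzip2_start_inj (Z : seq (garc * garc)) :
  uniq (map st (unzip2 Z)) -> {in Z &, forall p q, (p.2 == q.2) = (p == q)}.
Proof.
rewrite /unzip2 -map_comp => UZ p q pZ qZ.
by apply/eqP/eqP => [E|->//]; apply: (uniq_map_inj UZ) => //=; rewrite E.
Qed.

(* Only the order of the starts and their position among the other times
   matter. *)
Lemma gdet_congr (Z : seq (garc * garc)) :
  uniq (map st (unzip1 Z)) -> uniq (map st (unzip2 Z)) ->
  {in Z &, forall p q, (st p.1 < st q.1) = (st p.2 < st q.2)} ->
  {in Z &, forall p q, (st p.1 < it q.1) = (st p.2 < it q.2)} ->
  {in Z, forall q, ct q.1 != 0 -> {in Z, forall p, (st p.1 < ot q.1) = (st p.2 < ot q.2)}} ->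
  {in Z, forall p, wt p.1 = wt p.2 /\ ct p.1 = ct p.2} ->
  gdet (unzip1 Z) = gdet (unzip2 Z).
Proof.
move=> U1 U2 mono Hi Ho Hw; rewrite /gdet {1}/unzip1 {2}/unzip2 !ndet_map.
apply: eq_ndet => p q pZ qZ; have [w c] := Hw p pZ.
rewrite /gmat (unzip1_start_inj U1) // (unzip2_start_inj U2) // w c; congr (_ - _ - _).
  (* A row with [ct = 0], such as that of [base], puts no condition on its overpass time. *)
  have [->|c0] := eqVneq (ct p.2) 0; first by rewrite !mul0r.
  congr (_ * _%:R); congr nat_of_bool.
  by apply: (on_congr mono) => // r rZ; apply: Ho; rewrite // c.
congr (_ * _%:R); congr nat_of_bool.
by apply: (on_congr mono) => // r rZ; apply: Hi.
Qed.

(** The arc started by [f] is ended by [l] within the same interval, so it is invisible outside [C];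
    this is what allows its elimination. *)
Lemma on_first S f l C t : f \in S -> l \in S -> st f < st l ->
  st f \in dom C -> st l \in dom C -> t \notin dom C -> on S t f = false.
Proof.
move=> fS lS fl fC lC tC; apply/negP => /andP[ft /allP/(_ l lS)].
by rewrite leNgt fl /= leNgt -(dom_ltl fC lC tC) ft.
Qed.

Lemma on_second S f l C y : uniq (map st S) -> f \in S -> l \in S -> y \in S ->
  st f < st l -> st f \in dom C -> st l \in dom C ->
  (forall x, x \in S -> x != f -> x != l -> st x \notin dom C) ->
  on S (st l) y = (y == f).
Proof.
move=> US fS lS yS fl fC lC outC.
have onf : on S (st l) f.
  rewrite /on fl; apply/allP => z zS.
  have [->|zf] := eqVneq z f; first by rewrite lexx.
  have [->|zl] := eqVneq z l; first by rewrite lexx orbT.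
  rewrite [st l <= _]leNgt (dom_ltr lC fC (outC z zS zf zl)).
  by case: ltP => [/ltW->|]; rewrite ?orbT.
by apply/idP/eqP => [yl|->//]; exact: on_inj yl onf.
Qed.

End FormalMoves.

(** * The third move on formal arcs *)

Section Triangle.
Variables (R : realType) (L : comNzRingType).
Local Notation garc := (garc R L).
Implicit Types (S : seq garc) (t : R) (x y z u a : garc).

Lemma apart_lt (I J : R * R) t t' s s' : apart I J -> t \in dom I -> t' \in dom I ->
  s \in dom J -> s' \in dom J -> (t < s) = (t' < s').
Proof.
move=> IJ tI t'I sJ s'J; rewrite (dom_ltl tI t'I); last by apply: apart_dom sJ; rewrite apart_sym.
by rewrite (dom_ltr sJ s'J) // (apart_dom IJ).
Qed.

Definition outside (I : R * R) x : bool :=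
  [&& st x \notin dom I, it x \notin dom I & ot x \notin dom I].

(** [A] is the top strand, [B] the middle one and [C] the bottom one. Row [b] is the crossing of [A]
    over [B]; [f] and [l] are the first and the last undercrossing on [C]. On one side of the move
    [C] meets [A] first, on the other (primed) side it meets [B] first, so [f] and [l'] pass under
    [A] while [l] and [f'] pass under [B]. [X] tells whether, in the unprimed picture, [B] meets [A]
    before [C]. *)
Variables (S : seq garc) (b f l b' f' l' : garc) (A B C : R * R) (X : bool) (k : L).
Hypotheses (U1 : uniq (map st (b :: f :: l :: S)))
  (U2 : uniq (map st (b' :: f' :: l' :: S))).
Hypotheses (AB : apart A B) (AC : apart A C) (BC : apart B C).
Hypotheses (outS : {in S, forall x, [/\ outside A x, outside B x & outside C x]}).
Hypotheses (itE : all (fun x => it x == st x) [:: b; f; l; b'; f'; l']).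
Hypotheses (bB : st b \in dom B) (b'B : st b' \in dom B)
  (bA : ot b \in dom A) (b'A : ot b' \in dom A)
  (fC : st f \in dom C) (f'C : st f' \in dom C)
  (lC : st l \in dom C) (l'C : st l' \in dom C)
  (fA : ot f \in dom A) (lB : ot l \in dom B)
  (f'B : ot f' \in dom B) (l'A : ot l' \in dom A).
Hypotheses (fl : st f < st l) (fl' : st f' < st l').
Hypotheses (lX : (st b < ot l) = X) (f'X : (st b' < ot f') = ~~ X).
Hypotheses (wb : wt b' = wt b) (cb : ct b' = ct b) (wf : wt f' = wt l)
  (cf : ct f' = ct l) (wl : wt l' = wt f) (cl : ct l' = ct f).
Hypothesis kE : if X then
    [/\ k = - ct l, ct l * wt f = ct l * wt b & ct f * (1 - wt l) = ct l * ct b]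
  else [/\ k = wt f * ct l, wt f * wt b * ct l = ct l &
           ct f * (1 - wt l) = - (wt f * ct l * ct b)].

Let Z : seq (garc * garc) :=
  [:: (f, f'), (l, l'), (b, b') & [seq (x, x) | x <- S]].

Let inZ p : p \in Z -> [\/ p = (f, f'), p = (l, l'), p = (b, b') |
  exists2 x, x \in S & p = (x, x)].
Proof.
rewrite !inE => /or4P[/eqP|/eqP|/eqP|/mapP[x xS]] ->; [exact: Or41|exact: Or42|exact: Or43|].
by apply: Or44; exists x.
Qed.

Let unzip1Z : unzip1 Z = [:: f, l, b & S].
Proof. by rewrite /unzip1 /= -map_comp map_id. Qed.

Let unzip2Z : unzip2 Z = [:: f', l', b' & S].
Proof. by rewrite /unzip2 /= -map_comp map_id. Qed.

Let perm3 (x y z : garc) : perm_eq [:: z, x, y & S] [:: x, y, z & S].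
Proof. exact/permPl/(perm_catCA [:: z] [:: x; y]). Qed.

Let UZ1 : uniq (map st (unzip1 Z)).
Proof. by rewrite unzip1Z -(perm_uniq (perm_map st (perm3 f l b))). Qed.

Let UZ2 : uniq (map st (unzip2 Z)).
Proof. by rewrite unzip2Z -(perm_uniq (perm_map st (perm3 f' l' b'))). Qed.

Let outSt I x : outside I x -> st x \notin dom I.
Proof. by case/and3P. Qed.

Let BA : apart B A. Proof. by rewrite apart_sym. Qed.
Let CA : apart C A. Proof. by rewrite apart_sym. Qed.
Let CB : apart C B. Proof. by rewrite apart_sym. Qed.

Let monoZ : {in Z &, forall p q, (st p.1 < st q.1) = (st p.2 < st q.2)}.
Proof.
move=> p q /inZ[->|->|->|[x xS ->]] /inZ[->|->|->|[y yS ->]] /=;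
  rewrite ?ltxx //; try (by rewrite ?fl ?fl' // ltNge ltW // ltNge ltW);
  try (exact: apart_lt BC _ _ _ _); try exact: apart_lt CB _ _ _ _;
  try have [/outSt xA /outSt xB /outSt xC] := outS xS;
  try have [/outSt yA /outSt yB /outSt yC] := outS yS;
  first [exact: (dom_ltr fC)|exact: (dom_ltr lC)|exact: (dom_ltr bB)|
         exact: (dom_ltl fC)|exact: (dom_ltl lC)|exact: (dom_ltl bB)].
Qed.

Let timesA t t' : t \in dom A -> t' \in dom A ->
  {in Z, forall q, (st q.1 < t) = (st q.2 < t')}.
Proof.
move=> tA t'A q /inZ[->|->|->|[x xS ->]] /=; try exact: apart_lt CA _ _ _ _.
  exact: apart_lt BA _ _ _ _.
by have [/outSt xA _ _] := outS xS; exact: dom_ltr xA.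
Qed.

Let timesS t : t \notin dom B -> t \notin dom C ->
  {in Z, forall q, (st q.1 < t) = (st q.2 < t)}.
Proof.
move=> tB tC q /inZ[->|->|->|[x xS ->]] //=.
- exact: dom_ltl tC.
- exact: dom_ltl tC.
exact: dom_ltl tB.
Qed.

Let W1 := unzip1 Z.
Let W2 := unzip2 Z.

Let inW1 x : x \in W1 -> [\/ x = f, x = l, x = b | x \in S].
Proof.
rewrite /W1 unzip1Z !inE => /or4P[/eqP|/eqP|/eqP|] H;
  [exact: Or41|exact: Or42|exact: Or43|exact: Or44].
Qed.

Let inW2 x : x \in W2 -> [\/ x = f', x = l', x = b' | x \in S].
Proof.
rewrite /W2 unzip2Z !inE => /or4P[/eqP|/eqP|/eqP|] H;
  [exact: Or41|exact: Or42|exact: Or43|exact: Or44].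
Qed.

Let outB1 x : x \in W1 -> x != b -> st x \notin dom B.
Proof.
move=> /inW1[->|->|->|/outS[_ /outSt//]]; rewrite ?eqxx // => _; exact: apart_dom CB _.
Qed.

Let outB2 x : x \in W2 -> x != b' -> st x \notin dom B.
Proof.
move=> /inW2[->|->|->|/outS[_ /outSt//]]; rewrite ?eqxx // => _; exact: apart_dom CB _.
Qed.

Let outC1 x : x \in W1 -> x != f -> x != l -> st x \notin dom C.
Proof.
move=> /inW1[->|->|->|/outS[_ _ /outSt//]]; rewrite ?eqxx // => _ _; exact: apart_dom BC _.
Qed.

Let outC2 x : x \in W2 -> x != f' -> x != l' -> st x \notin dom C.
Proof.
move=> /inW2[->|->|->|/outS[_ _ /outSt//]]; rewrite ?eqxx // => _ _; exact: apart_dom BC _.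
Qed.

Let memW1 : [/\ f \in W1, l \in W1 & b \in W1].
Proof. by rewrite /W1 unzip1Z !inE !eqxx !orbT. Qed.

Let memW2 : [/\ f' \in W2, l' \in W2 & b' \in W2].
Proof. by rewrite /W2 unzip2Z !inE !eqxx !orbT. Qed.

Let onA t t' p : t \in dom A -> t' \in dom A -> p \in Z -> on W1 t p.1 = on W2 t' p.2.
Proof. by move=> tA t'A; apply: (on_congr monoZ); exact: timesA. Qed.

Let onst p q : p \in Z -> q \in Z -> on W1 (st p.1) q.1 = on W2 (st p.2) q.2.
Proof. by move=> pZ; apply: (on_congr monoZ) => r rZ; apply: monoZ. Qed.

Let memZ p : p \in Z -> (p.1 \in W1) * (p.2 \in W2).
Proof. by move=> pZ; rewrite /W1 /W2 !map_f. Qed.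

(** Once the short arcs [f] and [f'] are eliminated, only the rows of [l] and [l'] differ. One of
    them contains the arc of [B] before its crossing with [A] and the other the arc [b] after it;
    [kE] makes their difference equal to [k] times row [b]. *)
Lemma gdet_triangle : gdet (b :: f :: l :: S) = gdet (b' :: f' :: l' :: S).
Proof.
rewrite (gdet_perm (perm3 f l b)) (gdet_perm (perm3 f' l' b')) -unzip1Z -unzip2Z.
rewrite /gdet {1}/unzip1 {2}/unzip2 !ndet_map.
have [fW lW bW] := memW1; have [fW' lW' bW'] := memW2.
have [ib i_f il] : [/\ it b = st b, it f = st f & it l = st l].
  by case/and4P: itE => /eqP ? /eqP ? /eqP ? _.
have [ib' if' il'] : [/\ it b' = st b', it f' = st f' & it l' = st l'].
  by move: itE => /= /and5P[_ _ _ /eqP ? /and3P[/eqP ? /eqP ? _]].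
have cst1 t : t \notin dom C -> on W1 t f = false by apply: on_first fl fC lC.
have cst2 t : t \notin dom C -> on W2 t f' = false by apply: on_first fl' f'C l'C.
have col1 : on W1 (st l) f by rewrite (on_second UZ1 fW lW fW fl fC lC) ?eqxx.
have col2 : on W2 (st l') f' by rewrite (on_second UZ2 fW' lW' fW' fl' f'C l'C) ?eqxx.
have fZ : (f, f') \in Z by rewrite !inE eqxx.
have lZ : (l, l') \in Z by rewrite !inE eqxx orbT.
have bZ : (b, b') \in Z by rewrite !inE eqxx !orbT.
have nA t : t \in dom A -> t \notin dom C by apply: apart_dom.
have nB t : t \in dom B -> t \notin dom C by apply: apart_dom.
have pZ' p : p \in behead Z -> p \in Z by rewrite !inE => ->; rewrite orbT.
have lZ' : (l, l') \in behead Z by rewrite !inE eqxx.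
have bZ' : (b, b') \in behead Z by rewrite !inE eqxx orbT.
have UZ : uniq Z by exact: (map_uniq (map_uniq UZ1)).
have pf p : p \in behead Z -> (p.1 == f = false) * (p.2 == f' = false).
  move=> pZ; have /= -> := unzip1_start_inj UZ1 (pZ' p pZ) fZ.
  have /= -> := unzip2_start_inj UZ2 (pZ' p pZ) fZ.
  have : p != (f, f') by apply: contraTneq UZ => pE; rewrite /= -pE pZ.
  by move=> /negPf->.
(* Elimination of [f], then of [f']: neither arc contains a time that its own row refers to, so both
   pivots are 1. *)
rewrite -/W1 -/W2 /Z [LHS]ndet_pivot; last first.
  by rewrite /gmat /= i_f eqxx (cst1 _ (nA _ fA)) /on ltxx /= !mulr0 !subr0.
rewrite [RHS]ndet_pivot; last first.
  by rewrite /gmat /= if' eqxx (cst2 _ (nB _ f'B)) /on ltxx /= !mulr0 !subr0.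
apply: (@ndet_rowop _ _ _ (b, b') (l, l') k).
- by case/andP: UZ.
- by rewrite !inE eqxx !orbT.
- by rewrite !inE eqxx.
- by move: UZ => /= /and3P[_ + _]; rewrite inE negb_or eq_sym => /andP[].
move=> p q pZ qZ.
have [qZ1 pZ1] := (pZ' q qZ, pZ' p pZ).
have onX1 : on W1 (ot l) q.1 = if X then q == (b, b') else on W1 (st b) q.1.
  rewrite -lX; case: ltP => lb; last by rewrite (on_dom_le _ _ bB lB outB1) // memZ.
  rewrite (on_dom_gt _ _ bB lB outB1) // ?memZ //.
  exact: unzip1_start_inj UZ1 _ _ qZ1 bZ.
have onX2 : on W2 (ot f') q.2 = if X then on W1 (st b) q.1 else q == (b, b').
  rewrite (onst bZ qZ1) /= -[X]negbK -f'X if_neg; case: ltP => fb.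
    rewrite (on_dom_gt _ _ b'B f'B outB2) // ?memZ //.
    exact: unzip2_start_inj UZ2 _ _ qZ1 bZ.
  by rewrite (on_dom_le _ _ b'B f'B outB2) // memZ.
have gb : gmat W2 b' q.2 = (q == (b, b'))%:R - ct b * (on W1 (ot b) q.1)%:R
    - wt b * (on W1 (st b) q.1)%:R.
  rewrite /gmat wb cb ib' (onA bA b'A qZ1) (onst bZ qZ1).
  by rewrite -(unzip2_start_inj UZ2 qZ1 bZ) eq_sym.
have gb0 : gmat W2 b' f' = 0.
  rewrite /gmat ib' (cst2 _ (nA _ b'A)) (cst2 _ (nB _ b'B)) !mulr0 !subr0.
  by have /= -> := (pf _ bZ').2.
case: eqVneq => [->|pl] /=.
  rewrite gb gb0 mul0r subr0 /gmat i_f il if' il' wf cf wl cl.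
  have /= -> := (pf _ lZ').1; have /= -> := (pf _ lZ').2.
  rewrite (cst1 _ (nB _ lB)) (cst2 _ (nA _ l'A)) col1 col2 /=.
  rewrite [f == _]eq_sym [f' == _]eq_sym !pf //.
  have /= -> := unzip1_start_inj UZ1 lZ qZ1; have /= -> := unzip2_start_inj UZ2 lZ qZ1.
  rewrite onX1 onX2 -(onA fA l'A qZ1) -(onst fZ qZ1) /=.
  rewrite (onA bA fA qZ1) -(onA fA fA qZ1).
  rewrite -[on W2 (st l') q.2]/(on W2 (st (l, l').2) q.2) -(onst lZ qZ1) /=.
  rewrite (on_second UZ1 fW lW _ fl fC lC) // ?memZ // pf //=.
  move: (on W1 (ot f) q.1)%:R (on W1 (st f) q.1)%:R ((l, l') == q)%:R => va vc ve.
  case: (X) kE => -[-> E1 E2]; apply/subr0_eq.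
    transitivity (va * (ct f * (1 - wt l) - ct l * ct b)
        + (on W1 (st b) q.1)%:R * (ct l * wt f - ct l * wt b)); first by ring.
    by rewrite E1 E2 !subrr !mulr0 addr0.
  transitivity (va * (ct f * (1 - wt l) - - (wt f * ct l * ct b))
      + (on W1 (st b) q.1)%:R * (wt f * wt b * ct l - ct l)); first by ring.
  by rewrite E1 E2 !subrr !mulr0 addr0.
rewrite addr0.
have pcase : p = (b, b') \/ exists2 x, x \in S & p = (x, x).
  case/inZ: pZ1 (pf p pZ).1 pl => [->|->|->|?]; rewrite ?eqxx //; first by left.
  by right.
have row0 : (gmat W1 p.1 f = 0) * (gmat W2 p.2 f' = 0).
  rewrite /gmat !pf //; case: pcase => [->|[x xS ->]] /=.
    rewrite ib ib' (cst1 _ (nA _ bA)) (cst1 _ (nB _ bB)).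
    by rewrite (cst2 _ (nA _ b'A)) (cst2 _ (nB _ b'B)) !mulr0 !subr0.
  have [_ _ /and3P[_ iC oC]] := outS xS.
  by rewrite !(cst1 _ iC) !(cst1 _ oC) !(cst2 _ iC) !(cst2 _ oC) !mulr0 !subr0.
rewrite !row0 !mul0r !subr0; case: pcase => [->|[x xS pE]] /=.
  by rewrite gb /gmat -(unzip1_start_inj UZ1 qZ1 bZ) eq_sym ib.
rewrite /gmat (unzip1_start_inj UZ1) // (unzip2_start_inj UZ2) // pE /=.
have [_ /and3P[_ iB oB] /and3P[_ iC oC]] := outS xS.
by rewrite !(on_congr monoZ (timesS iB iC)) // !(on_congr monoZ (timesS oB oC)).
Qed.

End Triangle.

(** * Laurent polynomials and the ring T *)

Section LaurentTheory.
Variable R : comNzRingType.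
Local Notation laurent := (laurent R).
Implicit Types (P Q : {poly {poly R}}) (z : laurent) (k : int) (c : R).

Definition lpi P : laurent := \pi_laurent P.

Lemma lpi_is_zmod : zmod_morphism lpi.
Proof. by move=> P Q; rewrite /lpi !piE. Qed.

Lemma lpi_is_monoid : monoid_morphism lpi.
Proof. by split=> [|P Q]; rewrite /lpi !piE. Qed.

HB.instance Definition _ :=
  GRing.isZmodMorphism.Build {poly {poly R}} laurent lpi lpi_is_zmod.
HB.instance Definition _ :=
  GRing.isMonoidMorphism.Build {poly {poly R}} laurent lpi lpi_is_monoid.

Lemma lpi_repr z : lpi (repr z) = z.
Proof. by rewrite /lpi reprK. Qed.

Lemma lpi_eq0P P : reflect (exists Q, P = Q * ('X * 'X%:P - 1)) (lpi P == 0).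
Proof.
have -> : (lpi P == 0) = (P \in gen_ideal (laurent_rel R)).
  rewrite -[0](rmorph0 lpi) /lpi.
  have := Quotient.idealrBE (proper_gen_ideal (@laurent_rel_proper R)) P 0.
  by rewrite subr0 => ->.
apply: (iffP (asboolP _)) => [[a ->]|[Q ->]].
  by exists (a 0); rewrite big_ord1.
by exists (fun=> Q); rewrite big_ord1.
Qed.

Lemma lcst_is_zmod : zmod_morphism (@lcst R).
Proof. by move=> a b; rewrite /lcst -!/(lpi _) !rmorphB. Qed.

Lemma lcst_is_monoid : monoid_morphism (@lcst R).
Proof. by split=> [|a b]; rewrite /lcst -!/(lpi _) ?rmorph1 ?rmorphM. Qed.

HB.instance Definition _ :=
  GRing.isZmodMorphism.Build R laurent (@lcst R) lcst_is_zmod.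
HB.instance Definition _ :=
  GRing.isMonoidMorphism.Build R laurent (@lcst R) lcst_is_monoid.

Lemma lmonom0 : lmonom R 0 = 1.
Proof. exact: (rmorph1 lpi). Qed.

Lemma lmonom_nat n : lmonom R n%:Z = lpi 'X^n. Proof. by []. Qed.

Lemma lmonom_opp n : lmonom R (- n%:Z) = lpi ('X^n)%:P.
Proof. by case: n => [|n] //; rewrite oppr0 lmonom0 expr0 !rmorph1. Qed.

Lemma lmonom_XV : lmonom R 1 * lmonom R (-1) = 1.
Proof.
rewrite (lmonom_nat 1) (lmonom_opp 1) !expr1 -rmorphM; apply/eqP.
by rewrite -subr_eq0 -(rmorph1 lpi) -rmorphB; apply/lpi_eq0P; exists 1; rewrite mul1r.
Qed.

Lemma lmonomS k : lmonom R (k + 1) = lmonom R k * lmonom R 1.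
Proof.
case: (intP k) => [|n|n]; first by rewrite add0r lmonom0 mul1r.
  have -> : n.+1%:Z + 1 = n.+2%:Z by lia.
  by rewrite !lmonom_nat -rmorphM -exprSr.
have -> : - n.+1%:Z + 1 = - n%:Z by lia.
rewrite !lmonom_opp exprSr polyCM rmorphM -mulrA.
have -> : lpi 'X%:P * lmonom R 1 = 1 by rewrite mulrC -lmonom_XV (lmonom_opp 1).
by rewrite mulr1.
Qed.

Lemma lmonomP k : lmonom R (k - 1) = lmonom R k * lmonom R (-1).
Proof. by rewrite -{2}[k](subrK 1) lmonomS -mulrA lmonom_XV mulr1. Qed.

Lemma lmonomD k l : lmonom R (k + l) = lmonom R k * lmonom R l.
Proof.
elim: l => [|l IHl|l IHl]; first by rewrite addr0 lmonom0 mulr1.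
  have -> : k + l.+1%:Z = k + l%:Z + 1 by lia.
  have -> : l.+1%:Z = l%:Z + 1 by lia.
  by rewrite !lmonomS IHl -mulrA.
have -> : k - l.+1%:Z = k - l%:Z - 1 by lia.
have -> : - l.+1%:Z = - l%:Z - 1 by lia.
by rewrite !lmonomP IHl -mulrA.
Qed.

Lemma laurent_ind (Pr : laurent -> Prop) :
  (forall c k, Pr (lcst c * lmonom R k)) ->
  (forall z1 z2, Pr z1 -> Pr z2 -> Pr (z1 + z2)) -> forall z, Pr z.
Proof.
move=> Hm HD z; rewrite -(lpi_repr z); move: (repr z) => {z} P.
have Pr0 : Pr 0 by have := Hm 0 0; rewrite rmorph0 mul0r.
rewrite -[P]coefK poly_def rmorph_sum; elim/big_ind: _ => // i _.
rewrite -mul_polyC rmorphM -[P`_i]coefK poly_def !rmorph_sum mulr_suml.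
elim/big_ind: _ => // j _.
rewrite -mul_polyC !rmorphM -/(lcst _) -mulrA.
have -> : lpi ('X^j)%:P * lpi 'X^i = lmonom R (i%:Z - j%:Z); last exact: Hm.
by rewrite lmonomD mulrC lmonom_opp.
Qed.

(** A common bound on both degrees lets coefficients be summed over one square of exponents for all
    the representatives that are compared. *)
Definition bounded (N : nat) P :=
  (size P <= N)%N && [forall i : 'I_(size P), (size (P`_i)%R <= N)%N].

Definition pcoef (N : nat) P k : R :=
  \sum_(i < N) \sum_(j < N | i%:Z - j%:Z == k) (P`_i)%R`_j.

Lemma bounded_coef N P i j : bounded N P -> (N <= j)%N -> (P`_i)%R`_j = 0.
Proof.
move=> /andP[_ /forallP PN] Nj; case: (ltnP i (size P)) => iP; last first.
  by rewrite (nth_default 0 iP) coef0.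
by rewrite nth_default // (leq_trans (PN (Ordinal iP))).
Qed.

Lemma ex_bounded P Q : exists2 N, bounded N P & bounded N Q.
Proof.
pose b P := maxn (size P) (\max_(i < size P) size (P`_i)%R).
have bP S N : (b S <= N)%N -> bounded N S.
  rewrite geq_max => /andP[SN /bigmax_leqP SiN]; rewrite /bounded SN /=.
  by apply/forallP => i; apply: SiN.
by exists (maxn (b P) (b Q)); apply: bP; rewrite ?leq_maxl ?leq_maxr.
Qed.

Lemma lcoef_pcoef N z k : bounded N (repr z) -> lcoef z k = pcoef N (repr z) k.
Proof.
move=> bN; have /andP[zN /forallP ziN] := bN; rewrite /lcoef /pcoef.
rewrite (big_ord_widen _ (fun i : nat => \sum_(j < size ((repr z)`_i)%R | i%:Z - j%:Z == k)
  ((repr z)`_i)%R`_j) zN) big_mkcond; apply: eq_bigr => i _.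
case: ltnP => iz; last by rewrite (nth_default 0 iz) big1 // => j _; rewrite coef0.
rewrite (big_ord_widen_cond _ (fun j : nat => i%:Z - j%:Z == k)
  (fun j : nat => ((repr z)`_i)%R`_j) (ziN (Ordinal iz))).
by rewrite big_mkcondr; apply: eq_bigr => j _; case: ltnP => // jz; rewrite nth_default.
Qed.

Lemma pcoefD N P Q k : pcoef N (P + Q) k = pcoef N P k + pcoef N Q k.
Proof.
rewrite -big_split; apply: eq_bigr => i _ /=; rewrite -big_split.
by apply: eq_bigr => j _; rewrite !coefD.
Qed.

Lemma pcoefN N P k : pcoef N (- P) k = - pcoef N P k.
Proof.
rewrite /pcoef -sumrN; apply: eq_bigr => i _; rewrite -sumrN.
by apply: eq_bigr => j _; rewrite !coefN.
Qed.

Lemma pcoefM N c P k : pcoef N (c%:P%:P * P) k = c * pcoef N P k.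
Proof.
rewrite /pcoef mulr_sumr; apply: eq_bigr => i _; rewrite mulr_sumr.
by apply: eq_bigr => j _; rewrite !coefCM.
Qed.

Lemma pcoefX N P k : bounded N P -> pcoef N.+1 (P * 'X) (k + 1) = pcoef N.+1 P k.
Proof.
move=> bN; rewrite {1}/pcoef big_ord_recl coefMX eqxx big1 => [|j _]; last by rewrite coef0.
rewrite add0r [RHS]big_ord_recr /= [X in _ = _ + X]big1 ?addr0 => [|j _]; last first.
  by rewrite [(P`_N)%R](nth_default 0) ?coef0 //; case/andP: bN.
apply: eq_bigr => i _; rewrite coefMX /bump /= add1n /=.
by apply: eq_bigl => j; lia.
Qed.

Lemma pcoefY N P k : bounded N P -> pcoef N.+1 (P * 'X%:P) (k - 1) = pcoef N.+1 P k.
Proof.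
move=> bN; apply: eq_bigr => i _; rewrite coefMC.
rewrite big_mkcond big_ord_recl coefMX /= if_same add0r.
rewrite [RHS]big_mkcond [RHS]big_ord_recr /= (bounded_coef _ bN (leqnn N)) if_same addr0.
apply: eq_bigr => j _; rewrite coefMX /bump /= add1n /=.
by rewrite (_ : (_ == k - 1) = (i%:Z - j%:Z == k)) //; lia.
Qed.

Lemma pcoefS N P k : bounded N P -> pcoef N.+1 P k = pcoef N P k.
Proof.
move=> bN; rewrite {1}/pcoef big_ord_recr /= [X in _ + X]big1 ?addr0 => [|j _]; last first.
  by rewrite [(P`_N)%R](nth_default 0) ?coef0 //; case/andP: bN.
apply: eq_bigr => i _; rewrite big_mkcond big_ord_recr /=.
by rewrite (bounded_coef _ bN (leqnn N)) if_same addr0 -big_mkcond.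
Qed.

Lemma bounded_leq N M P : (N <= M)%N -> bounded N P -> bounded M P.
Proof.
move=> NM /andP[PN /forallP PiN]; rewrite /bounded (leq_trans PN NM).
by apply/forallP => i; apply: leq_trans (PiN i) NM.
Qed.

Lemma pcoef_leq N M P k : (N <= M)%N -> bounded N P -> pcoef M P k = pcoef N P k.
Proof.
move=> /subnKC <-; elim: (M - N)%N => [|m IHm] bN; first by rewrite addn0.
by rewrite addnS pcoefS ?IHm // (bounded_leq _ bN) // leq_addr.
Qed.

(** Two representatives differ by a multiple [Q (X Y - 1)]. The factor X raises every exponent of
    [Q] by one and Y lowers it back, so this multiple contributes 0 to each coefficient. *)
Lemma lcoef_pi N P k : bounded N P -> lcoef (lpi P) k = pcoef N P k.
Proof.
move=> bN; have /eqP : lpi (repr (lpi P) - P) = 0 by rewrite rmorphB /= lpi_repr subrr.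
move=> /lpi_eq0P[Q /eqP]; rewrite subr_eq => /eqP rE.
have [M0 bQ bX] := ex_bounded Q (Q * 'X); have [M1 bP _] := ex_bounded (repr (lpi P)) 0.
pose M := (maxn N (maxn M0 M1)).
have [NM M0M M1M] : [/\ N <= M, M0 <= M & M1 <= M]%N by rewrite /M; split; lia.
have bM := bounded_leq M1M bP.
rewrite (lcoef_pcoef k (bounded_leq (leqnSn M) bM)) rE pcoefD.
rewrite -(pcoef_leq k (leq_trans NM (leqnSn M)) bN) -[RHS]add0r; congr (_ + _).
rewrite mulrBr mulr1 pcoefD pcoefN mulrA -{1}[k](addrK 1).
rewrite pcoefY; last exact: bounded_leq bX.
by rewrite pcoefX ?subrr //; apply: bounded_leq bQ.
Qed.

Lemma lcoefD z1 z2 k : lcoef (z1 + z2) k = lcoef z1 k + lcoef z2 k.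
Proof.
have [N b1 b2] := ex_bounded (repr z1) (repr z2).
have [M bM _] := ex_bounded (repr z1 + repr z2) 0.
have [bN1 bN2] := (leq_maxl N M, leq_maxr N M).
rewrite -[z1 in LHS]lpi_repr -[z2 in LHS]lpi_repr -rmorphD.
rewrite (lcoef_pi k (bounded_leq bN2 bM)) pcoefD.
by rewrite !(@lcoef_pcoef (maxn N M)) ?(bounded_leq bN1).
Qed.

Lemma lcoef_cstM c z k : lcoef (lcst c * z) k = c * lcoef z k.
Proof.
have [N b1 b2] := ex_bounded (repr z) (c%:P%:P * repr z).
rewrite -[z in LHS]lpi_repr /lcst -/(lpi _) -rmorphM (lcoef_pi k b2) pcoefM.
by rewrite (lcoef_pcoef k b1).
Qed.

Lemma lcoef_XM z k : lcoef (z * lmonom R 1) (k + 1) = lcoef z k.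
Proof.
have [N b1 b2] := ex_bounded (repr z) (repr z * 'X).
rewrite -[z in LHS]lpi_repr (lmonom_nat 1) -rmorphM (lcoef_pi _ (bounded_leq (leqnSn N) b2)).
by rewrite pcoefX // pcoefS // (lcoef_pcoef k b1).
Qed.

Lemma lcoef_monomM z k l : lcoef (z * lmonom R l) k = lcoef z (k - l).
Proof.
elim: l => [|l IHl|l IHl] in k *; first by rewrite lmonom0 mulr1 subr0.
  have -> : l.+1%:Z = l%:Z + 1 by lia.
  rewrite lmonomS mulrA -{1}[k](subrK 1) lcoef_XM IHl; congr lcoef; lia.
rewrite -lcoef_XM -mulrA -lmonomS.
have -> : - l.+1%:Z + 1 = - l%:Z by lia.
by rewrite IHl; congr lcoef; lia.
Qed.

Lemma lcoef0 k : lcoef (0 : laurent) k = 0.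
Proof. by have := lcoef_cstM 0 0 k; rewrite mulr0 mul0r. Qed.

Lemma lcoef_cst c k : lcoef (lcst c) k = if k == 0 then c else 0.
Proof.
have b1 : bounded 1 c%:P%:P.
  rewrite /bounded size_polyC_leq1; apply/forallP => -[[|i] /= iP].
    by rewrite coefC eqxx size_polyC_leq1.
  by rewrite coefC size_poly0.
rewrite /lcst -/(lpi _) (lcoef_pi _ b1) /pcoef big_ord1 big_mkcond big_ord1.
by rewrite /= !coefC eqxx eq_sym.
Qed.

Section Eval.
Variables (S : comNzRingType) (f : {rmorphism R -> S}) (u v : S).
Hypothesis uv : u * v = 1.

Let g : {rmorphism {poly R} -> S} := horner_morph (fun c => mulrC v (f c)).
Let h : {rmorphism {poly {poly R}} -> S} := horner_morph (fun p => mulrC u (g p)).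

(** The proof of [u * v = 1] is an argument, so that the term itself carries what its morphism
    structure requires. *)
Definition leval of u * v = 1 := fun z : laurent => h (repr z).
Local Notation ev := (leval uv).

Lemma leval_pi P : ev (lpi P) = h P.
Proof.
have /eqP : lpi (repr (lpi P) - P) = 0 by rewrite rmorphB /= lpi_repr subrr.
move=> /lpi_eq0P[Q E]; apply/eqP; rewrite -subr_eq0 -rmorphB E.
rewrite rmorphM rmorphB rmorphM rmorph1 /= /h horner_morphX horner_morphC.
by rewrite /= /g horner_morphX uv subrr mulr0.
Qed.

Lemma leval_is_zmod : zmod_morphism ev.
Proof.
by move=> z1 z2; rewrite -[z1]lpi_repr -[z2]lpi_repr -rmorphB !leval_pi rmorphB.
Qed.

Lemma leval_is_monoid : monoid_morphism ev.
Proof.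
split; first by rewrite -(rmorph1 lpi) leval_pi rmorph1.
by move=> z1 z2; rewrite -[z1]lpi_repr -[z2]lpi_repr -rmorphM !leval_pi rmorphM.
Qed.

HB.instance Definition _ := GRing.isZmodMorphism.Build laurent S ev leval_is_zmod.
HB.instance Definition _ := GRing.isMonoidMorphism.Build laurent S ev leval_is_monoid.

Lemma leval_cst c : ev (lcst c) = f c.
Proof.
by rewrite /lcst -/(lpi _) leval_pi; exact: etrans (horner_morphC _ _) (horner_morphC _ _).
Qed.

Lemma leval_X : ev (lmonom R 1) = u.
Proof. by rewrite (lmonom_nat 1) expr1 leval_pi; exact: horner_morphX. Qed.

Lemma leval_V : ev (lmonom R (-1)) = v.
Proof.
by rewrite (lmonom_opp 1) expr1 leval_pi; exact: etrans (horner_morphC _ _) (horner_morphX _).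
Qed.

End Eval.

End LaurentTheory.

Lemma rmorph_ndet (I : eqType) (L L' : comNzRingType) (phi : {rmorphism L -> L'})
    (S : seq I) (f : I -> I -> L) :
  phi (ndet S f) = ndet S (fun x y => phi (f x y)).
Proof. by rewrite /ndet -det_map_mx; congr (\det _); apply/matrixP => i j; rewrite !mxE. Qed.

Section LaurentDegree.
Variable R : comNzRingType.
Implicit Types (P : {poly R}) (z : laurent R) (k : int).

Lemma lcoef_sum (I : Type) (r : seq I) (Q : pred I) (F : I -> laurent R) k :
  lcoef (\sum_(i <- r | Q i) F i) k = \sum_(i <- r | Q i) lcoef (F i) k.
Proof. by apply: (big_morph _ (fun x y => lcoefD x y k) (lcoef0 R k)). Qed.

(** Polynomials in the inverse variable. They are the Laurent polynomials without positive
    exponents, the form in which the degree bound is obtained. *)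
Definition linv P : laurent R := lpi P%:P.

Lemma linv_is_zmod : zmod_morphism linv.
Proof. by move=> P Q; rewrite /linv polyCB; exact: (@rmorphB {poly {poly R}} (laurent R) (@lpi R)). Qed.

Lemma linv_is_monoid : monoid_morphism linv.
Proof.
split=> [|P Q]; first exact: (@rmorph1 {poly {poly R}} (laurent R) (@lpi R)).
by rewrite /linv polyCM; exact: (@rmorphM {poly {poly R}} (laurent R) (@lpi R)).
Qed.

HB.instance Definition _ := GRing.isZmodMorphism.Build {poly R} (laurent R) linv linv_is_zmod.
HB.instance Definition _ := GRing.isMonoidMorphism.Build {poly R} (laurent R) linv linv_is_monoid.

Lemma linv_monom c n : linv (c *: 'X^n) = lcst c * lmonom R (- n%:Z).
Proof. by rewrite lmonom_opp /linv -mul_polyC !rmorphM. Qed.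

Lemma linvZ c P : linv (c *: P) = lcst c * linv P.
Proof.
by rewrite -mul_polyC rmorphM. Qed.

Lemma lcoef_linv P k : lcoef (linv P) k = if k <= 0 then P`_`|k|%N else 0.
Proof.
rewrite -{1}[P]coefK poly_def rmorph_sum /= lcoef_sum.
under eq_bigr do rewrite linv_monom lcoef_monomM opprK lcoef_cst.
have [kle|klt] := leP k 0; last by rewrite big1 // => i _; rewrite ifF //; lia.
have [kP|Pk] := ltnP `|k|%N (size P); last first.
  rewrite (nth_default 0 Pk) big1 // => i _; rewrite ifF //.
  by move: (ltn_ord i) Pk kle; move: (size P) (nat_of_ord i) => m n; lia.
rewrite (bigD1 (Ordinal kP)) //= big1 => [|i]; first by rewrite addr0 ifT //; lia.
by rewrite -val_eqE /= => ik; rewrite ifF //; lia.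
Qed.

Lemma linv_inj : injective linv.
Proof.
move=> P Q PQ; apply/polyP => i.
have := congr1 (fun z => lcoef z (- i%:Z)) PQ; rewrite !lcoef_linv (_ : - i%:Z <= 0); last by lia.
by have -> : `|- i%:Z|%N = i by lia.
Qed.

Lemma lmonomK k z : z * lmonom R k * lmonom R (- k) = z.
Proof. by rewrite -mulrA -lmonomD subrr lmonom0 mulr1. Qed.

Lemma ex_linv z : exists n P, z * lmonom R (- n%:Z) = linv P.
Proof.
elim/laurent_ind: z => [c k|z1 z2 [n1 [P1 E1]] [n2 [P2 E2]]].
  exists (absz k), (c *: 'X^(absz ((absz k)%:Z - k))); rewrite linv_monom -mulrA -lmonomD.
  by congr (_ * lmonom R _); lia.
exists (n1 + n2)%N, (P1 * 'X^n2 + P2 * 'X^n1).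
rewrite mulrDl PoszD opprD !rmorphD !rmorphM /= -E1 -E2.
rewrite -['X^n2]scale1r -['X^n1]scale1r !linv_monom rmorph1 !mul1r !lmonomD !mulrA.
by congr (_ + _); rewrite -!mulrA [lmonom R _ * _]mulrC.
Qed.

End LaurentDegree.

(** Multiplication by a power of the variable moves both factors into the integral domain of
    polynomials in its inverse. *)
Lemma laurent_mul_eq0 (R : idomainType) (z1 z2 : laurent R) :
  z1 * z2 = 0 -> z1 = 0 \/ z2 = 0.
Proof.
have [n1 [P1 E1]] := ex_linv z1; have [n2 [P2 E2]] := ex_linv z2 => z0.
have /eqP : P1 * P2 = 0.
  apply: (@linv_inj R); rewrite rmorphM /= -E1 -E2 mulrACA z0 mul0r.
  by rewrite rmorph0.
rewrite mulf_eq0 => /orP[] /eqP P0; [left; rewrite -(lmonomK (- n1%:Z) z1) E1 P0|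
  right; rewrite -(lmonomK (- n2%:Z) z2) E2 P0]; by rewrite rmorph0 mul0r.
Qed.

(** * The specialisations p = q and p = q = 1 *)

Section TwoVariables.
Variable R : comNzRingType.
Local Notation Rp := (laurent R).
Local Notation Rpq := (laurent (laurent R)).
Implicit Types (C : Rpq) (k : int).

Definition zp k : Rpq := lcst (lmonom R k).
Definition zq k : Rpq := lmonom Rp k.

Lemma zpD k l : zp (k + l) = zp k * zp l.
Proof. by rewrite /zp lmonomD rmorphM. Qed.

Lemma zp0 : zp 0 = 1.
Proof. by rewrite /zp lmonom0 rmorph1. Qed.

Lemma zqD k l : zq (k + l) = zq k * zq l.
Proof. exact: lmonomD. Qed.

Lemma zq0 : zq 0 = 1.
Proof. exact: lmonom0. Qed.

(** The specialisation q = p: the outer variable goes to the inner one. *)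
Definition diag : Rpq -> Rp := leval idfun (lmonom_XV R).
HB.instance Definition _ := GRing.RMorphism.on diag.

Lemma diag_cst c : diag (lcst c) = c.
Proof. exact: leval_cst. Qed.

Lemma diag_zp k : diag (zp k) = lmonom R k.
Proof. exact: leval_cst. Qed.

Lemma pow_ext (S : comNzRingType) (t u : int -> S) :
  (forall k l, t (k + l) = t k * t l) -> (forall k l, u (k + l) = u k * u l) ->
  t 0 = 1 -> u 0 = 1 -> t 1 = u 1 -> t (-1) = u (-1) -> forall k, t k = u k.
Proof.
move=> tD uD t0 u0 t1 tN1; elim=> [|k IHk|k IHk]; first by rewrite t0 u0.
  have -> : k.+1%:Z = k%:Z + 1 by lia.
  by rewrite tD uD IHk t1.
have -> : - k.+1%:Z = - k%:Z - 1 by lia.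
by rewrite tD uD IHk tN1.
Qed.

Lemma diag_zq k : diag (zq k) = lmonom R k.
Proof.
apply: (pow_ext (t := fun k => diag (zq k))) => {k} [k l|k l||||].
- by rewrite zqD rmorphM.
- exact: lmonomD.
- by rewrite zq0 rmorph1.
- exact: lmonom0.
- exact: leval_X.
exact: leval_V.
Qed.

(** Divisibility of t^k - u^k by t - u, negative exponents included; there it follows from t^-1 -
    u^-1 = - (t - u) t^-1 u^-1. *)
Lemma sub_pow (S : comNzRingType) (t u : int -> S) :
  (forall k l, t (k + l) = t k * t l) -> (forall k l, u (k + l) = u k * u l) ->
  t 0 = 1 -> u 0 = 1 -> forall k, exists c, t k - u k = (t 1 - u 1) * c.
Proof.
move=> tD uD t0 u0; elim=> [|k [c E]|k [c E]].
- by exists 0; rewrite t0 u0 subrr mulr0.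
- exists (c * t 1 + u k); have -> : k.+1%:Z = k%:Z + 1 by lia.
  rewrite tD uD; transitivity ((t k - u k) * t 1 + u k * (t 1 - u 1)); first by ring.
  by rewrite E; ring.
exists (c * t (-1) - u (- k%:Z) * t (-1) * u (-1)).
have -> : - k.+1%:Z = - k%:Z - 1 by lia.
have tV : t 1 * t (-1) = 1 by rewrite -tD subrr.
have uV : u 1 * u (-1) = 1 by rewrite -uD subrr.
rewrite tD uD; transitivity ((t (- k%:Z) - u (- k%:Z)) * t (-1)
   + u (- k%:Z) * (t (-1) * (u 1 * u (-1)) - (t 1 * t (-1)) * u (-1))).
  by rewrite tV uV; ring.
by rewrite E; ring.
Qed.

(** On a monomial the difference is a multiple of p^k - q^k, and both sides are additive. *)
Lemma diag_ker C : exists E, C - lcst (diag C) = (zp 1 - zq 1) * E.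
Proof.
elim/laurent_ind: C => [c k|C1 C2 [E1 H1] [E2 H2]].
  rewrite rmorphM /= diag_cst -/(zq k) diag_zq rmorphM -/(zp k) -mulrBr.
  have [E EE] := @sub_pow Rpq zp zq zpD zqD zp0 zq0 k.
  by exists (- lcst c * E); rewrite mulrCA -EE mulNr -mulrN opprB.
exists (E1 + E2); rewrite rmorphD /= rmorphD mulrDr -H1 -H2.
by rewrite opprD addrACA.
Qed.

Lemma diag_eq0 C : diag C = 0 -> exists E, C = (zp 1 - zq 1) * E.
Proof. by move=> C0; have [E] := diag_ker C; rewrite C0 rmorph0 subr0; exists E. Qed.

Definition aug1 : Rp -> R := leval idfun (mul1r 1).
HB.instance Definition _ := GRing.RMorphism.on aug1.

(** The specialisation p = q = 1. As it factors through [diag], it vanishes on the kernel of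
    [diag]. *)
Definition aug : Rpq -> R := aug1 \o diag.
HB.instance Definition _ := GRing.RMorphism.on aug.

Lemma aug1_monom k : aug1 (lmonom R k) = 1.
Proof.
apply: (pow_ext (t := fun k => aug1 (lmonom R k)) (u := fun=> 1)) => {k} [k l|k l||||] //.
- by rewrite lmonomD rmorphM.
- by rewrite mulr1.
- by rewrite lmonom0 rmorph1.
- exact: leval_X.
exact: leval_V.
Qed.

Lemma aug_zp k : aug (zp k) = 1.
Proof. by rewrite /aug /= diag_zp aug1_monom. Qed.

Lemma aug_zq k : aug (zq k) = 1.
Proof. by rewrite /aug /= diag_zq aug1_monom. Qed.

Lemma aug_mul1B C t : aug t = 1 -> aug (C * (1 - t)) = 0.
Proof.
move=> t1; have -> : aug (C * (1 - t)) = aug C * (1 - aug t).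
  by rewrite /aug /= rmorphM rmorphB rmorph1 rmorphM rmorphB rmorph1.
by rewrite t1 subrr mulr0.
Qed.

Lemma aug_ker C : exists a b,
  C - lcst (lcst (aug C)) = a * (zp 1 - 1) + b * (zq 1 - 1).
Proof.
have [E H] := diag_ker C.
suff [a Ha] : exists a : Rp, diag C - lcst (aug1 (diag C)) = a * (lmonom R 1 - 1).
  (* The passage from p, q to 1 goes through q = p, and (p - q) E + a (p - 1) = (E + a) (p - 1) - E
     (q - 1). *)
  exists (E + lcst a), (- E).
  have -> : C - lcst (lcst (aug C)) = (C - lcst (diag C)) + lcst (diag C - lcst (aug1 (diag C))).
    by rewrite rmorphB /= addrA subrK.
  rewrite H Ha rmorphM rmorphB rmorph1 /= -/(zp 1).
  by move: (zp 1) (zq 1) (lcst a) => x y w; ring.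
elim/laurent_ind: (diag C) => [c k|C1 C2 [E1 H1] [E2 H2]].
  rewrite rmorphM /= aug1_monom mulr1 /aug1 leval_cst /=.
  have [F FE] := @sub_pow Rp (lmonom R) (fun=> 1) (@lmonomD R) (fun _ _ => esym (mulr1 1)) (lmonom0 R) erefl k.
  by exists (lcst c * F); rewrite -mulrA [F * _]mulrC -FE mulrBr mulr1.
exists (E1 + E2); rewrite rmorphD /= rmorphD mulrDl -H1 -H2.
by rewrite opprD addrACA.
Qed.

End TwoVariables.

(* [A / ((p - 1)(p - q), (q - 1)(p - q))], where [D] is [A / (p - q)]. *)
Section Quotient.
Variables (A B D : comNzRingType) (pi : {rmorphism A -> B}) (iota : {rmorphism A -> D}).
Variables (Z : comNzRingType) (cst : {rmorphism Z -> A}) (au : {rmorphism A -> Z}).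
Variables (p q : A).
Hypothesis pi0 : forall C,
  reflect (exists a b, C = (p - q) * (a * (p - 1) + b * (q - 1))) (pi C == 0).
Hypothesis iota0 : forall C, iota C = 0 -> exists E, C = (p - q) * E.
Hypothesis au0 : forall C, exists a b, C - cst (au C) = a * (p - 1) + b * (q - 1).
Hypothesis iota_au : forall C, iota C = 0 -> au C = 0.
Hypothesis iota_pq : iota p = iota q.
Hypothesis domD : forall x y : D, x * y = 0 -> x = 0 \/ y = 0.

(** In the quotient, p - q annihilates the augmentation ideal, which [au0] describes as generated by
    p - 1 and q - 1. *)
Lemma pi_pq C : au C = 0 -> pi ((p - q) * C) = 0.
Proof.
move=> C0; apply/eqP/pi0; have [a [b]] := au0 C.
by rewrite C0 rmorph0 subr0 => ->; exists a, b.
Qed.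

(* If [Delta C] vanishes in [B] then [C] vanishes in the domain [D], so [C] is a
   multiple of [p - q], and such multiples only depend on their augmentation. *)
Lemma quotient_regular (Delta C : A) : au Delta = 1 -> pi (Delta * C) = 0 -> pi C = 0.
Proof.
move=> D1 DC0.
have /domD[D0|/iota0[E CE]] : iota Delta * iota C = 0.
- rewrite -rmorphM; have /eqP/pi0[a [b ->]] := DC0.
  by rewrite rmorphM rmorphB iota_pq subrr mul0r.
- by move: (iota_au D0); rewrite D1 => /eqP; rewrite oner_eq0.
(* On multiples of p - q the factor [Delta] acts as its augmentation 1, so [Delta * C] and [C] have
   the same image. *)
have /pi_pq : au (Delta * E - E) = 0 by rewrite rmorphB rmorphM D1 mul1r subrr.
by rewrite mulrBr -CE rmorphB mulrCA -CE DC0 sub0r => /eqP; rewrite oppr_eq0 => /eqP.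
Qed.

End Quotient.

(** * The ring T: elements that are not zero divisors, and the relation used by the third move *)

Section TRing.
Local Notation Zpq := (laurent (laurent int)).

Definition tpi (C : Zpq) : T_ring := \pi_T_ring C.

Lemma tpi_is_zmod : zmod_morphism tpi.
Proof. exact: pi_is_zmod_morphism. Qed.

Lemma tpi_is_monoid : monoid_morphism tpi.
Proof. exact: pi_is_monoid_morphism. Qed.

HB.instance Definition _ := GRing.isZmodMorphism.Build Zpq T_ring tpi tpi_is_zmod.
HB.instance Definition _ := GRing.isMonoidMorphism.Build Zpq T_ring tpi tpi_is_monoid.

Lemma tpi_repr c : tpi (repr c) = c.
Proof. by rewrite /tpi reprK. Qed.

Lemma gen_ideal2 (A : comNzRingType) (p q x : A) :
  reflect (exists a b, x = (p - q) * (a * (p - 1) + b * (q - 1)))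
    (x \in gen_ideal [:: (p - 1) * (p - q); (q - 1) * (p - q)]).
Proof.
apply: (iffP (asboolP _)) => [[a ->]|[a [b ->]]].
  by exists (a 0), (a 1); rewrite big_ord_recl big_ord1 /=; ring.
exists (fun i => if i is 0 then a else b); rewrite big_ord_recl big_ord1 /=; ring.
Qed.

Lemma tpi_eq0 C : reflect (exists a b,
    C = (zp int 1 - zq int 1) * (a * (zp int 1 - 1) + b * (zq int 1 - 1))) (tpi C == 0).
Proof.
have E : (tpi C == 0) = (C \in gen_ideal T_rel).
  rewrite -(raddf0 tpi) /tpi.
  have := Quotient.idealrBE (proper_gen_ideal T_rel_proper) C 0.
  by rewrite subr0 => ->.
by rewrite E; exact: gen_ideal2.
Qed.

Lemma diag_pq : diag (zp int 1) = diag (zq int 1).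
Proof. by rewrite diag_zp diag_zq. Qed.

Lemma aug_diag0 (C : Zpq) : diag C = 0 -> aug C = 0.
Proof. by rewrite /aug /= => ->; rewrite rmorph0. Qed.

Lemma T_regular (Delta : Zpq) (c : T_ring) :
  aug Delta = 1 -> tpi Delta * c = 0 -> c = 0.
Proof.
move=> D1; rewrite -(tpi_repr c) => H.
have {}H : tpi (Delta * repr c) = 0 by rewrite (rmorphM tpi).
exact: (quotient_regular (cst := @lcst _ \o @lcst _) tpi_eq0 (@diag_eq0 int) (@aug_ker int)
  aug_diag0 diag_pq (@laurent_mul_eq0 int) D1 H).
Qed.

(** p^s - q^s is a multiple of p - q, and 1 - t lies in the augmentation ideal, which p - q
    annihilates. *)
Lemma T_pq0 (s : int) (t : Zpq) : aug t = 1 -> (p_pow s - q_pow s) * (1 - tpi t) = 0.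
Proof.
move=> t1; rewrite -[p_pow s]/(tpi (zp int s)) -[q_pow s]/(tpi (zq int s)).
have -> : 1 - tpi t = tpi (1 - t) by rewrite rmorphB rmorph1.
have [E pqE] := @sub_pow Zpq (zp int) (zq int) (@zpD int) (@zqD int) (zp0 int) (zq0 int) s.
rewrite -rmorphB -rmorphM pqE -mulrA.
apply: (pi_pq (cst := @lcst _ \o @lcst _) tpi_eq0 (@aug_ker int)).
exact: aug_mul1B.
Qed.

Lemma p_powD k l : p_pow (k + l) = p_pow k * p_pow l.
Proof. by rewrite -[LHS]/(tpi (zp int (k + l))) zpD rmorphM. Qed.

Lemma q_powD k l : q_pow (k + l) = q_pow k * q_pow l.
Proof. by rewrite -[LHS]/(tpi (zq int (k + l))) zqD rmorphM. Qed.

Lemma p_pow0 : p_pow 0 = 1.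
Proof. by rewrite -[LHS]/(tpi (zp int 0)) zp0 rmorph1. Qed.

Lemma q_pow0 : q_pow 0 = 1.
Proof. by rewrite -[LHS]/(tpi (zq int 0)) zq0 rmorph1. Qed.

Lemma p_powV k : p_pow k * p_pow (- k) = 1.
Proof. by rewrite -p_powD subrr p_pow0. Qed.

Lemma q_powV k : q_pow k * q_pow (- k) = 1.
Proof. by rewrite -q_powD subrr q_pow0. Qed.

End TRing.

(** * The polynomial as a determinant of formal arcs *)

Section Crossings.
Variables (R : realType) (D : diagram R).
Implicit Types (t u : R) (c : R * R) (k : nat).

Lemma cross_anti (a b : R * R) : cross a b = - cross b a.
Proof. by rewrite /cross; ring. Qed.

Lemma crossing_times_uniq : [/\ {in crossings D &, injective fst},
  {in crossings D &, injective snd} &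
  {in crossings D &, forall c c', c.1 != c'.2}].
Proof.
have := curve_double D; rewrite cat_uniq => /and3P[u1 /hasPn u12 u2]; split.
- exact: uniq_map_inj u1.
- exact: uniq_map_inj u2.
move=> c c' cD c'D; apply/eqP => cc'.
by have := u12 c'.2 (map_f snd c'D); rewrite -cc' map_f.
Qed.

Lemma classical_crossing c : c \in classical D -> c \in crossings D.
Proof. by rewrite /crossings mem_cat => ->. Qed.

Lemma virtual_crossing c : c \in virtual D -> c \in crossings D.
Proof. by rewrite /crossings mem_cat orbC => ->. Qed.

Lemma crossing_curve c : c \in crossings D -> c.1 != c.2 /\ curve D c.1 = curve D c.2.
Proof. by case: c => t u cD; apply/(curve_crossings D); left. Qed.

Lemma crossing_cross c : c \in crossings D ->
  cross (velocity D c.1) (velocity D c.2) != 0.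
Proof. by move=> /crossing_curve[]; apply: curve_transverse. Qed.

Lemma degree_stepE c : c \in virtual D ->
  (degree_step D c.1 = if left_to_right D c.2 c.1 then 1 else -1) /\
  (degree_step D c.2 = if left_to_right D c.1 c.2 then 1 else -1).
Proof.
move=> cV; have cD := virtual_crossing cV; have [i1 i2 i12] := crossing_times_uniq.
rewrite /degree_step; split; congr (if _ then _ else _); apply/hasP/idP.
- move=> [c' c'V /orP[]/andP[/eqP cc' ]].
    by rewrite (i1 _ _ (virtual_crossing c'V) cD cc').
  by case/negP: (i12 _ _ cD (virtual_crossing c'V)); apply/eqP.
- by move=> lr; exists c => //; rewrite eqxx lr.
- move=> [c' c'V /orP[]/andP[/eqP cc' ]].
    by case/negP: (i12 _ _ (virtual_crossing c'V) cD); apply/eqP.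
  by rewrite (i2 _ _ (virtual_crossing c'V) cD cc').
- by move=> lr; exists c => //; rewrite eqxx lr orbT.
Qed.

(** The two passages see each other from opposite sides, because [cross] is antisymmetric, and it
    does not vanish by transversality. *)
Lemma degree_step_pair c : c \in virtual D -> degree_step D c.1 + degree_step D c.2 = 0.
Proof.
move=> cV; have [-> ->] := degree_stepE cV.
have := crossing_cross (virtual_crossing cV).
rewrite /left_to_right; move: (velocity D c.1) (velocity D c.2) => x y.
by rewrite (cross_anti y) oppr_lt0; case: ltgtP.
Qed.

Definition height t : int := \sum_(v <- virtual_times D | v < t) degree_step D v.

Lemma sum_degree_step : \sum_(v <- virtual_times D) degree_step D v = 0.
Proof.
rewrite /virtual_times big_cat /= !big_map -big_split /= big_seq big1 // => c.
exact: degree_step_pair.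
Qed.

Lemma perm_times : perm_eq (unzip1 (crossings D) ++ unzip2 (crossings D))
  (unzip1 (classical D) ++ (unzip2 (classical D) ++ virtual_times D)).
Proof.
rewrite /crossings /virtual_times /unzip1 /unzip2 !map_cat.
by apply/seq.permP => a; rewrite !count_cat; lia.
Qed.

Lemma cuts_uniq : uniq (cuts D).
Proof.
rewrite sort_uniq; have := curve_double D; rewrite (perm_uniq perm_times).
by rewrite cat_uniq => /and3P[].
Qed.

Lemma over_notin_cuts c : c \in classical D -> c.1 \notin cuts D.
Proof.
move=> cD; rewrite mem_sort.
have := curve_double D; rewrite (perm_uniq perm_times).
rewrite cat_uniq => /and3P[_ /hasPn H _]; apply/negP => /H.
by rewrite map_f.
Qed.

Lemma under_notin_virtual c : c \in classical D -> c.2 \notin virtual_times D.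
Proof.
move=> cD; have := curve_double D; rewrite (perm_uniq perm_times).
rewrite cat_uniq => /and3P[_ _]; rewrite cat_uniq => /and3P[_ /hasPn H _].
by apply/negP => /H; rewrite map_f.
Qed.

Lemma mem_cuts t : (t \in cuts D) = (t \in unzip2 (classical D)) || (t \in virtual_times D).
Proof. by rewrite mem_sort mem_cat. Qed.

Lemma sorted_cuts : sorted <%R (cuts D).
Proof. by rewrite lt_sorted_uniq_le cuts_uniq sort_sorted //; exact: le_total. Qed.

Local Notation cuts := (cuts D).
Local Notation tk k := (take k cuts).

(** The height on the arc number [k], hence after [k] cuts. *)
Definition hk k : int := \sum_(v <- tk k | v \in virtual_times D) degree_step D v.

(* [c] is the last undercrossing among the first [k] cuts. *)
Definition onk c k : bool := (c.2 \in tk k) &&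
  all (fun z => (z.2 \in tk k) ==> (z.2 <= c.2)) (classical D).

(** No undercrossing has been passed: arc [k] lies on the initial long arc. *)
Definition nok k : bool := all (fun z => z.2 \notin tk k) (classical D).

Lemma takeS k : (k < size cuts)%N -> tk k.+1 = rcons (tk k) cuts`_k.
Proof. exact: take_nth. Qed.

Lemma mem_takeS k t : (k < size cuts)%N -> (t \in tk k.+1) = (t == cuts`_k) || (t \in tk k).
Proof. by move=> /takeS->; rewrite mem_rcons inE. Qed.

Lemma take_lt k t : (k < size cuts)%N -> t \in tk k -> t < cuts`_k.
Proof.
move=> ks /(nthP 0)[i]; rewrite size_take ks => ik <-; rewrite nth_take //.
apply: (sorted_ltn_nth lt_trans 0 sorted_cuts); rewrite ?inE //.
exact: ltn_trans ik ks.
Qed.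

Lemma hkS k : (k < size cuts)%N ->
  hk k.+1 = hk k + (if cuts`_k \in virtual_times D then degree_step D cuts`_k else 0).
Proof. by move=> /takeS E; rewrite /hk E -cats1 big_cat /= big_cons big_nil; case: ifP; rewrite ?addr0. Qed.

Lemma onk_virtual c k : c \in classical D -> (k < size cuts)%N ->
  cuts`_k \in virtual_times D -> onk c k.+1 = onk c k.
Proof.
move=> cD ks kV; have E z : z \in classical D -> (z.2 \in tk k.+1) = (z.2 \in tk k).
  move=> zD; rewrite mem_takeS //; case: eqP => // zk.
  by have := under_notin_virtual zD; rewrite zk kV.
by rewrite /onk E //; congr (_ && _); apply: eq_in_all => z zD; rewrite E.
Qed.

Lemma nok_virtual k : (k < size cuts)%N -> cuts`_k \in virtual_times D -> nok k.+1 = nok k.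
Proof.
move=> ks kV; apply: eq_in_all => z zD; rewrite mem_takeS //; case: eqP => // zk.
by have := under_notin_virtual zD; rewrite zk kV.
Qed.

Lemma onk_under c k : c \in classical D -> (k < size cuts)%N ->
  cuts`_k \notin virtual_times D -> onk c k.+1 = (cuts`_k == c.2).
Proof.
move=> cD ks kV; have : cuts`_k \in cuts by apply: mem_nth.
rewrite mem_cuts (negPf kV) orbF => /mapP[z zD zk].
apply/andP/eqP => [[ck /allP/(_ z zD)]|<-].
  rewrite -zk !mem_takeS // eqxx /= => kc; apply/eqP; rewrite eq_le kc /=.
  by move: ck; rewrite mem_takeS // => /predU1P[->//|/(take_lt ks)/ltW].
split; first by rewrite mem_takeS // eqxx.
apply/allP => y yD; apply/implyP; rewrite mem_takeS // => /predU1P[->//|].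
by move=> /(take_lt ks)/ltW.
Qed.

Lemma nok_under k : (k < size cuts)%N -> cuts`_k \notin virtual_times D -> nok k.+1 = false.
Proof.
move=> ks kV; have : cuts`_k \in cuts by apply: mem_nth.
rewrite mem_cuts (negPf kV) orbF => /mapP[z zD zk].
by apply/allPn; exists z => //; rewrite mem_takeS // zk eqxx.
Qed.

Lemma onk0 c : onk c 0 = false.
Proof. by rewrite /onk take0. Qed.

Lemma nok0 : nok 0.
Proof. by apply/allP => z; rewrite take0. Qed.

Lemma nok_onk c k : c \in classical D -> nok k -> onk c k = false.
Proof. by move=> cD /allP/(_ c cD) ck; rewrite /onk (negPf ck). Qed.

Lemma degree_from_onk c d k : c \in classical D -> (k <= size cuts)%N -> onk c k ->
  degree_from D d k = hk k - hk (index c.2 cuts).+1.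
Proof.
move=> cD; elim: k => [|k IHk] ks; first by rewrite onk0.
rewrite /= hkS //; have [kV|kV] := boolP (cuts`_k \in virtual_times D).
  by rewrite onk_virtual // => /(IHk (ltnW ks)) ->; rewrite addrAC.
rewrite onk_under // => /eqP ck; rewrite addr0 -ck index_uniq ?cuts_uniq //.
by rewrite hkS // (negPf kV) addr0 subrr.
Qed.

Lemma degree_from_nok d k : (k <= size cuts)%N -> nok k -> degree_from D d k = d + hk k.
Proof.
elim: k => [|k IHk] ks; first by rewrite /hk take0 big_nil addr0.
rewrite /= hkS //; have [kV|kV] := boolP (cuts`_k \in virtual_times D).
  by rewrite nok_virtual // => /(IHk (ltnW ks)) ->; rewrite addrA.
by rewrite nok_under.
Qed.

(** Membership in the long arc emanating from [c] in terms of the order of the cuts; the second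
    alternative continues the final long arc into the initial one. *)
Definition cyc c k := onk c k || nok k && onk c (size cuts).

Lemma hk_size : hk (size cuts) = 0.
Proof.
rewrite /hk take_size -big_filter; apply: etrans sum_degree_step; apply: perm_big.
apply: uniq_perm; rewrite ?filter_uniq ?cuts_uniq //.
  by have := cuts_uniq; rewrite sort_uniq cat_uniq => /and3P[].
by move=> t; rewrite mem_filter mem_cuts andb_orr andbb; case: (t \in virtual_times D) => //=; rewrite orbT.
Qed.

(** Degrees start at 0 on the first arc of a long arc, so they are height differences. On the
    initial long arc they continue those of the final one; the formula stays the same because the
    total height is 0. *)
Lemma degree_cyc c (a : arc D) : c \in classical D -> cyc c a ->
  degree a = hk a - hk (index c.2 cuts).+1.
Proof.
move=> cD; have as_ : (a <= size cuts)%N by rewrite -ltnS.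
rewrite /degree => /orP[ca|/andP[na cs]]; first exact: degree_from_onk.
by rewrite degree_from_nok // (degree_from_onk _ cD _ cs) // hk_size sub0r addrC.
Qed.

Lemma cyc_virtual c (a b : arc D) : c \in classical D -> virtual_neighbours a b ->
  cyc c a = cyc c b.
Proof.
move=> cD /andP[/eqP ab aV]; have ks : (a < size cuts)%N.
  by have := ltn_ord b; rewrite ab ltnS.
by rewrite /cyc ab onk_virtual // nok_virtual.
Qed.

Lemma cyc_ends c : c \in classical D -> cyc c 0 = cyc c (size cuts).
Proof.
move=> cD; rewrite /cyc onk0 nok0 /=; case ns : (nok (size cuts)); last by rewrite orbF.
by rewrite (nok_onk cD ns).
Qed.

Lemma same_long_arc_cyc c (a b : arc D) : c \in classical D ->
  same_long_arc a b -> cyc c a = cyc c b.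
Proof.
move=> cD /connectP[s + ->]; elim: s a => //= x s IHs a /andP[ax /IHs <-].
case/or4P: ax => [|+|/andP[/eqP-> /eqP->]|/andP[/eqP-> /eqP->]].
- exact: cyc_virtual.
- by move/(cyc_virtual cD).
- by rewrite cyc_ends.
by rewrite cyc_ends.
Qed.

(** The long arc is grown by one cut at a time, each virtual cut being one edge of [connect]; the
    edge between the two unbounded arcs gives the cyclic case. *)
Lemma long_arcE c (a : arc D) : c \in classical D -> long_arc c a = cyc c a.
Proof.
move=> cD; apply/existsP/idP => [[b /andP[/andP[b0 /eqP bc] /(same_long_arc_cyc cD) <-]]|].
  have bs : (b.-1 < size cuts)%N by have := ltn_ord b; lia.
  rewrite /cyc -[nat_of_ord b]prednK // onk_under // bc ?eqxx //.
  exact: under_notin_virtual.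
have onk_conn k (ks : (k < (size cuts).+1)%N) : onk c k ->
    exists b : arc D, emanates c b && same_long_arc b (Ordinal ks).
  elim: k ks => [|k IHk] ks; first by rewrite onk0.
  have [kV|kV] := boolP (cuts`_k \in virtual_times D).
    rewrite onk_virtual // => /(IHk (ltnW ks))[b /andP[cb bk]]; exists b; rewrite cb.
    apply: connect_trans bk (connect1 _); rewrite /virtual_neighbours /=.
    by rewrite eqxx kV.
  rewrite onk_under // => kc; exists (Ordinal ks).
  by rewrite /emanates /= kc /same_long_arc connect0.
have nok_conn k (ks : (k < (size cuts).+1)%N) : nok k -> same_long_arc (D := D) ord0 (Ordinal ks).
  elim: k ks => [|k IHk] ks nk.
    by rewrite (_ : Ordinal ks = ord0) /same_long_arc ?connect0 //; apply: val_inj.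
  have [kV|kV] := boolP (cuts`_k \in virtual_times D); last by rewrite nok_under in nk.
  rewrite nok_virtual // in nk; apply: connect_trans (IHk (ltnW ks) nk) (connect1 _).
  by rewrite /virtual_neighbours /= eqxx kV.
have aE : Ordinal (ltn_ord a) = a by apply: val_inj.
case/orP => [/(onk_conn _ (ltn_ord a))|/andP[/(nok_conn _ (ltn_ord a)) na]].
  by rewrite aE.
move=> /(onk_conn _ (ltnSn _))[b /andP[cb bs]]; exists b; rewrite cb -aE.
apply: connect_trans bs (connect_trans (connect1 _) na).
by rewrite -!val_eqE /= eqxx !orbT.
Qed.

End Crossings.

Lemma take_count_lt (R : realType) (t : R) s : sorted <%R s ->
  take (count (fun x => x < t) s) s = [seq x <- s | x < t].
Proof.
elim: s => //= x s IHs xs; have [xt|tx] := ltP x t.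
  by rewrite /= IHs // (path_sorted xs).
have /allP xall := order_path_min lt_trans xs.
have c0 : count (fun x => x < t) s = 0%N.
  apply/eqP; rewrite -leqn0 leqNgt -has_count; apply/hasPn => y /xall xy.
  by rewrite -leNgt (le_trans tx (ltW xy)).
rewrite add0n c0 (@eq_in_filter _ _ pred0) ?filter_pred0 // => y /xall xy.
by rewrite /= ltNge (le_trans tx (ltW xy)).
Qed.

Lemma index_count_lt (R : realType) (t : R) s : sorted <%R s -> t \in s ->
  index t s = count (fun x => x < t) s.
Proof.
elim: s => //= x s IHs xs; have /allP xall := order_path_min lt_trans xs.
rewrite inE eq_sym; case: eqVneq => [xt _|_ /= ts]; last first.
  by rewrite (xall t ts) /= add1n IHs // (path_sorted xs).
rewrite xt ltxx add0n; apply/esym/eqP; rewrite -leqn0 leqNgt -has_count.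
by apply/hasPn => y /xall; rewrite xt -leNgt => /ltW.
Qed.

Lemma lcst_inc (A : comNzRingType) (n1 n2 n3 : nat) (a : A) :
  lcst (n1%:R * 1 + n2%:R * (a - 1) + n3%:R * - a) =
  n1%:R + n2%:R * (lcst a - 1) - n3%:R * lcst a.
Proof.
rewrite mulr1 mulrN rmorphB rmorphD !rmorphM /= !rmorph_nat.
by rewrite [lcst (a - 1)]rmorphB rmorph1.
Qed.

(** * From the matrix of arcs and degrees to the system of times and heights *)

Section Arcs.
Variables (R : realType) (D : diagram R).
Implicit Types (t u : R) (c : R * R) (k : nat).
Local Notation cuts := (cuts D).

(** The comparison is strict, so at a cut this is the arc that ends there. *)
Definition arc_at t : nat := count (fun x => x < t) cuts.

Lemma arc_at_lt t : (arc_at t < (size cuts).+1)%N.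
Proof. by rewrite ltnS count_size. Qed.

Lemma mem_take_arc_at t u : (u \in take (arc_at t) cuts) = (u \in cuts) && (u < t).
Proof. by rewrite take_count_lt ?sorted_cuts // mem_filter andbC. Qed.

Lemma hk_arc_at t : hk D (arc_at t) = height D t.
Proof.
rewrite /hk take_count_lt ?sorted_cuts // big_filter_cond /height -big_filter -[RHS]big_filter.
apply: perm_big; apply: uniq_perm; rewrite ?filter_uniq ?cuts_uniq //.
  by have := cuts_uniq D; rewrite sort_uniq cat_uniq => /and3P[].
move=> v; rewrite !mem_filter mem_cuts /=.
by case: (v \in virtual_times D); rewrite ?orbT ?andbF ?andbT.
Qed.

Lemma under_cuts c : c \in classical D -> c.2 \in cuts.
Proof. by move=> cD; rewrite mem_cuts map_f. Qed.

Lemma index_arc_at c : c \in classical D -> index c.2 cuts = arc_at c.2.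
Proof. by move=> /under_cuts; apply: index_count_lt; apply: sorted_cuts. Qed.

Lemma hk_index c : c \in classical D -> hk D (index c.2 cuts).+1 = height D c.2.
Proof.
move=> cD; rewrite hkS ?index_mem ?under_cuts // nth_index ?under_cuts //.
by rewrite (negPf (under_notin_virtual cD)) addr0 index_arc_at // hk_arc_at.
Qed.

Lemma emanatesE c (a : arc D) : c \in classical D ->
  emanates c a = (a == (index c.2 cuts).+1 :> nat).
Proof.
move=> cD; rewrite /emanates; apply/andP/eqP => [[a0 /eqP <-]|->].
  by rewrite index_uniq ?cuts_uniq ?prednK // -ltnS.
by rewrite nth_index ?under_cuts.
Qed.

Lemma comes_intoE c (a : arc D) : c \in classical D ->
  comes_into c a = (a == arc_at c.2 :> nat).
Proof.
move=> cD; rewrite /comes_into -index_arc_at //; apply/andP/eqP => [[ak /eqP <-]|->].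
  by rewrite index_uniq ?cuts_uniq.
by rewrite index_mem nth_index ?under_cuts.
Qed.

Lemma passes_overE c (a : arc D) : c \in classical D ->
  passes_over c a = (a == arc_at c.1 :> nat).
Proof.
move=> cD; have c1 := over_notin_cuts cD; have ac := mem_take_arc_at c.1.
have as_ : (a <= size cuts)%N by rewrite -ltnS.
have kc : (arc_at c.1 <= size cuts)%N by apply: count_size.
have lt_c i : (i < size cuts)%N -> (cuts`_i < c.1) = (i < arc_at c.1)%N.
  move=> ik; have := ac cuts`_i; rewrite mem_nth //= => <-.
  by rewrite in_take ?mem_nth // index_uniq ?cuts_uniq.
have gt_c i : (i < size cuts)%N -> (c.1 < cuts`_i) = (arc_at c.1 <= i)%N.
  move=> ik; rewrite leqNgt -lt_c // -leNgt lt_neqAle; case: eqP => //= cE.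
  by case/negP: c1; rewrite cE mem_nth.
rewrite /passes_over; apply/andP/eqP => [[/implyP a0 /implyP a1]|->]; last first.
  split; apply/implyP => H; last by rewrite gt_c.
  by rewrite lt_c; lia.
apply/eqP; rewrite eqn_leq; apply/andP; split; last first.
  by move: a1; case: (ltnP a (size cuts)) => [al /(_ isT)|al _]; [rewrite gt_c|lia].
by case: (posnP a) => [->//|ap]; have := a0 ap; rewrite lt_c; lia.
Qed.

Section CrossingArcs.
Variables (A : comNzRingType) (w : R * R -> A) (b e : R).
Local Notation L := (laurent A).

(** Start and incoming time are both [c.2]: as [on] is strict in the time, at [c.2] it still selects
    the incoming arc. *)
Definition garc_of c : garc R L :=
  ((c.2, c.2, c.1), (lcst (w c), (1 - lcst (w c)) * lmonom A (height D c.1 - height D c.2))).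

(* Since [st = b] comes first and [it = e] last, this row identifies the arc
   coming from -oo with the arc going to +oo. *)
Definition base : garc R L := ((b, e, e), (1, 0)).

Definition garcs := base :: map garc_of (classical D).

Definition surrounds := [/\ b < e, {in classical D, forall c, b < c.1 < e /\ b < c.2 < e} &
  {in virtual_times D, forall t, b < t < e}].

Hypothesis be : surrounds.

Lemma on_garc_of t c : c \in classical D -> on garcs t (garc_of c) = onk D c (arc_at t).
Proof.
move=> cD; have [_ bc _] := be; have [_ /andP[bc2 _]] := bc c cD.
rewrite /on /garcs /= all_map /st /= /onk !mem_take_arc_at under_cuts //= (ltW bc2) /=.
congr (_ && _); apply: eq_in_all => z zD; rewrite mem_take_arc_at under_cuts //=.
by rewrite implybE -leNgt orbC.
Qed.

Lemma on_base t : b < t -> on garcs t base = nok D (arc_at t).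
Proof.
move=> bt; have [_ bc _] := be; rewrite /on /garcs /= all_map /st /= bt lexx /=.
apply: eq_in_all => z zD /=; have [_ /andP[bz2 _]] := bc z zD.
by rewrite mem_take_arc_at under_cuts //= leNgt bz2 /= leNgt.
Qed.

Lemma arc_at_e : arc_at e = size cuts.
Proof.
have [_ bc bv] := be; apply/eqP; rewrite -all_count; apply/allP => t.
by rewrite mem_cuts => /orP[/mapP[c /bc[_ /andP[_ ?]] ->//]|/bv /andP[]].
Qed.

(* Conjugating by the powers [s ^ height] turns the degrees, measured from the
   first arc of each long arc, into the difference of heights of the two
   passages through a crossing. *)
Definition reduced x y : L :=
  (x == y)%:R - ct (garc_of x) * (cyc D y (arc_at x.1))%:R
    - wt (garc_of x) * (cyc D y (arc_at x.2))%:R.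

Lemma garc_of_inj : injective garc_of.
Proof. by move=> [x1 x2] [y1 y2] [-> _ ->]. Qed.

(** Elimination of [base]: its row identifies it with the arc current at [e], which turns membership
    along the line into the cyclic [cyc]. The pivot is 1 because, in the presence of a classical
    crossing, [base] is no longer current at [e]. *)
Lemma gdet_reduced : (0 < size (classical D))%N ->
  gdet garcs = ndet (classical D) reduced.
Proof.
move=> D0; have [lt_be bc bv] := be.
have [c cD] : exists c, c \in classical D.
  by case: (classical D) D0 => // c s _; exists c; rewrite inE eqxx.
have one : on garcs e base = false.
  by rewrite on_base // arc_at_e /nok take_size; apply/allPn; exists c; rewrite ?under_cuts.
have nbase x : x \in classical D -> (garc_of x == base) = false.
  move=> xD; apply/eqP => -[E _ _ _ _]; have [_ /andP[+ _]] := bc x xD.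
  by rewrite E ltxx.
rewrite /gdet /garcs ndet_pivot -/garcs; last first.
  rewrite /gmat /= eqxx /it /= one mul0r subr0.
  by rewrite mulr0 subr0.
rewrite ndet_map; apply: eq_ndet => x y xD yD.
rewrite /gmat nbase // [base == _]eq_sym nbase // (inj_eq garc_of_inj).
have [/andP[x1 _] /andP[x2 _]] := bc x xD.
have row_base : 0 - ct base * (on garcs (ot base) (garc_of y))%:R -
    wt base * (on garcs (it base) (garc_of y))%:R = - (onk D y (size cuts))%:R :> L.
  rewrite /ct /wt /it /ot /= !on_garc_of // arc_at_e.
  by rewrite mul0r subr0 sub0r mul1r.
rewrite row_base !on_garc_of //; rewrite !on_base // /reduced /cyc.
have cycE k : (onk D y k || nok D k && onk D y (size cuts))%:R =
    (onk D y k)%:R + (nok D k)%:R * (onk D y (size cuts))%:R :> L.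
  case nk : (nok D k); last by rewrite orbF mul0r addr0.
  by rewrite (nok_onk yD nk) mul1r add0r.
rewrite !cycE; move: (nok D _)%:R (nok D _)%:R (onk D y _)%:R (onk D y _)%:R (onk D y _)%:R.
rewrite -[false%:R]/(0 : L) => n1 n2 o1 o2 o3; move: (o1 : L) => {}o1; ring.
Qed.

Definition ginc c (a : arc D) : A :=
  (emanates c a)%:R * 1 + (passes_over c a)%:R * (w c - 1) + (comes_into c a)%:R * - w c.

Definition gentry x y : L :=
  \sum_(a : arc D | long_arc y a) lcst (ginc x a) * lmonom A (degree a).

Lemma sum_arc (P : pred nat) (F : nat -> L) k : (k < (size cuts).+1)%N ->
  \sum_(a : arc D | P a) (a == k :> nat)%:R * F a = (P k)%:R * F k.
Proof.
move=> ks; rewrite big_mkcond (bigD1 (Ordinal ks)) //= eqxx big1 ?addr0.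
  by case: (P k); rewrite ?mul1r ?mul0r.
by move=> a; rewrite -val_eqE /= => /negPf->; rewrite mul0r if_same.
Qed.

Lemma gentryE x y : x \in classical D -> y \in classical D ->
  gentry x y = lmonom A (height D x.2) * reduced x y * lmonom A (- height D y.2).
Proof.
move=> xD yD.
pose F k : L := lmonom A (hk D k - height D y.2).
rewrite /gentry (eq_bigl (fun a : arc D => cyc D y a)); last by move=> a; exact: long_arcE.
rewrite (eq_bigr (fun a : arc D =>
   (a == (index x.2 cuts).+1 :> nat)%:R * F a
   + (a == arc_at x.1 :> nat)%:R * ((lcst (w x) - 1) * F a)
   + (a == arc_at x.2 :> nat)%:R * (- lcst (w x) * F a))); last first.
  move=> a ya; rewrite (degree_cyc yD ya) hk_index // /ginc emanatesE // passes_overE // comes_intoE //.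
  rewrite lcst_inc -/(F a); move: (F a) (lcst (w x)) => f v.
  ring.
rewrite !big_split /= (sum_arc _ F) ?(sum_arc _ (fun k => (lcst (w x) - 1) * F k)) ?arc_at_lt //; last first.
  by rewrite ltnS index_mem under_cuts.
rewrite (sum_arc _ (fun k => - lcst (w x) * F k)) ?arc_at_lt // /F !hk_arc_at hk_index //.
have -> : cyc D y (index x.2 cuts).+1 = (x == y).
  have ks : (index x.2 cuts < size cuts)%N by rewrite index_mem under_cuts.
  have xV : cuts`_(index x.2 cuts) \notin virtual_times D.
    by rewrite nth_index ?under_cuts // under_notin_virtual.
  rewrite /cyc onk_under // nok_under // orbF nth_index ?under_cuts //.
  have [_ i2 _] := crossing_times_uniq D.
  by apply/eqP/eqP => [E|->//]; apply: i2 => //; exact: classical_crossing.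
rewrite /reduced /ct /wt /= !lmonomD.
set hx := lmonom A (height D x.2); set hxN := lmonom A (- height D x.2).
set h1 := lmonom A (height D x.1); set hy := lmonom A (- height D y.2).
have hxK : hx * hxN = 1 by rewrite -lmonomD subrr lmonom0.
have hxy : (x == y)%:R * (hx * hy) = (x == y)%:R :> L.
  case: eqVneq => [xy|_]; last by rewrite mul0r.
  by rewrite /hx /hy xy -lmonomD subrr lmonom0 mulr1.
move: (cyc D y (arc_at x.1))%:R (cyc D y (arc_at x.2))%:R (lcst (w x)) => c1 c2 v.
transitivity ((x == y)%:R * (hx * hy) - (1 - v) * (h1 * hy) * c1 * (hx * hxN) - v * c2 * hx * hy).
  by rewrite hxy hxK; ring.
by ring.
Qed.

Lemma det_gentry : (0 < size (classical D))%N -> ndet (classical D) gentry = gdet garcs.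
Proof.
move=> /gdet_reduced ->.
rewrite (@eq_ndet _ _ _ _ (fun x y => lmonom A (height D x.2) * (reduced x y * lmonom A (- height D y.2)))).
  rewrite ndet_rowscale ndet_colscale mulrA -big_split /= big1 ?mul1r // => c _.
  by rewrite -lmonomD subrr lmonom0.
by move=> x y xD yD; rewrite gentryE // mulrA.
Qed.

End CrossingArcs.
End Arcs.

Lemma zetaE (R : realType) (D : diagram R) b e : surrounds D b e ->
  (0 < size (classical D))%N -> zeta D = gdet (garcs D (weight D) b e).
Proof.
by move=> be D0; rewrite -det_gentry.
Qed.

(** * The degree bound *)

Section DegreeBound.
Variables (R : realType) (D : diagram R) (A : comNzRingType) (w : R * R -> A) (b e : R).
Hypothesis be : surrounds D b e.
Local Notation S := (garcs D w b e).
Local Notation L := (laurent A).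
Implicit Types (x y : garc R L) (t v : R).

Lemma garcs_uniq : uniq (map st S).
Proof.
have [_ bc _] := be; rewrite /garcs /= -map_comp; apply/andP; split.
  apply/negP => /mapP[c cD] /= E; have [_ /andP[+ _]] := bc c cD.
  by rewrite /= /st /= in E; rewrite E ltxx.
have := cuts_uniq D; rewrite sort_uniq cat_uniq => /andP[].
by rewrite /unzip2.
Qed.

Lemma height_b : height D b = 0.
Proof.
have [_ _ bv] := be; rewrite /height big_seq_cond big1 // => v /andP[/bv /andP[? _]].
by rewrite ltNge ltW.
Qed.

Lemma height_e : height D e = 0.
Proof.
have [_ _ bv] := be; rewrite -[RHS](sum_degree_step D) /height big_mkcond.
by apply: eq_big_seq => v /bv /andP[_ ->].
Qed.

Definition ups y : nat :=
  count (fun v => (degree_step D v == 1) && on S v y) (virtual_times D).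

Lemma start_notin_virtual y : y \in S -> st y \notin virtual_times D.
Proof.
have [_ _ bv] := be; rewrite inE => /predU1P[->|/mapP[c cD ->]] /=.
  by apply/negP => /bv; rewrite ltxx.
exact: under_notin_virtual.
Qed.

Lemma degree_step1 v : degree_step D v <= (degree_step D v == 1)%:Z.
Proof. by rewrite /degree_step; case: ifP. Qed.

(** Along an arc the height rises by at most 1 at each step +1, and the steps -1 only lower it. *)
Lemma height_ups t y : y \in S -> on S t y -> height D t - height D (st y) <= (ups y)%:Z.
Proof.
move=> yS /andP[yt /allP ally].
have -> : height D t - height D (st y) =
    \sum_(v <- virtual_times D | (st y <= v < t)) degree_step D v.
  apply/eqP; rewrite subr_eq; apply/eqP; rewrite /height (bigID (fun v => v < st y)) /=.
  rewrite addrC; congr (_ + _); apply: eq_bigl => v.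
    by rewrite andbC -leNgt.
  by case: (ltP v (st y)) => vy; rewrite ?andbT ?andbF // (lt_trans vy yt).
rewrite /ups -sum1_count [X in _ <= X%:Z]big_mkcond /= (big_morph Posz PoszD (erefl 0%:Z)).
rewrite big_mkcond; rewrite big_seq [X in _ <= X]big_seq; apply: ler_sum => v vV.
case: ifP => [/andP[yv vt]|_]; last by case: ifP.
rewrite (le_trans (degree_step1 v)) //; case: eqP => _ //=.
rewrite ifT // /on lt_neqAle yv andbT; apply/andP; split.
  by apply: contraNneq (start_notin_virtual yS) => ->.
by apply/allP => z /ally /orP[->//|tz]; rewrite (le_trans (ltW vt) tz) orbT.
Qed.

Lemma count_steps : count (fun v => degree_step D v == 1) (virtual_times D) = size (virtual D).
Proof.
rewrite /virtual_times count_cat /unzip1 /unzip2 !count_map -sum1_size.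
rewrite -!sum1_count !(big_mkcond (fun _ => _ == _)) /= -big_split /=.
apply: eq_big_seq => c cV /=.
by have := degree_step_pair cV; rewrite /degree_step; case: ifP => _; case: ifP.
Qed.

(** Each virtual crossing provides exactly one step +1, and its time lies on at most one arc. *)
Lemma sum_ups : (\sum_(y <- S) ups y <= size (virtual D))%N.
Proof.
rewrite -count_steps /ups.
under eq_bigr do rewrite -sum1_count big_mkcond.
rewrite exchange_big -sum1_count [X in (_ <= X)%N]big_mkcond /=; apply: leq_sum => v _.
case: (degree_step D v == 1) => /=; last by rewrite big1.
rewrite -big_mkcond sum1_count.
rewrite -size_filter; case E : (seq.filter _ _) => [|y [|y' s]] //=.
have US : uniq (seq.filter (on S v) S) by rewrite filter_uniq ?(map_uniq garcs_uniq).
have [] : y \in seq.filter (on S v) S /\ y' \in seq.filter (on S v) S.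
  by rewrite E !inE !eqxx orbT.
rewrite !mem_filter => /andP[yv yS] /andP[yv' yS'].
move: US; rewrite E /= inE negb_or.
by rewrite (on_inj garcs_uniq yS yS' yv yv') eqxx.
Qed.

(** After conjugation by the heights at the starts, the exponents in column [y] are at most [ups y].
    Extracting s^(ups y) from each column leaves polynomials in s^-1. *)
Lemma gdet_bound k : (size (virtual D))%:Z < k -> lcoef (gdet S) k = 0.
Proof.
move=> kV; have [_ bc _] := be.
pose hs x := height D (st x).
have form x : x \in S -> exists v : A,
    [/\ wt x = lcst v, ct x = (1 - lcst v) * lmonom A (height D (ot x) - hs x)
      & height D (it x) = hs x].
  rewrite inE => /predU1P[->|/mapP[c cD ->]]; last by exists (w c).
  (* The row of [base] has the same form with weight 1, since the height vanishes at both [b] and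
     [e]. *)
  exists 1; split; rewrite ?rmorph1 ?subrr ?mul0r //.
  by rewrite /hs height_b height_e.
(* The exponent still missing to reach [ups y]. It is used only where [y] is the current arc, where
   [height_ups] makes the difference nonnegative and the absolute value harmless. *)
pose E (a : int) y : nat := absz ((ups y)%:Z - (a - hs y))%R.
have EP t y : y \in S -> lmonom A (height D t - hs y) * (on S t y)%:R =
    lmonom A (ups y)%:Z * linv ((on S t y)%:R *: 'X^(E (height D t) y)).
  move=> yS; case tS : (on S t y); last by rewrite !mulr0n scale0r rmorph0 !mulr0.
  rewrite !mulr1n mulr1 linv_monom (rmorph1 (@lcst A)) mul1r -lmonomD; congr lmonom.
  by have := height_ups yS tS; rewrite -/(hs y) /E; lia.
pose f x y := lmonom A (hs x) * (gmat S x y * lmonom A (- hs y)).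
have fE : gdet S = ndet S f.
  rewrite ndet_rowscale ndet_colscale mulrA -big_split /= big1 ?mul1r // => y _.
  by rewrite -lmonomD subrr lmonom0.
have [G GE] : exists G : garc R L -> garc R L -> {poly A},
    {in S &, forall x y, f x y = linv (G x y) * lmonom A (ups y)%:Z}.
  suff H x y : exists P, x \in S -> y \in S -> f x y = linv P * lmonom A (ups y)%:Z.
    pose G x y := sval (cid (H x y)).
    by exists G => x y xS yS; rewrite /G; case: (cid _) => P /= ->.
  have [/andP[xS yS]|xyS] := boolP ((x \in S) && (y \in S)); last first.
    by exists 0 => xS yS; rewrite xS yS in xyS.
  have [v [wE cE iE]] := form x xS.
  exists ((x == y)%:R *: 'X^(ups y) - (1 - v) *: ((on S (ot x) y)%:R *: 'X^(E (height D (ot x)) y))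
     - v *: ((on S (it x) y)%:R *: 'X^(E (height D (it x)) y))) => _ _.
  rewrite mulrC !rmorphB /= !(linvZ v) !(linvZ (1 - v)) !mulrBr !(mulrCA (lmonom A (ups y)%:Z)).
  rewrite -!EP // linvZ (mulrCA (lmonom A (ups y)%:Z)) -['X^(ups y)]scale1r linv_monom rmorph1 mul1r.
  rewrite -lmonomD subrr lmonom0 mulr1 rmorph_nat rmorphB rmorph1 iE /f /gmat wE cE.
  have hK : lmonom A (hs x) * lmonom A (- hs x) = 1 by rewrite -lmonomD subrr lmonom0.
  have xyE : (x == y)%:R * (lmonom A (hs x) * lmonom A (- hs y)) = (x == y)%:R :> L.
    case: eqVneq => [->|_]; last by rewrite mul0r.
    by rewrite -lmonomD subrr lmonom0 mulr1.
  rewrite /= !lmonomD; move: hK xyE.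
  move: (lmonom A (hs x)) (lmonom A (- hs x)) (lmonom A (- hs y)) (lmonom A (height D (ot x))).
  move: (x == y)%:R (on S (ot x) y)%:R (on S (it x) y)%:R (lcst v) => c1 c2 c3 c4.
  move=> m1 m2 m3 m4 m12 c13.
  transitivity (c1 * (m1 * m3) - (1 - c4) * m4 * m3 * c2 * (m1 * m2) - c4 * m1 * m3 * c3).
    by ring.
  by rewrite m12 c13; ring.
rewrite fE (eq_ndet GE) ndet_colscale -rmorph_ndet.
have -> : \prod_(y <- S) lmonom A (ups y)%:Z = lmonom A (\sum_(y <- S) ups y)%N%:Z.
  elim: (garcs _ _ _ _) => [|y s IHs]; first by rewrite !big_nil lmonom0.
  by rewrite !big_cons IHs PoszD lmonomD.
(* The exponent [k] minus the sum of the [ups] remains positive, and [linv] has no positive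
   exponents. *)
rewrite mulrC lcoef_monomM lcoef_linv ifF //; apply/negbTE; rewrite -ltNge subr_gt0.
by apply: le_lt_trans kV; rewrite lez_nat sum_ups.
Qed.

End DegreeBound.

(** * The product with a classical knot *)

Section Blocks.
Variables (R : realType) (L : comNzRingType).
Local Notation garc := (garc R L).
Implicit Types (S : seq garc) (t : R) (x y z : garc).

Lemma ndet_sorted (I : eqType) (key : I -> R) (S : seq I) (f : I -> I -> L) :
  uniq (map key S) -> {in S, forall i, f i i = 1} ->
  {in S &, forall i j, key i < key j -> f i j = 0} -> ndet S f = 1.
Proof.
pose le (x y : I) := key x <= key y; pose s := sort le S => US f1 f0.
have sS : perm_eq s S by apply/permPl/perm_sort.
have s_sorted : sorted le s by apply: sort_sorted => x y; exact: le_total.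
rewrite -(ndet_perm f sS).
have {}US : uniq (map key s) by rewrite (perm_uniq (perm_map key sS)).
have {}f1 : {in s, forall i, f i i = 1} by move=> x; rewrite (perm_mem sS) => /f1.
have {f0} : {in s &, forall i j, key i < key j -> f i j = 0}.
  by move=> x y; rewrite !(perm_mem sS); exact: f0.
elim: s US f1 s_sorted {sS} => [|x s IHs] /=; first by rewrite ndet_nil.
case/andP=> xs US f1 xsort f0.
have le_tr : transitive le by move=> a b c; exact: le_trans.
have /allP xall := order_path_min le_tr xsort.
rewrite ndet_cons0 => [|y ys]; last first.
  rewrite f0 ?inE ?eqxx ?ys ?orbT // lt_neqAle [_ <= _](xall y ys) andbT.
  by apply: contraNneq xs => ->; apply: map_f.
rewrite f1 ?inE ?eqxx // mul1r IHs //.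
- by move=> y ys; rewrite f1 // inE ys orbT.
- exact: path_sorted xsort.
by move=> y z ys zs; apply: f0; rewrite inE ?ys ?zs orbT.
Qed.

(** The rows after time [m] have coefficient sum [1 - ct x - wt x = 0]. One column operation
    therefore removes them from the first block and makes the matrix block triangular. *)
Lemma gdet_cat b0 S1 S2 m :
  uniq (map st ((b0 :: S1) ++ S2)) -> st b0 < m < it b0 ->
  ct b0 = 0 -> wt b0 = 1 ->
  {in S1, forall x, [/\ st x < m, it x < m & ot x < m]} ->
  {in S2, forall x, [/\ m <= st x, m <= it x, m <= ot x & ct x = 1 - wt x]} ->
  gdet ((b0 :: S1) ++ S2) = gdet (b0 :: S1) * ndet S2 (gmat S2).
Proof.
move=> US /andP[bm mi] cb wb low high; set S := _ ++ _.
have low' x : x \in b0 :: S1 -> st x < m by rewrite inE => /predU1P[->//|/low[]].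
have U1 : uniq (map st (b0 :: S1)) by move: US; rewrite map_cat cat_uniq => /and3P[].
have U2 : uniq (map st S2) by move: US; rewrite map_cat cat_uniq => /and3P[].
have S12 x : x \in b0 :: S1 -> x \notin S2.
  by move=> x1; apply/negP => /high[]; rewrite leNgt low'.
(* [l] is the arc of the first part still running at time [m]; it reaches into the second part until
   the first start there. *)
have [l lS lm] : exists2 l, l \in b0 :: S1 & on (b0 :: S1) m l.
  by apply: exists_on; exists b0; rewrite ?inE ?eqxx.
pose none t := all (fun z => t <= st z) S2.
have onlow t y : t <= m -> y \in b0 :: S1 -> on S t y = on (b0 :: S1) t y.
  move=> tm y1; rewrite /on /S all_cat.
  have -> : all (fun z => (st z <= st y) || (t <= st z)) S2.
    by apply/allP => z /high[mz _ _ _]; rewrite (le_trans tm mz) orbT.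
  by rewrite andbT.
have onlow2 t y : t <= m -> y \in S2 -> on S t y = false.
  by move=> tm /high[my _ _ _]; rewrite /on ltNge (le_trans tm my).
have onhigh2 t y : m <= t -> y \in S2 -> on S t y = on S2 t y.
  move=> mt y2; rewrite /on /S all_cat.
  have -> // : all (fun z => (st z <= st y) || (t <= st z)) (b0 :: S1).
  by apply/allP => z /low' zm; have [my _ _ _] := high y y2; rewrite (le_trans (ltW zm) my).
have onl t y : m <= t -> y \in b0 :: S1 -> on (b0 :: S1) t y = (y == l).
  move=> mt y1; transitivity (on (b0 :: S1) m y); last first.
    by apply/idP/eqP => [ym|->//]; exact: on_inj U1 y1 lS ym lm.
  rewrite /on (low' y y1) (lt_le_trans (low' y y1) mt); apply: eq_in_all => z z1.
  by rewrite ![_ <= st z]leNgt (lt_le_trans (low' z z1) mt) low'.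
have onhigh t y : m <= t -> y \in b0 :: S1 -> on S t y = (y == l) && none t.
  move=> mt y1; rewrite -(onl t) // /on /S all_cat -andbA; congr (_ && (_ && _)).
  apply: eq_in_all => z /high[mz _ _ _].
  by rewrite leNgt (lt_le_trans (low' y y1) mz).
have sum2 t : m <= t -> \sum_(z <- S2) (on S t z)%:R = 1 - (none t)%:R :> L.
  move=> mt; rewrite (eq_big_seq (fun z => (on S2 t z)%:R)); last first.
    by move=> z z2; rewrite onhigh2.
  case nt : (none t).
    rewrite subrr big1_seq // => z /= z2; rewrite /on ltNge.
    by move/allP: nt => /(_ z z2) ->.
  have /allPn[z z2 /= tz] := negbT nt; rewrite -ltNge in tz.
  have [y y2 yt] := exists_on (ex_intro2 _ _ z z2 tz).
  rewrite (bigD1_seq y) ?(map_uniq U2) //= yt big1_seq ?addr0 ?subr0 // => x /andP[xy x2].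
  by case xt : (on S2 t x) => //; rewrite (on_inj U2 x2 y2 xt yt) eqxx in xy.
(* Right multiplication by [g] adds all columns of [S2] to column [l], the only column of the first
   block in which rows of [S2] have entries. *)
pose g x y : L := (x == y)%:R + ((x \in S2) && (y == l))%:R.
have US0 : uniq S := map_uniq US.
have g1 : ndet S g = 1.
  apply: (ndet_sorted (key := st)) => // [x xS|x y xS yS xy]; rewrite /g.
    rewrite eqxx; case: (boolP (x \in S2)) => x2; last by rewrite addr0.
    by case: eqVneq => [xl|_]; rewrite ?addr0 //; move: (S12 l lS); rewrite -xl x2.
  have -> : (x == y) = false by apply: contraTF xy => /eqP->; rewrite ltxx.
  case x2 : (x \in S2); last by rewrite addr0.
  case: eqVneq => [yl|_]; rewrite ?addr0 //; move: xy; rewrite yl.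
  by have [mx _ _ _] := high x x2; rewrite ltNge (ltW (lt_le_trans (low' l lS) mx)).
rewrite -[LHS]mulr1 -g1 /gdet ndet_mul.
pose f x y := gmat S x y + (y == l)%:R * \sum_(z <- S2) gmat S x z.
rewrite (eq_ndet (g := f)); last first.
  move=> x y xS yS; rewrite /g /f; under eq_bigr do rewrite mulrDr.
  rewrite big_split /=; congr (_ + _).
    rewrite (bigD1_seq y) //= eqxx mulr1 big1 ?addr0 // => i /negPf iy.
    by rewrite iy mulr0.
  rewrite big_cat big1_seq => [|z /= z1]; last first.
    by rewrite (negPf (S12 z z1)) mulr0.
  rewrite mulr_sumr /= add0r; apply: eq_big_seq => z z2.
  by rewrite z2 /= mulrC.
have b0S2 : b0 \notin S2 by apply: S12; rewrite inE eqxx.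
have neq12 x y : x \in b0 :: S1 -> y \in S2 -> (x == y = false) * (y == x = false).
  by move=> x1 y2; rewrite [y == x]eq_sym; case: eqP => // xy; move: (S12 x x1); rewrite xy y2.
rewrite (ndet_perm _ (permEl (perm_catC _ _))) ndet_cat; last first.
  move=> x y x2 y1; have [mx mi_ mo cx] := high x x2.
  rewrite /f {1}/gmat !(neq12 y x) // sub0r !onhigh //.
  rewrite (eq_big_seq (fun z => (x == z)%:R - ct x * (on S (ot x) z)%:R - wt x * (on S (it x) z)%:R)) //.
  rewrite !big_split /= !sumrN -!mulr_sumr !sum2 //.
  have -> : \sum_(z <- S2) (x == z)%:R = 1 :> L.
    by rewrite (bigD1_seq x) ?(map_uniq U2) //= eqxx big1 ?addr0 // => z; rewrite eq_sym => /negPf->.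
  rewrite cx; case: (y == l) => /=; last by rewrite !mulr0n !mulr0 mul0r subr0 oppr0 addr0.
  by move: (none _)%:R (none _)%:R => n1 n2; ring.
rewrite mulrC; congr (_ * _); apply: eq_ndet => x y xS yS; last first.
  by rewrite /f (neq12 l y) // mul0r addr0 /gmat; have [_ mi_ mo _] := high x xS; rewrite !onhigh2.
rewrite /f; have [xb|xb] := eqVneq x b0.
  (* In the row of [b0] the same operation turns the reference to the last arc of the whole system
     into one to [l], as in the system of the first part alone. *)
  have row T z : gmat T b0 z = (b0 == z)%:R - (on T (it b0) z)%:R.
    by rewrite /gmat cb wb mul0r subr0 mul1r.
  rewrite xb !row onl ?(ltW mi) // onhigh ?(ltW mi) //.
  rewrite (eq_big_seq (fun z => - (on S (it b0) z)%:R)); last first.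
    by move=> z z2; rewrite row (neq12 b0 z) ?inE ?eqxx // sub0r.
  rewrite sumrN sum2 ?(ltW mi) //.
  by case: (y == l); case: (none _); rewrite /=; ring.
have x1 : x \in S1 by move: xS; rewrite inE (negPf xb).
have [_ /ltW ix /ltW ox] := low x x1.
rewrite big1_seq ?mulr0 ?addr0 => [|z /= z2]; last first.
  by rewrite /gmat (neq12 x z) // !onlow2 // !mulr0 !subr0.
by rewrite /gmat !onlow.
Qed.

End Blocks.

(** * Changes of parameter and of base times *)

Section Renaming.
Variables (R : realType) (A : comNzRingType).
Implicit Types (D : diagram R) (w : R * R -> A) (b e t : R) (c : R * R).

Lemma crossing_time_lt D r : long_outside (curve D) r ->
  {in crossings D, forall c, - r < c.1 < r /\ - r < c.2 < r}.
Proof.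
move=> Dr c /crossing_curve[c12 cE].
have := crossing_box Dr c12 cE.
have := crossing_box Dr _ (esym cE); rewrite eq_sym => /(_ c12).
by rewrite !ltr_norml.
Qed.

Lemma virtual_timesP D t : t \in virtual_times D ->
  exists2 c, c \in virtual D & t = c.1 \/ t = c.2.
Proof.
by rewrite mem_cat => /orP[/mapP|/mapP][c cV ->]; exists c => //; [left|right].
Qed.

Lemma ex_surrounds D m : exists b e, surrounds D b e /\ b < m < e.
Proof.
have [r Dr] := curve_long D; have r0 := Dr.1; have lt_r := crossing_time_lt Dr.
exists (- r - `|m| - 1), (r + `|m| + 1); have m1 := ler_norm m; have m2 := lerNnormlW (lexx `|m|).
split; last by lra.
split; first by have := normr_ge0 m; lra.
  move=> c /classical_crossing /lt_r [? ?]; have := normr_ge0 m; split; lra.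
move=> t /virtual_timesP[c /virtual_crossing /lt_r [? ?] tc]; have := normr_ge0 m.
by case: tc => ->; lra.
Qed.

Definition pair_map (alpha : R -> R) c := (alpha c.1, alpha c.2).

(** The matrix depends only on comparisons of times, which an increasing change of parameter
    preserves. It serves both for translations and for isotopies. *)
Lemma gdet_rename D D' w w' b e alpha (s : seq (R * R)) :
  {mono alpha : x y / x < y} ->
  {in s, forall c, [/\ w' c = w (pair_map alpha c),
     height D' c.1 = height D (alpha c.1) & height D' c.2 = height D (alpha c.2)]} ->
  uniq (b :: map snd s) ->
  gdet (base A b e :: map (garc_of D' w') s) =
  gdet (base A (alpha b) (alpha e) :: map (garc_of D w) (map (pair_map alpha) s)).
Proof.
move=> mono wh us.
pose Z := (base A b e, base A (alpha b) (alpha e)) ::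
  [seq (garc_of D' w' c, garc_of D w (pair_map alpha c)) | c <- s].
have inZ p : p \in Z -> [/\ st p.2 = alpha (st p.1), it p.2 = alpha (it p.1),
    ot p.2 = alpha (ot p.1) & wt p.1 = wt p.2 /\ ct p.1 = ct p.2].
  rewrite inE => /predU1P[->//|/mapP[c cs ->]] /=.
  by have [E1 E2 E3] := wh c cs; rewrite /wt /ct /= E1 E2 E3.
have alpha_inj : injective alpha.
  move=> x y E; have [xy|yx|//] := ltgtP x y; first by rewrite -mono E ltxx in xy.
  by rewrite -mono E ltxx in yx.
have -> : base A b e :: map (garc_of D' w') s = unzip1 Z.
  by rewrite /unzip1 /= -map_comp.
have -> : base A (alpha b) (alpha e) :: map (garc_of D w) (map (pair_map alpha) s) = unzip2 Z.
  by rewrite /unzip2 /= -!map_comp.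
have U1 : uniq (map st (unzip1 Z)) by rewrite /unzip1 /= -!map_comp.
apply: gdet_congr => //.
- have -> : map st (unzip2 Z) = map alpha (map st (unzip1 Z)).
    rewrite /unzip1 /unzip2 -!map_comp; by apply/eq_in_map => p /inZ[].
  by rewrite map_inj_uniq.
- by move=> p q /inZ[-> _ _ _] /inZ[-> _ _ _]; rewrite mono.
- by move=> p q /inZ[-> _ _ _] /inZ[_ -> _ _]; rewrite mono.
- by move=> q /inZ[_ _ -> _] _ p /inZ[-> _ _ _]; rewrite mono.
by move=> p /inZ[].
Qed.

Lemma gdet_base D w b e b' e' : surrounds D b e -> surrounds D b' e' ->
  gdet (garcs D w b e) = gdet (garcs D w b' e').
Proof.
move=> be be'; pose Z := (base A b e, base A b' e') :: [seq (x, x) | x <- map (garc_of D w) (classical D)].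
have -> : garcs D w b e = unzip1 Z by rewrite /unzip1 /= -!map_comp.
have -> : garcs D w b' e' = unzip2 Z by rewrite /unzip2 /= -!map_comp.
have inZ p : p \in Z -> p = (base A b e, base A b' e') \/
    exists2 c, c \in classical D & p = (garc_of D w c, garc_of D w c).
  rewrite inE => /predU1P[|/mapP[x /mapP[c cD ->] ->]]; first by left.
  by right; exists c.
have [lt_be bc _] := be; have [lt_be' bc' _] := be'.
apply: gdet_congr.
- by rewrite /unzip1 /= -!map_comp; have := garcs_uniq w be; rewrite /= -map_comp.
- by rewrite /unzip2 /= -!map_comp; have := garcs_uniq w be'; rewrite /= -map_comp.
- move=> p q /inZ[->|[c cD ->]] /inZ[->|[c' c'D ->]] //=; rewrite /st /= ?ltxx //.
    by have [_ /andP[-> _]] := bc c' c'D; have [_ /andP[-> _]] := bc' c' c'D.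
  have [_ /andP[/ltW c1 _]] := bc c cD; have [_ /andP[/ltW c2 _]] := bc' c cD.
  by rewrite !ltNge c1 c2.
- move=> p q /inZ[->|[c cD ->]] /inZ[->|[c' c'D ->]] //=; rewrite /st /it /= ?lt_be //.
    by have [_ /andP[-> _]] := bc c' c'D; have [_ /andP[-> _]] := bc' c' c'D.
  by have [_ /andP[_ ->]] := bc c cD; have [_ /andP[_ ->]] := bc' c cD.
- move=> q /inZ[->|[c' c'D ->]]; first by rewrite /ct /= eqxx.
  move=> _ p /inZ[->|[c cD ->]] //=; rewrite /st /ot /=.
  by have [/andP[-> _] _] := bc c' c'D; have [/andP[-> _] _] := bc' c' c'D.
by move=> p /inZ[->|[c cD ->]].
Qed.

End Renaming.

(** The entries do not involve s and have obvious lifts, so the determinant lifts as well. Where all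
    weights become 1, each row says that an arc equals the one before it: sorted by starts, the
    matrix is unitriangular. *)
Lemma block_const (R : realType) (A B Z : comNzRingType) (pi : {rmorphism A -> B})
    (au : {rmorphism A -> Z}) (W : R * R -> A) (S : seq (garc R (laurent B))) :
  uniq (map st S) ->
  {in S, forall x, [/\ it x = st x, wt x = lcst (pi (W (ot x, st x))),
     ct x = 1 - wt x & au (W (ot x, st x)) = 1]} ->
  exists2 Delta, ndet S (gmat S) = lcst (pi Delta) & au Delta = 1.
Proof.
move=> US HS; pose v (x : garc R (laurent B)) := W (ot x, st x).
exists (ndet S (fun x y => (x == y)%:R - (1 - v x) * (on S (ot x) y)%:R - v x * (on S (it x) y)%:R)).
  rewrite rmorph_ndet (rmorph_ndet (@lcst B)); apply: eq_ndet => x y xS yS.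
  have [_ wE cE _] := HS x xS; rewrite /gmat cE wE.
  by rewrite !rmorphB !rmorphM !rmorphB !rmorph1 !rmorph_nat.
rewrite rmorph_ndet; apply: (ndet_sorted US) => [x xS|x y xS yS xy];
  have [iE _ _ vE] := HS x xS; rewrite !rmorphB !rmorphM rmorphB rmorph1 !rmorph_nat vE subrr mul0r subr0 mul1r iE.
  by rewrite eqxx {1}/on ltxx subr0.
have -> : (x == y) = false by apply: contraTF xy => /eqP->; rewrite ltxx.
by rewrite /on ltNge (ltW xy) subr0.
Qed.

Local Opaque velocity cross.

Section Weight.
Variables (R : realType) (D : diagram R).

(** A lift of [weight] to Laurent polynomials, on which [aug] is defined. *)
Definition zweight (v : R * R) : laurent (laurent int) :=
  if early_overcrossing v then zp int (writhe D v) else zq int (writhe D v).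

Lemma weightE v : weight D v = tpi (zweight v).
Proof. by rewrite /weight /zweight; case: ifP. Qed.

Lemma aug_zweight v : aug (zweight v) = 1.
Proof. by rewrite /zweight; case: ifP => _; [apply: aug_zp|apply: aug_zq]. Qed.

End Weight.

(** * Factorisation of the polynomial of a product *)

Section Concat.
Variables (R : realType) (P D K : diagram R) (c1 c2 : R).
Let alpha t := t + c1.
Let beta t := t - c1.
Hypothesis virtualP : virtual P = map (pair_map beta) (virtual D).
Hypothesis classicalP : classical P = map (pair_map beta) (classical D) ++
  map (pair_map (fun t => t + c2)) (classical K).
Hypothesis velocity_left : forall t, t < 1 -> velocity P t = velocity D (alpha t).
Hypothesis left_neg : forall c, c \in crossings D -> beta c.1 < 0 /\ beta c.2 < 0.
Hypothesis right_pos : forall c, c \in crossings K -> 0 <= c.1 + c2 /\ 0 <= c.2 + c2.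

Let virtual_timesE : virtual_times P = map beta (virtual_times D).
Proof. by rewrite /virtual_times virtualP map_cat /unzip1 /unzip2 -!map_comp. Qed.

Let alphaK t : alpha (beta t) = t. Proof. exact: subrK. Qed.

Let step_left t : t \in virtual_times D -> degree_step P (beta t) = degree_step D t.
Proof.
pose F (lr : R -> R -> bool) (V : seq (R * R)) (u : R) : int :=
  if has (fun c => ((c.1 == u) && lr c.2 c.1) || ((c.2 == u) && lr c.1 c.2)) V then 1 else -1.
have lrE : {in virtual D, forall c,
    left_to_right P (beta c.2) (beta c.1) = left_to_right D c.2 c.1 /\
    left_to_right P (beta c.1) (beta c.2) = left_to_right D c.1 c.2}.
  move=> c /virtual_crossing/left_neg[n1 n2].
  have lt1 (x : R) : x < 0 -> x < 1 by move=> ?; lra.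
  have v1 := velocity_left (lt1 _ n1); have v2 := velocity_left (lt1 _ n2).
  by rewrite !alphaK in v1 v2; rewrite /left_to_right v1 v2; split.
rewrite -[LHS]/(F (left_to_right P) _ _) -[RHS]/(F (left_to_right D) _ _) virtualP => tV.
move: (left_to_right P) (left_to_right D) lrE => lrP lrD lrE; rewrite /F has_map.
congr (if _ then _ else _); apply: eq_in_has => c cV /=; have [-> ->] := lrE c cV.
by rewrite !(inj_eq (addIr _)).
Qed.

Let height_left t : height P (beta t) = height D t.
Proof.
rewrite /height virtual_timesE big_map big_seq_cond [RHS]big_seq_cond.
apply: eq_big => [v|v /andP[vV _]]; last exact: step_left.
by rewrite /beta ltrD2r.
Qed.

(** All virtual crossings lie on the first factor and have been passed twice, so their steps
    cancel. *)
Let height_right t : 0 <= t -> height P t = 0.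
Proof.
move=> t0; rewrite -[RHS](sum_degree_step P) /height big_mkcond; apply: eq_big_seq => v.
rewrite virtual_timesE => /mapP[v' /virtual_timesP[c /virtual_crossing/left_neg[n1 n2] vc] ->].
by rewrite ifT // (lt_le_trans _ t0) //; case: vc => ->.
Qed.

Let weight_left c : c \in classical D -> weight P (pair_map beta c) = weight D c.
Proof.
move=> cD; have [n1 n2] := left_neg (classical_crossing cD).
have lt1 (x : R) : x < 0 -> x < 1 by move=> ?; lra.
have v1 := velocity_left (lt1 _ n1); have v2 := velocity_left (lt1 _ n2).
rewrite !alphaK in v1 v2; have wE : writhe P (pair_map beta c) = writhe D c.
  by rewrite /writhe v1 v2.
by rewrite /weight wE /early_overcrossing /pair_map /= /beta ltrD2r.
Qed.

Lemma concat_zeta : (0 < size (classical D))%N ->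
  exists2 Delta, zeta P = zeta D * lcst (tpi Delta) & aug Delta = 1.
Proof.
move=> D0; have [b [e [be /andP[b0 e0]]]] := ex_surrounds P 0.
have P0 : (0 < size (classical P))%N by rewrite classicalP size_cat size_map; lia.
have [_ bc bv] := be.
have be' : surrounds D (alpha b) (alpha e).
  have shift t : b < beta t < e -> alpha b < t < alpha e.
    by rewrite /alpha /beta => ?; lra.
  split; first by rewrite /alpha; lra.
    move=> c cD; have : pair_map beta c \in classical P by rewrite classicalP mem_cat map_f.
    by move=> /bc[/shift ? /shift ?].
  move=> t tV; have : beta t \in virtual_times P by rewrite virtual_timesE map_f.
  by move=> /bv /shift.
pose w := weight P; pose s1 := map (pair_map beta) (classical D).
pose s2 := map (pair_map (fun t => t + c2)) (classical K).
pose S2 := map (garc_of P w) s2.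
have gE : garcs P w b e = (base _ b e :: map (garc_of P w) s1) ++ S2.
  by rewrite /garcs classicalP map_cat.
have US := garcs_uniq w be.
have s1P c : c \in s1 -> c \in classical P by rewrite classicalP mem_cat => ->.
have s2P c : c \in s2 -> c \in classical P by rewrite classicalP mem_cat orbC => ->.
have high : {in S2, forall x, [/\ 0 <= st x, 0 <= it x, 0 <= ot x & ct x = 1 - wt x]}.
  move=> x /mapP[_ /mapP[c cK ->] ->]; have [n1 n2] := right_pos (classical_crossing cK).
  by rewrite /st /it /ot /ct /wt /= !height_right // subrr lmonom0 mulr1.
have [Delta DE aD] : exists2 Delta, ndet S2 (gmat S2) = lcst (tpi Delta) & aug Delta = 1.
  apply: (@block_const _ _ _ _ tpi (@aug int) (zweight P)).
    by move: US; rewrite gE map_cat cat_uniq => /and3P[].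
  move=> x xS; have [_ _ _ cx] := high x xS; move: xS cx => /mapP[c cs ->] cx.
  split; [by [] | | exact: cx | exact: aug_zweight].
  by case: c {cs cx} => t u; exact: congr1 (weightE P (t, u)).
(* The two factors are separated by the time 0, as in the construction of the concatenation. *)
exists Delta => //; rewrite (zetaE be P0) gE (@gdet_cat _ _ _ _ _ 0) -?gE ?b0 //; last first.
  move=> x /mapP[_ /mapP[c cD ->] ->]; have [n1 n2] := left_neg (classical_crossing cD).
  by rewrite /st /it /ot /=.
rewrite DE (zetaE be' D0); congr (_ * _).
rewrite (@gdet_rename _ _ D _ (weight D) _ _ _ alpha).
- congr (gdet (_ :: map _ _)); rewrite -map_comp -[RHS]map_id; apply: eq_map => -[x y].
  by rewrite /= /pair_map /= !alphaK.
- by move=> x y; rewrite /alpha ltrD2r.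
- move=> _ /mapP[c cD ->]; have -> : pair_map alpha (pair_map beta c) = c.
    by case: (c) => x y; rewrite /pair_map /= !alphaK.
  split; first exact: weight_left.
    by rewrite alphaK; exact: height_left.
  by rewrite alphaK; exact: height_left.
move: US; rewrite gE map_cat cat_uniq => /and3P[+ _ _].
by rewrite /= -map_comp.
Qed.

End Concat.

Lemma product_virtual (R : realType) (D K : diagram R) : virtual K = [::] ->
  size (virtual (product D K)) = size (virtual D).
Proof. by move=> K0; rewrite /= K0 cats0 size_map. Qed.

Lemma zeta_product (R : realType) (D K : diagram R) : virtual K = [::] ->
  (0 < size (classical D))%N ->
  exists2 Delta, zeta (product D K) = zeta D * lcst (tpi Delta) & aug Delta = 1.
Proof.
move=> K0; rewrite /product; move: (svalP (cid (curve_long D))) (svalP (cid (curve_long K))).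
move: (sval (cid (curve_long D))) (sval (cid (curve_long K))) => r1 r2 Dr Kr.
apply: (@concat_zeta R (concat_diagram Dr Kr) D K (r1 + 1) (r2 + 1)).
- by rewrite /= K0 cats0.
- by [].
- exact: derive_concat_left.
- by case=> t u tu; apply/andP/(crossing_left Dr); rewrite !subrK.
by case=> t u tu; apply/andP/(crossing_right Kr); rewrite !addrK.
Qed.

Local Transparent velocity cross.

(** * Local moves *)

Lemma curve_derivable (R : realType) (D : diagram R) t : derivable (curve D) t 1.
Proof. by have [cd _] := curve_smooth D 1; apply/derivable1_diffP. Qed.

(** At an end point of the moved interval the two curves agree on one side only; since the
    derivative exists, that side determines it. *)
Lemma derive_eq0_oneside (R : realType) (V : normedModType R) (f : R -> V) t :
  derivable f t 1 -> (forall s, t <= s -> f s = 0) \/ (forall s, s <= t -> f s = 0) ->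
  'D_1 f t = 0.
Proof.
move=> df f0; have Df : (fun h => h^-1 *: ((f \o shift t) (h *: (1 : R)) - f t)) @ 0^' --> 'D_1 f t by exact: df.
have ft : f t = 0 by case: f0; apply.
have zero h : f (h + t) = 0 -> h^-1 *: ((f \o shift t) (h *: (1 : R)) - f t) = 0.
  by move=> fh; rewrite /= ft subr0 (_ : h *: 1 = h) ?fh ?scaler0 //; exact: mulr1.
case: f0 => f0.
  apply: (norm_cvg_unique (cvg_dnbhs_at_right Df)); apply: cvg_near_cst; near=> h; apply/zero/f0.
  by rewrite lerDr; near: h; exact: nbhs_right_ge.
apply: (norm_cvg_unique (cvg_dnbhs_at_left Df)); apply: cvg_near_cst; near=> h; apply/zero/f0.
by rewrite gerDr; near: h; exact: nbhs_left_le.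
Unshelve. all: by end_near. Qed.

Section Agree.
Variables (R : realType) (D D' : diagram R) (I : R * R).
Hypothesis DD' : agree_off I D D'.

Lemma velocity_agree t : t \notin dom I -> velocity D t = velocity D' t.
Proof.
have [cE _] := DD'; move=> tI; apply/eqP; rewrite -subr_eq0; apply/eqP.
rewrite /velocity !derive1E -deriveB; try exact: curve_derivable.
apply: derive_eq0_oneside; first by apply: derivableB; exact: curve_derivable.
have diff0 s : s \notin dom I -> (curve D - curve D') s = 0.
  by move=> /cE; rewrite !fctE => ->; rewrite subrr.
move: tI; rewrite mem_dom negb_and -!leNgt => /orP[tI|It]; [right|left] => s st; apply: diff0.
  by rewrite mem_dom negb_and -!leNgt (le_trans st tI).
by rewrite mem_dom negb_and -!leNgt (le_trans It st) orbT.
Qed.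

End Agree.

Section VirtualTimes.
Variables (R : realType) (D : diagram R).
Implicit Types (t u : R) (c : R * R).

Lemma classical_notin_virtual c : c \in classical D -> c \notin virtual D.
Proof.
have := curve_double D; rewrite cat_uniq => /andP[/map_uniq]; rewrite cat_uniq.
by move=> /and3P[_ /hasPn H _] _ cD; apply/negP => /H /negP.
Qed.

Lemma crossing_asym t u : (t, u) \in crossings D -> (u, t) \notin crossings D.
Proof.
move=> tu; apply/negP => ut; have [_ _ i12] := crossing_times_uniq D.
by have := i12 _ _ tu ut; rewrite eqxx.
Qed.

(** [agree_off] and [planar_isotopic] speak of the curve and of classical crossings only, so virtual
    times are recognised as the remaining double points. *)
Lemma virtual_timeP t : (t \in virtual_times D) <->
  exists u, [/\ t != u, curve D t = curve D u, (t, u) \notin classical D &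
    (u, t) \notin classical D].
Proof.
split=> [/virtual_timesP[[x y] cV tc]|[u [tu Dtu tuC utC]]].
  have cD := virtual_crossing cV; have [/= xy Dxy] := crossing_curve cD.
  have n1 : (x, y) \notin classical D.
    by apply/negP => /classical_notin_virtual; rewrite cV.
  have n2 : (y, x) \notin classical D.
    by apply/negP => /classical_crossing; apply/negP/crossing_asym.
  case: tc => /= ->; first by exists y.
  by exists x; split; rewrite // eq_sym.
have [] := (curve_crossings D t u).1 (conj tu Dtu).
  rewrite /crossings mem_cat (negPf tuC) /= => tuV.
  by rewrite mem_cat; apply/orP; left; apply/mapP; exists (t, u).
rewrite /crossings mem_cat (negPf utC) /= => tuV.
by rewrite mem_cat; apply/orP; right; apply/mapP; exists (u, t).
Qed.

Lemma virtual_step t u : t != u -> curve D t = curve D u ->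
  (t, u) \notin classical D -> (u, t) \notin classical D ->
  degree_step D t = if left_to_right D u t then 1 else -1.
Proof.
move=> tu Dtu tuC utC; have [] := (curve_crossings D t u).1 (conj tu Dtu).
  rewrite /crossings mem_cat (negPf tuC) /= => tuV.
  by have [E _] := degree_stepE tuV.
rewrite /crossings mem_cat (negPf utC) /= => tuV.
by have [_ E] := degree_stepE tuV.
Qed.

Lemma partner_uniq t u u' : t != u -> t != u' -> curve D t = curve D u ->
  curve D t = curve D u' -> u = u'.
Proof.
move=> tu tu' E E'; have [i1 i2 i12] := crossing_times_uniq D.
have [c1|c1] := (curve_crossings D t u).1 (conj tu E);
  have [c2|c2] := (curve_crossings D t u').1 (conj tu' E').
- by have := i1 _ _ c1 c2 erefl; case.
- by have := i12 _ _ c1 c2; rewrite eqxx.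
- by have := i12 _ _ c2 c1; rewrite eqxx.
by have := i2 _ _ c1 c2 erefl; case.
Qed.

Lemma height_dom (J : R * R) s t : s \in dom J -> t \in dom J ->
  {in virtual_times D, forall v, v \notin dom J} -> height D s = height D t.
Proof.
move=> sJ tJ VJ; rewrite /height big_seq_cond [RHS]big_seq_cond; apply: eq_bigl => v.
by case vV : (v \in _) => //=; apply: dom_ltr (VJ v vV).
Qed.

End VirtualTimes.

Lemma weight_eq (R : realType) (D D' : diagram R) c :
  velocity D c.1 = velocity D' c.1 -> velocity D c.2 = velocity D' c.2 ->
  weight D c = weight D' c.
Proof.
move=> E1 E2; have E : writhe D c = writhe D' c by rewrite /writhe E1 E2.
by rewrite /weight E.
Qed.

Lemma ex_surrounds2 (R : realType) (D D' : diagram R) (xs : seq R) :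
  exists b e, [/\ surrounds D b e, surrounds D' b e & {in xs, forall x, b < x < e}].
Proof.
have [b1 [e1 [s1 _]]] := ex_surrounds D 0; have [b2 [e2 [s2 _]]] := ex_surrounds D' 0.
have [m mP] : exists m, {in xs, forall x, - m < x < m}.
  elim: xs => [|x xs [m mP]]; first by exists 0.
  exists (Num.max m (`|x| + 1)) => y; rewrite inE => /predU1P[->|/mP].
    rewrite lt_max ltrNl lt_max; have := ler_norm x; have := ler_norm (- x).
    by rewrite normrN => ? ?; apply/andP; split; apply/orP; right; lra.
  by move=> /andP[? ?]; rewrite lt_max ltrNl lt_max; apply/andP; split; apply/orP; left; lra.
pose b := Num.min (Num.min b1 b2) (- m); pose e := Num.max (Num.max e1 e2) m.
have [bb1 bb2 bbm] : [/\ b <= b1, b <= b2 & b <= - m].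
  by rewrite !ge_min !lexx ?orbT.
have [ee1 ee2 eem] : [/\ e1 <= e, e2 <= e & m <= e].
  by rewrite !le_max !lexx ?orbT.
have widen (E : diagram R) b' e' : surrounds E b' e' -> b <= b' -> e' <= e -> surrounds E b e.
  move=> [lt_be bc bv] bb' ee'; split; first exact: le_lt_trans bb' (lt_le_trans lt_be ee').
    by move=> c /bc[/andP[? ?] /andP[? ?]]; split; lra.
  by move=> v /bv /andP[? ?]; lra.
exists b, e; split; [exact: widen s1 _ _|exact: widen s2 _ _|].
by move=> x /mP /andP[? ?]; lra.
Qed.

(** * Moves supported in the square *)

Section LocalMove.
Variables (R : realType) (D D' : diagram R) (Is : seq (R * R)) (I : R * R).
Hypotheses (IIs : I \in Is) (agree : agree_off I D D').
Hypotheses (sq : meets_square_in D Is) (sq' : meets_square_in D' Is).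
Implicit Types (t u : R) (c : R * R).

Definition inside (Js : seq (R * R)) t : bool := has (fun J => t \in dom J) Js.
Local Notation U := (inside Is).

Lemma inside_partner (E : diagram R) (Js : seq (R * R)) t u : meets_square_in E Js ->
  curve E t = curve E u -> inside Js t = inside Js u.
Proof. by move=> sqE Etu; rewrite /inside -!sqE Etu. Qed.

Lemma outside_moved t : ~~ U t -> t \notin dom I.
Proof. by move=> /hasPn/(_ I IIs). Qed.

Lemma outside_curve t : ~~ U t -> curve D t = curve D' t.
Proof. by move=> /outside_moved; apply: agree.1. Qed.

Lemma outside_classical t u : ~~ U t -> ~~ U u ->
  ((t, u) \in classical D) = ((t, u) \in classical D').
Proof. by move=> /outside_moved tI /outside_moved uI; apply: agree.2. Qed.

Lemma outside_virtual t : ~~ U t ->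
  (t \in virtual_times D) = (t \in virtual_times D').
Proof.
move=> tU; apply/idP/idP => /virtual_timeP[u [tu E n1 n2]].
  have uU : ~~ U u by rewrite -(inside_partner sq E).
  apply/virtual_timeP; exists u; rewrite -!outside_classical //; split=> //.
  by rewrite -!outside_curve.
have uU : ~~ U u by rewrite -(inside_partner sq' E).
apply/virtual_timeP; exists u; rewrite !outside_classical //; split=> //.
by rewrite !outside_curve.
Qed.

Lemma outside_velocity t : ~~ U t -> velocity D t = velocity D' t.
Proof. by move=> /outside_moved; apply: velocity_agree. Qed.

Lemma outside_step t : ~~ U t -> t \in virtual_times D ->
  degree_step D t = degree_step D' t.
Proof.
move=> tU /virtual_timeP[u [tu E n1 n2]].
have uU : ~~ U u by rewrite -(inside_partner sq E).
rewrite (virtual_step tu E n1 n2).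
have E' : curve D' t = curve D' u by rewrite -!outside_curve.
rewrite outside_classical // in n1; rewrite outside_classical // in n2.
rewrite (virtual_step tu E' n1 n2) /left_to_right.
by rewrite (outside_velocity tU) (outside_velocity uU).
Qed.

Hypothesis Is_apart : pairwise (@apart R) Is.

Lemma sum_inside (s : seq R) (P : pred R) (F : R -> int) :
  \sum_(v <- s | U v && P v) F v = \sum_(J <- Is) \sum_(v <- s | (v \in dom J) && P v) F v.
Proof.
elim: Is Is_apart => [|J Js IHJs] /=; first by rewrite big_nil big_pred0.
case/andP=> /allP JJs /IHJs IH; rewrite big_cons -IH (bigID (fun v => v \in dom J)) /=.
congr (_ + _); apply: eq_bigl => v; first by case: (v \in dom J); rewrite ?andbF ?andbT.
case vJ : (v \in dom J); rewrite ?andbF ?andbT //=; apply/esym/negbTE.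
rewrite negb_and; apply/orP; left; apply/hasPn => K KJs; apply: apart_dom vJ.
exact: JJs.
Qed.

Hypothesis Is_sum : {in Is, forall J,
  \sum_(v <- virtual_times D | v \in dom J) degree_step D v =
  \sum_(v <- virtual_times D' | v \in dom J) degree_step D' v}.

Lemma virtual_times_uniq (E : diagram R) : uniq (virtual_times E).
Proof. by have := cuts_uniq E; rewrite sort_uniq cat_uniq => /and3P[]. Qed.

(** Virtual crossings outside the square are common to both diagrams, with equal steps. A strand of
    the square that has ended before [t] contributes its total sum of steps, which [Is_sum] assumes
    unchanged. *)
Lemma outside_height t : ~~ U t -> height D t = height D' t.
Proof.
move=> tU; have split_height (E : diagram R) : height E t =
    \sum_(J <- Is) (if J.2 <= t then \sum_(v <- virtual_times E | v \in dom J) degree_step E v else 0) +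
    \sum_(v <- virtual_times E | ~~ U v && (v < t)) degree_step E v.
  rewrite /height (bigID (inside Is)) /=; congr (_ + _); last first.
    by apply: eq_bigl => v; rewrite andbC.
  under eq_bigl do rewrite andbC; rewrite sum_inside; apply: eq_big_seq => J JIs.
  have tJ : t \notin dom J by move/hasPn: tU => /(_ J JIs).
  rewrite (eq_bigl (fun v => (v \in dom J) && (J.2 <= t))); last first.
    move=> v; case vJ : (v \in dom J) => //=; apply/idP/idP; move: vJ tJ;
      by rewrite !mem_dom negb_and -!leNgt => /andP[? ?] /orP[] ? ?; lra.
  by case: ifP => _; [apply: eq_bigl => v; rewrite andbT|rewrite big_pred0 // => v; rewrite andbF].
rewrite !split_height; congr (_ + _).
  by apply: eq_big_seq => J JIs; rewrite Is_sum.
have pV : perm_eq [seq v <- virtual_times D | ~~ U v && (v < t)]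
                  [seq v <- virtual_times D' | ~~ U v && (v < t)].
  apply: uniq_perm; rewrite ?filter_uniq ?virtual_times_uniq // => v; rewrite !mem_filter.
  by case vU : (U v) => //=; rewrite outside_virtual // vU.
rewrite -big_filter -[RHS]big_filter -[RHS](perm_big _ pV); apply: eq_big_seq => v.
by rewrite mem_filter => /andP[/andP[vU _] vV]; apply: outside_step.
Qed.

Definition outer (E : diagram R) := [seq c <- classical E | ~~ U c.1].
Definition inner (E : diagram R) := [seq c <- classical E | U c.1].

Lemma inside_crossing (E : diagram R) c : meets_square_in E Is -> c \in classical E ->
  U c.1 = U c.2.
Proof. by move=> sqE /classical_crossing/crossing_curve[_]; apply: inside_partner. Qed.

Lemma outer_perm : perm_eq (outer D) (outer D').
Proof.
have Ucl (E : diagram R) : uniq (classical E).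
  by have := curve_double E; rewrite cat_uniq => /andP[/map_uniq]; rewrite cat_uniq => /andP[].
apply: uniq_perm; rewrite ?filter_uniq // => -[t u]; rewrite !mem_filter /=.
case tU : (U t) => //=; apply/idP/idP => tuC; move: (tuC).
  by rewrite outside_classical ?tU // -(inside_crossing sq tuC) /= tU.
by rewrite -outside_classical ?tU // -(inside_crossing sq' tuC) /= tU.
Qed.

Lemma outer_garc_of c : c \in outer D -> garc_of D (weight D) c = garc_of D' (weight D') c.
Proof.
rewrite mem_filter => /andP[c1 cD]; have c2 : ~~ U c.2 by rewrite -(inside_crossing sq cD).
have E : weight D c = weight D' c by apply: weight_eq; exact: outside_velocity.
by rewrite /garc_of E !outside_height.
Qed.

(** [S] collects the common rows: [base] and the crossings outside the square, whose times, weights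
    and heights the move preserves. *)
Lemma move_garcs b e : exists2 S,
  perm_eq (garcs D (weight D) b e) (map (garc_of D (weight D)) (inner D) ++ S) /\
  perm_eq (garcs D' (weight D') b e) (map (garc_of D' (weight D')) (inner D') ++ S) &
  [/\ base T_ring b e \in S &
    {in S, forall x, x = base T_ring b e \/ [/\ ~~ U (st x), ~~ U (it x) & ~~ U (ot x)]}].
Proof.
exists (base T_ring b e :: map (garc_of D (weight D)) (outer D)).
  have split_cl (E : diagram R) : perm_eq (garcs E (weight E) b e)
      (map (garc_of E (weight E)) (inner E) ++ base T_ring b e :: map (garc_of E (weight E)) (outer E)).
    rewrite -cat1s perm_sym perm_catCA /= perm_cons -map_cat perm_map //.
    by rewrite perm_filterC.
  split; first exact: split_cl.
  apply: (perm_trans (split_cl D')); rewrite perm_cat2l perm_cons.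
  have E : map (garc_of D (weight D)) (outer D) = map (garc_of D' (weight D')) (outer D).
    by apply/eq_in_map; exact: outer_garc_of.
  apply: (eq_ind_r (fun s => perm_eq _ s) _ E).
  by rewrite perm_sym; apply: perm_map; exact: outer_perm.
split; first by rewrite inE eqxx.
move=> x; rewrite inE => /predU1P[->|/mapP[c cO ->]]; [by left|right; move: cO].
rewrite mem_filter => /andP[c1 cD]; have c2 : ~~ U c.2 by rewrite -(inside_crossing sq cD).
by split.
Qed.

End LocalMove.

Section UnitRelated.
Variable A : comNzRingType.
Implicit Types z : laurent A.

(** The factor is a constant unit, without any power of the variable, so it respects the vanishing
    of each coefficient. *)
Definition unit_related z z' := exists u v : A, u * v = 1 /\ z = lcst u * z'.

Lemma unit_related_refl z : unit_related z z.
Proof. by exists 1, 1; rewrite mulr1 rmorph1 mul1r. Qed.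

Lemma unit_related_sym z z' : unit_related z z' -> unit_related z' z.
Proof.
move=> [u [v [uv ->]]]; exists v, u; rewrite mulrC uv; split=> //.
by rewrite mulrA -rmorphM mulrC [v * u]mulrC uv rmorph1 mulr1.
Qed.

Lemma unit_related_trans z1 z2 z3 :
  unit_related z1 z2 -> unit_related z2 z3 -> unit_related z1 z3.
Proof.
move=> [u [v [uv ->]]] [u' [v' [uv' ->]]]; exists (u * u'), (v * v').
by rewrite mulrACA uv uv' mulr1 rmorphM mulrA.
Qed.

Lemma unit_relatedM u v z : u * v = 1 -> unit_related (lcst u * z) z.
Proof. by move=> uv; exists u, v. Qed.

Lemma unit_related_eq z z' : z = z' -> unit_related z z'.
Proof. by move=> ->; apply: unit_related_refl. Qed.

End UnitRelated.

Section SameZeta.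
Variable R : realType.
Implicit Types D : diagram R.

Definition cdet D b e := gdet (garcs D (weight D) b e).

(* Units of T appear only through the first move. *)
Definition same_zeta D D' := forall b e b' e', surrounds D b e -> surrounds D' b' e' ->
  unit_related (cdet D b e) (cdet D' b' e').

Lemma same_zetaI D D' b e b' e' : surrounds D b e -> surrounds D' b' e' ->
  unit_related (cdet D b e) (cdet D' b' e') -> same_zeta D D'.
Proof.
move=> be be' H b1 e1 b2 e2 be1 be2; rewrite /cdet.
by rewrite (gdet_base _ be1 be) (gdet_base _ be2 be').
Qed.

Lemma same_zetaE D D' b e b' e' x y : surrounds D b e -> surrounds D' b' e' ->
  cdet D b e = x -> cdet D' b' e' = y -> unit_related x y -> same_zeta D D'.
Proof. by move=> be be' <- <-; apply: same_zetaI. Qed.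

Lemma same_zeta_refl D : same_zeta D D.
Proof.
have [b [e [be _]]] := ex_surrounds D 0; apply: (same_zetaI be be).
exact: unit_related_refl.
Qed.

Lemma same_zeta_sym D D' : same_zeta D D' -> same_zeta D' D.
Proof. by move=> H b e b' e' be be'; apply/unit_related_sym/H. Qed.

Lemma same_zeta_trans D1 D2 D3 : same_zeta D1 D2 -> same_zeta D2 D3 -> same_zeta D1 D3.
Proof.
move=> H12 H23 b e b' e' be be'; have [b2 [e2 [be2 _]]] := ex_surrounds D2 0.
exact: unit_related_trans (H12 _ _ _ _ be be2) (H23 _ _ _ _ be2 be').
Qed.

Lemma weight_unit D c : exists v, weight D c * v = 1.
Proof.
rewrite /weight; case: ifP => _.
  by exists (p_pow (- writhe D c)); exact: p_powV.
by exists (q_pow (- writhe D c)); exact: q_powV.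
Qed.

Lemma virtual_step_pair D t u : t != u -> curve D t = curve D u ->
  (t, u) \notin classical D -> (u, t) \notin classical D ->
  degree_step D t + degree_step D u = 0.
Proof.
move=> tu E n1 n2; have ut : u != t by rewrite eq_sym.
rewrite (virtual_step tu E n1 n2) (virtual_step ut (esym E) n2 n1) /left_to_right.
have := curve_transverse tu E; rewrite -!/(velocity D _).
move: (velocity D t) (velocity D u) => x y; rewrite (cross_anti y) oppr_lt0.
by case: ltgtP.
Qed.

Lemma sum_virtual D (J : R * R) (s : seq R) : uniq s ->
  (forall v, (v \in virtual_times D) && (v \in dom J) = (v \in s)) ->
  \sum_(v <- virtual_times D | v \in dom J) degree_step D v = \sum_(v <- s) degree_step D v.
Proof.
move=> us sE; rewrite -big_filter; apply: perm_big; apply: uniq_perm => //.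
  by rewrite filter_uniq // virtual_times_uniq.
by move=> v; rewrite mem_filter andbC sE.
Qed.

Lemma classical_uniq D : uniq (classical D).
Proof.
by have := curve_double D; rewrite cat_uniq => /andP[/map_uniq]; rewrite cat_uniq => /andP[].
Qed.

Lemma inner_perm D Is (s : seq (R * R)) : uniq s ->
  (forall c, (c \in classical D) && inside Is c.1 = (c \in s)) ->
  perm_eq (inner Is D) s.
Proof.
move=> us sE; apply: uniq_perm; rewrite ?filter_uniq ?classical_uniq // => c.
by rewrite mem_filter andbC sE.
Qed.

Lemma cdet_inner D b e Is s S :
  perm_eq (garcs D (weight D) b e) (map (garc_of D (weight D)) (inner Is D) ++ S) ->
  perm_eq (inner Is D) s ->
  perm_eq (garcs D (weight D) b e) (map (garc_of D (weight D)) s ++ S).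
Proof. by move=> p ps; apply: perm_trans p _; rewrite perm_cat2r; exact: perm_map. Qed.

End SameZeta.

(** * Invariance under the first move *)

Section FirstMove.
Variables (R : realType) (D D' : diagram R).

Lemma first_move_zeta : first_move D D' -> same_zeta D D'.
Proof.
move=> [I [I12 [sq sq'] agree inj [t0 [u0 [t0I u0I tu0 D'E]]]]].
have UE t : inside [:: I] t = (t \in dom I) by rewrite /inside /= orbF.
have [b [e [be be' bex]]] := ex_surrounds2 D D' [:: I.1; I.2].
have bI : b \notin dom I.
  by rewrite mem_dom negb_and -!leNgt ltW //; have /andP[] := bex I.1 (mem_head _ _).
have tu : t0 != u0 by rewrite lt_eqF.
have E0 : curve D' t0 = curve D' u0 by apply/(D'E t0 u0 t0I u0I tu0).
have Dself t u : t != u -> curve D t = curve D u -> t \notin dom I.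
  move=> ntu E; apply/negP => tI; have uI : u \in dom I.
    by rewrite -UE -(inside_partner sq E) UE.
  by move: ntu; rewrite (inj _ _ tI uI E) eqxx.
have D'self t u : t != u -> curve D' t = curve D' u -> t \in dom I ->
    (t = t0 /\ u = u0) \/ (t = u0 /\ u = t0).
  move=> ntu E tI; have uI : u \in dom I by rewrite -UE -(inside_partner sq' E) UE.
  case: (ltgtP t u) ntu => // lt_tu _.
    by left; apply/(D'E t u).
  by right; have [] := (D'E u t uI tI lt_tu).1 (esym E); split.
have VD v : (v \in virtual_times D) && (v \in dom I) = (v \in [::]).
  apply/negP => /andP[/virtual_timeP[u [vu E _ _]]]; apply/negP; exact: Dself E.
have innerD : perm_eq (inner [:: I] D) [::].
  apply: inner_perm => // c; apply/negP => /andP[/classical_crossing/crossing_curve[ne E]].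
  by rewrite UE; apply/negP; exact: Dself E.
have same_classical c : c \in classical D' -> c.1 \in dom I -> c = (t0, u0) \/ c = (u0, t0).
  case: c => x y /= /classical_crossing/crossing_curve[/= ne E] xI.
  by case: (D'self x y ne E xI) => -[-> ->]; [left|right].
have sumD : \sum_(v <- virtual_times D | v \in dom I) degree_step D v = 0.
  by rewrite (sum_virtual _ VD) // big_nil.
have apI : pairwise (@apart R) [:: I] by [].
have IIs : I \in [:: I] by rewrite inE.
(* A virtual kink adds no row, and its two passages have opposite steps. A classical kink adds one
   row, with equal heights at its two passages. *)
have [clas|/norP[n1 n2]] := boolP (((t0, u0) \in classical D') || ((u0, t0) \in classical D')); last first.
  have sumD' : \sum_(v <- virtual_times D' | v \in dom I) degree_step D' v = 0.
    rewrite (@sum_virtual _ _ _ [:: t0; u0]) ?big_cons ?big_nil ?addr0.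
    - exact: virtual_step_pair.
    - by rewrite /= inE tu.
    move=> v; rewrite !inE; apply/andP/orP => [[/virtual_timeP[u [vu E _ _]] vI]|].
      by case: (D'self v u vu E vI) => -[-> _]; [left|right].
    case=> /eqP->; split=> //; apply/virtual_timeP.
      by exists u0.
    by exists t0; rewrite eq_sym.
  have innerD' : perm_eq (inner [:: I] D') [::].
    apply: inner_perm => // c; apply/negP => /andP[cD']; rewrite UE => cI.
    by case: (same_classical c cD' cI) => cE; rewrite cE in cD'; move: n1 n2; rewrite cD'.
  have Is_sum : {in [:: I], forall J,
      \sum_(v <- virtual_times D | v \in dom J) degree_step D v =
      \sum_(v <- virtual_times D' | v \in dom J) degree_step D' v}.
    by move=> J; rewrite inE => /eqP->; rewrite sumD sumD'.
  have [S [p p'] _] := move_garcs IIs agree sq sq' apI Is_sum b e.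
  have E : cdet D b e = gdet S := gdet_perm (cdet_inner p innerD).
  have E' : cdet D' b e = gdet S := gdet_perm (cdet_inner p' innerD').
  exact: (same_zetaE be be' E E' (unit_related_refl _)).
have [c0 [c0D c0I c0I' c0u]] : exists c0, [/\ c0 \in classical D', c0.1 \in dom I, c0.2 \in dom I &
    forall c, (c \in classical D') && (c.1 \in dom I) = (c \in [:: c0])].
  case/orP: clas => cD; [exists (t0, u0)|exists (u0, t0)]; split=> // c; rewrite inE;
    apply/andP/eqP => [[cD' cI]|->//]; case: (same_classical c cD' cI) => // cE.
    by move: cD'; rewrite cE => /classical_crossing/crossing_asym; rewrite classical_crossing.
  by move: cD'; rewrite cE => /classical_crossing/crossing_asym; rewrite classical_crossing.
have VD' v : (v \in virtual_times D') && (v \in dom I) = (v \in [::]).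
  apply/negP => /andP[/virtual_timeP[u [vu E n1 n2]] vI].
  by case: (D'self v u vu E vI) => -[vE uE]; move: clas n1 n2; rewrite vE uE => /orP[]->.
have Is_sum : {in [:: I], forall J,
    \sum_(v <- virtual_times D | v \in dom J) degree_step D v =
    \sum_(v <- virtual_times D' | v \in dom J) degree_step D' v}.
  by move=> J; rewrite inE => /eqP->; rewrite sumD (sum_virtual _ VD') // big_nil.
have innerD' : perm_eq (inner [:: I] D') [:: c0].
  by apply: inner_perm => // c; rewrite UE.
have [S [p p'] [bS outS]] := move_garcs IIs agree sq sq' apI Is_sum b e.
have E : cdet D b e = gdet S := gdet_perm (cdet_inner p innerD).
have p0 := cdet_inner p' innerD'; have E' := gdet_perm p0.
apply: (same_zetaE be be' E E'); apply: unit_related_sym.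
have [v wv] := weight_unit D' c0.
have U0 : uniq (map st (map (garc_of D' (weight D')) [:: c0] ++ S)).
  by rewrite -(perm_uniq (perm_map st p0)); exact: garcs_uniq be'.
have VI : {in virtual_times D', forall v, v \notin dom I}.
  by move=> x xV; have := VD' x; rewrite xV /= => ->.
have c0C : c0 \in classical D' by [].
have E1 : gdet (map (garc_of D' (weight D')) [:: c0] ++ S) =
    (if c0.1 < c0.2 then 1 else lcst (weight D' c0)) * gdet S.
  apply: (gdet_kink (I := I)) => //.
  - have [_ bc _] := be'; have [_ /andP[bc0 _]] := bc c0 c0C.
    by exists (base T_ring b e).
  - by rewrite /ct /wt /= (height_dom c0I c0I' VI) subrr lmonom0 mulr1.
  - by have [] := crossing_curve (classical_crossing c0C).
  by move=> x /outS[->//|[+ _ _]]; rewrite UE.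
apply: (unit_related_trans (unit_related_eq E1)).
case: ifP => _; last exact: unit_relatedM wv.
by exists 1, 1; rewrite mulr1 rmorph1.
Qed.

End FirstMove.

(** * Strands as graphs, and the second move *)

Lemma cvg_coord (R : realType) (T : Type) (F : set_system T) (FF : Filter F)
    (f : T -> R * R) (z : R * R) a b : f @ F --> z ->
  (fun x => a * (f x).1 + b * (f x).2) @ F --> a * z.1 + b * z.2.
Proof.
move=> fz; have fst_c : fst @ z --> z.1 by apply: cvg_fst; exact: cvg_id.
have snd_c : snd @ z --> z.2 by apply: cvg_snd; exact: cvg_id.
apply: cvgD; apply: cvgM; try exact: cvg_cst.
  exact: (cvg_comp f fst fz fst_c).
exact: (cvg_comp f snd fz snd_c).
Qed.

Section LinearForms.
Variables (R : realType) (E : diagram R) (a b : R).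
Implicit Types s t : R.

(** The abscissa, the horizontal axis and both diagonals are all described by linear forms, so one
    study of monotonicity serves for all strands. *)
Definition lin t : R := a * (curve E t).1 + b * (curve E t).2.
Definition dlin t : R := a * (velocity E t).1 + b * (velocity E t).2.

Lemma lin_cvg t :
  (fun h : R => h^-1 *: ((lin \o shift t) (h *: (1 : R)) - lin t)) @ 0^' --> dlin t.
Proof.
have df := @curve_derivable R E t.
have Df : (fun h : R => h^-1 *: ((curve E \o shift t) (h *: (1 : R)) - curve E t)) @ 0^'
    --> velocity E t by rewrite /velocity derive1E; exact: df.
have H : (fun h : R => a * (h^-1 *: ((curve E \o shift t) (h *: (1 : R)) - curve E t)).1
    + b * (h^-1 *: ((curve E \o shift t) (h *: (1 : R)) - curve E t)).2) @ 0^' --> dlin t.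
  exact: cvg_coord Df.
apply: cvg_trans H; apply: near_eq_cvg; near=> h.
rewrite /lin /=; move: (curve E _) (curve E _) => [x1 y1] [x2 y2] /=.
by rewrite -![_ *: _]/(_ * _); ring.
Unshelve. all: by end_near. Qed.

Lemma lin_derivable t : derivable lin t 1.
Proof. by apply/cvg_ex; exists (dlin t); exact: lin_cvg. Qed.

Lemma lin_derive t : derive1 lin t = dlin t.
Proof. by rewrite derive1E; apply: cvg_lim => //; exact: lin_cvg. Qed.

Lemma lin_continuous : continuous lin.
Proof. by move=> t; apply: differentiable_continuous; apply/derivable1_diffP/lin_derivable. Qed.

Lemma lin_incr s t : (forall r, s < r < t -> 0 < dlin r) -> s < t -> lin s < lin t.
Proof.
move=> pos st; apply: (@gtr0_derive1_lt_cc _ lin s t); rewrite ?in_itv /= ?lexx ?ltW //.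
- by move=> r _; apply: lin_derivable.
- by move=> r; rewrite in_itv /= lin_derive; exact: pos.
by apply: continuous_subspaceT => r; exact: lin_continuous.
Qed.

Lemma lin_ivt s t v : s < t -> lin s < v < lin t -> exists2 r, s < r < t & lin r = v.
Proof.
move=> st /andP[sv vt]; have [||r] := @IVT R lin s t v (ltW st).
- by apply: continuous_subspaceT => r; exact: lin_continuous.
- by rewrite ge_min le_max (ltW sv) (ltW vt) orbT.
rewrite in_itv /= => /andP[sr rt] rv; exists r => //.
rewrite !lt_neqAle sr rt !andbT; apply/andP; split.
  by apply: contraTneq sv => E'; rewrite E' rv ltxx.
by apply: contraTneq vt => E'; rewrite -E' rv ltxx.
Qed.

End LinearForms.

Lemma const_sign (R : realType) (g : R -> R) (J : R * R) s t : continuous g ->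
  (forall t, t \in dom J -> g t != 0) -> s \in dom J -> t \in dom J -> g s < 0 -> 0 < g t -> False.
Proof.
move=> gc g0 sJ tJ gs gt; pose a := Num.min s t; pose b := Num.max s t.
have ab : a <= b by rewrite /a /b ge_min le_max lexx.
have [||r] := @IVT R g a b 0 ab.
- by apply: continuous_subspaceT => r; exact: gc.
- rewrite /a /b; case: (leP s t) => _; rewrite ge_min le_max.
    by rewrite (ltW gs) (ltW gt) orbT.
  by rewrite (ltW gs) (ltW gt) orbT.
rewrite in_itv /= => /andP[ar rb] gr.
suff rJ : r \in dom J by have := g0 r rJ; rewrite gr eqxx.
move: sJ tJ ar rb; rewrite !mem_dom /a /b ge_min le_max => /andP[s1 s2] /andP[t1 t2] ar rb.
apply/andP; split; first by case/orP: ar; exact: lt_le_trans.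
by case/orP: rb => rb; exact: le_lt_trans rb _.
Qed.

Section ChordAnalysis.
Variables (R : realType) (E : diagram R) (J : R * R).
Implicit Types s t : R.

Lemma velocity_fst_continuous : continuous (fun t => (velocity E t).1).
Proof.
have [_ /(_ 1) c] := curve_smooth E 1 => t.
have H : (fun t => (velocity E t)) @ t --> velocity E t.
  have := c t; rewrite /continuous_at /velocity derive1E.
  apply: cvg_trans; apply: near_eq_cvg; near=> s; by rewrite derive1E.
have fst_c : fst @ velocity E t --> (velocity E t).1 by apply: cvg_fst; exact: cvg_id.
exact: (cvg_comp (velocity E) fst H fst_c).
Unshelve. all: by end_near. Qed.

Lemma chord_direction : chord E J -> exists sg : R, [/\ sg = 1 \/ sg = -1,
  (forall t, t \in dom J -> 0 < dlin E sg 0 t), lin E sg 0 J.1 = -1 & lin E sg 0 J.2 = 1].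
Proof.
move=> [J12 x1 x2 vx].
have const_sign := const_sign velocity_fst_continuous (fun t => vx t).
pose m := (J.1 + J.2) / 2.
have mJ : m \in dom J by rewrite mem_dom /m; apply/andP; split; lra.
pose sg : R := if 0 < (velocity E m).1 then 1 else -1.
have dpos t : t \in dom J -> 0 < dlin E sg 0 t.
  move=> tJ; rewrite /dlin mul0r addr0 /sg; have nt := vx t tJ; have nm := vx m mJ.
  case: ifP => vm.
    rewrite mul1r lt_neqAle eq_sym nt /= leNgt; apply/negP => vt.
    exact: const_sign tJ mJ vt vm.
  rewrite mulN1r oppr_gt0 lt_neqAle nt /= leNgt; apply/negP => vt.
  by apply: const_sign mJ tJ _ vt; rewrite lt_neqAle nm /= leNgt vm.
exists sg; have incr : lin E sg 0 J.1 < lin E sg 0 J.2.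
  by apply: lin_incr => // r rJ; apply: dpos; rewrite mem_dom.
have abs1 t : `|(curve E t).1| = 1 -> lin E sg 0 t = 1 \/ lin E sg 0 t = -1.
  rewrite /lin mul0r addr0 /sg => /eqP; rewrite eqr_norml => /andP[/orP[] /eqP-> _];
  by case: ifP => _; rewrite ?mul1r ?mulN1r ?opprK; auto.
split=> //; first by rewrite /sg; case: ifP => _; auto.
  by case: (abs1 _ x1) (abs1 _ x2) incr => -> [] ->; lra.
by case: (abs1 _ x1) (abs1 _ x2) incr => -> [] ->; lra.
Qed.

End ChordAnalysis.

Definition directed (R : realType) (E : diagram R) (J : R * R) (sg : R) : Prop :=
  [/\ J.1 < J.2, sg = 1 \/ sg = -1, (forall t, t \in dom J -> 0 < dlin E sg 0 t),
    lin E sg 0 J.1 = -1 & lin E sg 0 J.2 = 1].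

Section Directed.
Variables (R : realType) (E : diagram R) (J : R * R) (sg : R).
Hypothesis Jsg : directed E J sg.
Implicit Types s t : R.

Local Notation x t := (curve E t).1.

Lemma directed_lt s t : s \in dom J -> t \in dom J -> (s < t) = (sg * x s < sg * x t).
Proof.
have [_ _ dpos _ _] := Jsg; move=> sJ tJ.
have incr a b : a \in dom J -> b \in dom J -> a < b -> sg * x a < sg * x b.
  move=> aJ bJ ab; have := @lin_incr R E sg 0 a b; rewrite /lin !mul0r !addr0; apply=> //.
  by move=> r /andP[ar rb]; apply: dpos; apply: (dom_between aJ bJ); rewrite !ltW.
apply/idP/idP; first exact: incr.
by case: (ltgtP s t) => // [ts|->]; [move/(incr _ _ tJ sJ): ts => ts|]; rewrite ?ltxx //; lra.
Qed.

Lemma directed_inj s t : s \in dom J -> t \in dom J -> x s = x t -> s = t.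
Proof.
move=> sJ tJ xE; have := directed_lt sJ tJ; have := directed_lt tJ sJ.
by rewrite xE ltxx; case: ltgtP.
Qed.

Lemma directed_ivt v : -1 < v < 1 -> exists2 t, t \in dom J & x t = v.
Proof.
have [J12 sg1 dpos x1 x2] := Jsg; move=> /andP[v1 v2].
have [|t] := @lin_ivt R E sg 0 J.1 J.2 (sg * v) J12.
- by rewrite x1 x2; case: sg1 => ->; lra.
rewrite -mem_dom /lin mul0r addr0 => tJ E'; exists t => //.
by move: E'; case: sg1 => ->; lra.
Qed.

Lemma directed_velocity t : t \in dom J -> 0 < sg * (velocity E t).1.
Proof. by have [_ _ dpos _ _] := Jsg; move=> /dpos; rewrite /dlin mul0r addr0. Qed.

End Directed.

Lemma chord_directed (R : realType) (E : diagram R) J : chord E J -> exists sg, directed E J sg.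
Proof.
by move=> Jc; have [sg [? ? ? ?]] := chord_direction Jc; exists sg; split=> //; case: Jc.
Qed.

Section Slopes.
Variables (R : realType) (E : diagram R).

(** Only right-hand difference quotients are used, because the sign of the form is known on that
    side. *)
Lemma dlin_le0 a b r t : lin E a b r = 0 -> r < t ->
  (forall s, r < s < t -> lin E a b s <= 0) -> dlin E a b r <= 0.
Proof.
move=> lr rt le0; apply: (cvgr_to_le (cvg_dnbhs_at_right (@lin_cvg R E a b r))).
near=> h; rewrite lr subr0 /=.
have h0 : 0 < h by near: h; exact: nbhs_right_gt.
rewrite (_ : h *: 1 = h); last exact: mulr1.
apply: mulr_ge0_le0; first by rewrite invr_ge0 ltW.
apply: le0; apply/andP; split; first by rewrite ltrDr.
by rewrite -ltrBrDr; near: h; apply: nbhs_right_lt; rewrite subr_gt0.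
Unshelve. all: by end_near. Qed.

Lemma linN a b t : lin E (- a) (- b) t = - lin E a b t.
Proof. by rewrite /lin !mulNr opprD. Qed.

Lemma dlinN a b t : dlin E (- a) (- b) t = - dlin E a b t.
Proof. by rewrite /dlin !mulNr opprD. Qed.

Lemma dlin_zero a b J t : (forall s, s \in dom J -> lin E a b s = 0) -> t \in dom J ->
  dlin E a b t = 0.
Proof.
move=> l0 tJ; have : t < J.2 by move: tJ; rewrite mem_dom => /andP[].
move=> tJ2; have inJ s : t < s < J.2 -> s \in dom J.
  by move: tJ; rewrite !mem_dom => /andP[? _] /andP[? ->]; rewrite andbT; lra.
apply/eqP; rewrite eq_le (dlin_le0 (l0 t tJ) tJ2) /=; last by move=> s /inJ/l0->.
rewrite -oppr_le0 -dlinN (@dlin_le0 _ _ _ J.2) ?linN ?l0 ?oppr0 //.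
by move=> s /inJ/l0; rewrite linN => ->; rewrite oppr0.
Qed.

End Slopes.

Section DirectedAgree.
Variables (R : realType) (D D' : diagram R) (I J : R * R).
Hypotheses (agree : agree_off I D D') (IJ : apart I J).

Lemma agree_curve t : J.1 <= t <= J.2 -> J.1 < J.2 -> curve D t = curve D' t.
Proof.
move=> /andP[J1t tJ2] J12; apply: agree.1; rewrite mem_dom negb_and -!leNgt.
by move: IJ => /orP[] ?; apply/orP; [right|left]; lra.
Qed.

Lemma agree_directed sg : directed D J sg -> directed D' J sg.
Proof.
move=> [J12 sg1 dpos x1 x2]; split; [exact: J12|exact: sg1| | |].
- move=> t tJ; rewrite /dlin -(velocity_agree agree); first exact: dpos.
  by apply: apart_dom tJ; rewrite apart_sym.
- by rewrite -x1 /lin agree_curve // lexx ltW.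
by rewrite -x2 /lin agree_curve // lexx ltW.
Qed.

End DirectedAgree.

Lemma cross_horizontal (R : realType) (u v : R * R) : u.2 = 0 -> cross u v = u.1 * v.2.
Proof. by move=> u2; rewrite /cross u2 mul0r subr0. Qed.

Lemma same_sign (R : realType) (s x y : R) : 0 < s * x -> 0 < s * y -> 0 < x * y.
Proof.
move=> sx sy; have := mulr_gt0 sx sy; rewrite mulrACA pmulr_rgt0 // lt_neqAle -expr2 sqr_ge0 andbT.
by rewrite eq_sym sqrf_eq0; apply: contraTneq sx => ->; rewrite mul0r ltxx.
Qed.

Lemma half_abs (R : realType) (x : R) :
  [/\ - 2^-1 < x -> x < 2^-1 -> `|x| < 2^-1, 2^-1 < x -> 2^-1 < `|x| & x < - 2^-1 -> 2^-1 < `|x|].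
Proof.
split; first by rewrite ltr_norml => -> ->.
  by move=> hx; apply: lt_le_trans hx (ler_norm x).
by rewrite ltrNr -normrN => hx; apply: lt_le_trans hx (ler_norm _).
Qed.

Section SecondMove.
Variables (R : realType) (D D' : diagram R).

(** The ordinate on [I2] vanishes only at the abscissas -1/2 and 1/2, which gives the two crossings.
    It goes down through the axis at one of them and up at the other, hence the opposite signs. *)
Lemma second_move_crossings I1 I2 : apart I1 I2 -> agree_off I2 D D' ->
  chord D I1 -> chord D' I2 ->
  (forall t, t \in dom I1 -> (curve D t).2 = 0) ->
  (forall t, t \in dom I2 -> Num.sg (curve D' t).2 = Num.sg (`|(curve D' t).1| - 2^-1)) ->
  exists s1 s2 r1 r2,
  [/\ [/\ s1 \in dom I1, s2 \in dom I1, r1 \in dom I2 & r2 \in dom I2],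
    s1 != s2 /\ r1 != r2, curve D' s1 = curve D' r1 /\ curve D' s2 = curve D' r2,
    (forall s r, s \in dom I1 -> r \in dom I2 -> curve D' s = curve D' r ->
       (s = s1 /\ r = r1) \/ (s = s2 /\ r = r2)) &
    cross (velocity D' s1) (velocity D' r1) * cross (velocity D' s2) (velocity D' r2) < 0].
Proof.
move=> I12 agree c1 c2 y0 ysg; have I21 : apart I2 I1 by rewrite apart_sym.
have [sg1 d1] := chord_directed c1; have {}d1 := agree_directed agree I21 d1.
have [sg2 d2] := chord_directed c2.
have {}y0 t : t \in dom I1 -> (curve D' t).2 = 0.
  by move=> tI; rewrite -agree.1 ?y0 // (apart_dom I12).
have half3 : - 2^-1 < 2^-1 :> R by lra.
have half : -1 < - 2^-1 :> R /\ 2^-1 < 1 :> R by split; lra.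
have [s1 s1I x1] : exists2 t, t \in dom I1 & (curve D' t).1 = - 2^-1.
  by apply: (directed_ivt d1); lra.
have [s2 s2I x2] : exists2 t, t \in dom I1 & (curve D' t).1 = 2^-1.
  by apply: (directed_ivt d1); lra.
have [r1 r1I z1] : exists2 t, t \in dom I2 & (curve D' t).1 = - 2^-1.
  by apply: (directed_ivt d2); lra.
have [r2 r2I z2] : exists2 t, t \in dom I2 & (curve D' t).1 = 2^-1.
  by apply: (directed_ivt d2); lra.
have norm_half : `|- 2^-1| = 2^-1 :> R by rewrite normrN ger0_norm; lra.
have norm_half' : `|2^-1| = 2^-1 :> R by rewrite ger0_norm; lra.
have y1 : (curve D' r1).2 = 0.
  by apply/eqP; rewrite -sgr_eq0 ysg // z1 norm_half subrr sgr0.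
have y2 : (curve D' r2).2 = 0.
  by apply/eqP; rewrite -sgr_eq0 ysg // z2 norm_half' subrr sgr0.
have E1 : curve D' s1 = curve D' r1.
  by rewrite [LHS]surjective_pairing [RHS]surjective_pairing x1 z1 y1 y0.
have E2 : curve D' s2 = curve D' r2.
  by rewrite [LHS]surjective_pairing [RHS]surjective_pairing x2 z2 y2 y0.
exists s1, s2, r1, r2; split=> //.
- split; apply/eqP => E; [move: x1 x2|move: z1 z2]; rewrite E => ->; lra.
- move=> s r sI rI E; have yr : (curve D' r).2 = 0 by rewrite -E y0.
  have : `|(curve D' r).1| - 2^-1 = 0.
    by apply/eqP; rewrite -sgr_eq0 -ysg // yr sgr0.
  move=> /eqP; rewrite subr_eq0 eqr_norml => /andP[/orP[] /eqP xr _].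
    by right; split; [apply: (directed_inj d1)|apply: (directed_inj d2)]; rewrite ?E ?xr.
  by left; split; [apply: (directed_inj d1)|apply: (directed_inj d2)]; rewrite ?E ?xr.
have vy0 s : s \in dom I1 -> (velocity D' s).2 = 0.
  move=> sI; have := @dlin_zero _ D' 0 1 I1 s; rewrite /dlin mul0r add0r mul1r; apply=> //.
  by move=> t /y0 yt; rewrite /lin yt mul0r mulr0 addr0.
have ypos t : t \in dom I2 -> (2^-1 < `|(curve D' t).1|) -> 0 < (curve D' t).2.
  by move=> tI xt; rewrite -sgr_gt0 ysg // sgr_gt0 subr_gt0.
have yneg t : t \in dom I2 -> (`|(curve D' t).1| < 2^-1) -> (curve D' t).2 < 0.
  by move=> tI xt; rewrite -sgr_lt0 ysg // sgr_lt0 subr_lt0.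
have lastI r : r \in dom I2 -> r < I2.2 by rewrite mem_dom => /andP[].
have slope k r t : r \in dom I2 -> (curve D' r).2 = 0 -> r < t -> t <= I2.2 ->
    (forall s, s \in dom I2 -> r < s -> s < t -> k * (curve D' s).2 <= 0) ->
    k * (velocity D' r).2 <= 0.
  move=> rI yr rt tI H; have := @dlin_le0 _ D' 0 k r t; rewrite /dlin mul0r add0r; apply=> //.
    by rewrite /lin yr mul0r mulr0 addr0.
  move=> s /andP[rs st]; rewrite /lin mul0r add0r; apply: (H s _ rs st).
  move: rI; rewrite !mem_dom => /andP[Ir _]; rewrite (lt_trans Ir rs).
  exact: lt_le_trans st tI.
have lt := directed_lt d2.
(* The ordinate is negative between the two crossings and positive outside. Each slope is read from
   what follows the crossing in the direction of the strand, so the two directions are treated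
   separately. *)
have vy12 : (velocity D' r1).2 * (velocity D' r2).2 <= 0.
  case: d2 lt => _ [->|->] _ _ _ lt.
    have r12 : r1 < r2 by rewrite (lt _ _ r1I r2I) z1 z2 !mul1r; exact: half3.
    have S1 : 1 * (velocity D' r1).2 <= 0.
      apply: (slope 1 r1 r2 r1I y1 r12 (ltW (lastI _ r2I))) => s sI.
      rewrite (lt _ _ r1I sI) (lt _ _ sI r2I) z1 z2 !mul1r => h1 h2.
      by apply/ltW/(yneg _ sI); have [H _ _] := half_abs (curve D' s).1; exact: H.
    have S2 : -1 * (velocity D' r2).2 <= 0.
      apply: (slope (-1) r2 I2.2 r2I y2 (lastI _ r2I) (lexx _)) => s sI.
      rewrite (lt _ _ r2I sI) z2 mulN1r oppr_le0 !mul1r => h1 _.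
      by apply/ltW/(ypos _ sI); have [_ H _] := half_abs (curve D' s).1; exact: H.
    by move: S1 S2; rewrite mul1r mulN1r oppr_le0; exact: mulr_le0_ge0.
  have r21 : r2 < r1 by rewrite (lt _ _ r2I r1I) z1 z2 !mulN1r opprK; exact: half3.
  have S1 : -1 * (velocity D' r1).2 <= 0.
    apply: (slope (-1) r1 I2.2 r1I y1 (lastI _ r1I) (lexx _)) => s sI.
    rewrite (lt _ _ r1I sI) z1 !mulN1r oppr_le0 ltrN2 => h1 _.
    by apply/ltW/(ypos _ sI); have [_ _ H] := half_abs (curve D' s).1; exact: H.
  have S2 : 1 * (velocity D' r2).2 <= 0.
    apply: (slope 1 r2 r1 r2I y2 r21 (ltW (lastI _ r1I))) => s sI.
    rewrite (lt _ _ r2I sI) (lt _ _ sI r1I) z1 z2 !mulN1r mul1r !ltrN2 => h1 h2.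
    by apply/ltW/(yneg _ sI); have [H _ _] := half_abs (curve D' s).1; exact: H.
  by move: S1 S2; rewrite mul1r mulN1r oppr_le0; exact: mulr_ge0_le0.
have vx12 : 0 < (velocity D' s1).1 * (velocity D' s2).1.
  exact: same_sign (directed_velocity d1 s1I) (directed_velocity d1 s2I).
have ne s r : s \in dom I1 -> r \in dom I2 -> curve D' s = curve D' r ->
    cross (velocity D' s) (velocity D' r) != 0.
  move=> sI rI; apply: curve_transverse; apply: contraTneq sI => ->.
  by apply: apart_dom rI.
(* The slopes give only a weak inequality; transversality makes it strict. *)
rewrite lt_neqAle; apply/andP; split.
  exact: mulf_neq0 (ne _ _ s1I r1I E1) (ne _ _ s2I r2I E2).
rewrite (cross_horizontal _ (vy0 _ s1I)) (cross_horizontal _ (vy0 _ s2I)) mulrACA.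
exact: mulr_ge0_le0 (ltW vx12) vy12.
Qed.

End SecondMove.

Lemma bigon_coef (A : comNzRingType) (w1 w2 : A) (k : int) : w1 * w2 = 1 ->
  (1 - lcst w2) * lmonom A k + lcst w2 * ((1 - lcst w1) * lmonom A k) = 0.
Proof.
move=> w12; have E : lcst w1 * lcst w2 = 1 by rewrite -rmorphM w12 rmorph1.
transitivity ((1 - lcst w1 * lcst w2) * lmonom A k); first by ring.
by rewrite E subrr mul0r.
Qed.

Lemma sign_opp (R : realType) (x y : R) : x * y < 0 ->
  (if 0 < y then 1 else -1 : int) = - (if 0 < x then 1 else -1 : int).
Proof.
move=> xy; have [x0|x0] := ltP 0 x; have [y0|y0] := ltP 0 y; rewrite ?opprK //.
  by have := lt_trans (mulr_gt0 x0 y0) xy; rewrite ltxx.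
by have := le_lt_trans (mulr_le0 x0 y0) xy; rewrite ltxx.
Qed.

Section Bigon.
Variables (R : realType) (D : diagram R) (Jo Ju : R * R) (o1 o2 u1 u2 : R).
Hypotheses (o1J : o1 \in dom Jo) (o2J : o2 \in dom Jo) (u1J : u1 \in dom Ju) (u2J : u2 \in dom Ju).
Hypothesis Jou : apart Jo Ju.

(** The two crossings have the same early strand, hence the same variable, and opposite writhes,
    hence opposite exponents. *)
Lemma bigon_weight : cross (velocity D o1) (velocity D u1) * cross (velocity D o2) (velocity D u2) < 0 ->
  weight D (o1, u1) * weight D (o2, u2) = 1.
Proof.
move=> c12; have wE : writhe D (o2, u2) = - writhe D (o1, u1) by exact: sign_opp c12.
have eE : early_overcrossing (o2, u2) = early_overcrossing (o1, u1).
  exact: (apart_lt Jou o2J o1J u2J u1J).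
by rewrite /weight eE wE; case: ifP => _; [exact: p_powV|exact: q_powV].
Qed.

Lemma bigon_gdet b e S : surrounds D b e -> o1 != o2 -> u1 != u2 ->
  {in virtual_times D, forall v, v \notin dom Jo /\ v \notin dom Ju} ->
  weight D (o1, u1) * weight D (o2, u2) = 1 ->
  (o1, u1) \in classical D ->
  uniq (map st (map (garc_of D (weight D)) [:: (o1, u1); (o2, u2)] ++ S)) ->
  base T_ring b e \in S ->
  {in S, forall x, [/\ st x \notin dom Ju, it x \notin dom Ju, ot x \notin dom Ju & st x \notin dom Jo]} ->
  gdet (map (garc_of D (weight D)) [:: (o1, u1); (o2, u2)] ++ S) = gdet S.
Proof.
move=> be o12 u12 VD w12 cD US bS outS.
apply: (gdet_bigon (I := Ju) (J := Jo)) => //.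
- exists (base T_ring b e) => //; have [_ bc _] := be.
  by have [_ /andP[bu _]] := bc _ cD.
- by rewrite /wt /= -rmorphM w12 rmorph1.
- have ho : height D o1 = height D o2 by apply: (height_dom o1J o2J) => v /VD[].
  have hu : height D u1 = height D u2 by apply: (height_dom u1J u2J) => v /VD[].
  rewrite /ct /wt /= ho hu; exact: bigon_coef.
by rewrite apart_sym.
Qed.

End Bigon.

Section Setup.
Variables (R : realType) (D D' : diagram R) (Is : seq (R * R)) (I : R * R) (s s' : seq (R * R)).
Hypotheses (IIs : I \in Is) (agree : agree_off I D D').
Hypotheses (sq : meets_square_in D Is) (sq' : meets_square_in D' Is).
Hypothesis Is_apart : pairwise (@apart R) Is.
Hypothesis Is_sum : {in Is, forall J,
  \sum_(v <- virtual_times D | v \in dom J) degree_step D v =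
  \sum_(v <- virtual_times D' | v \in dom J) degree_step D' v}.
Hypotheses (sI : perm_eq (inner Is D) s) (sI' : perm_eq (inner Is D') s').

(** The common form of all local moves: only the rows of the crossings in the square differ, and the
    base times are chosen off the strands, so that every common row is outside all of them. *)
Lemma local_move b e : surrounds D b e -> surrounds D' b e ->
  {in Is, forall J, b \notin dom J /\ e \notin dom J} -> exists S,
  [/\ cdet D b e = gdet (map (garc_of D (weight D)) s ++ S) /\
    cdet D' b e = gdet (map (garc_of D' (weight D')) s' ++ S),
    uniq (map st (map (garc_of D (weight D)) s ++ S)) /\
    uniq (map st (map (garc_of D' (weight D')) s' ++ S)), base T_ring b e \in S &
    {in S, forall x, {in Is, forall J, outside J x}}].
Proof.
move=> be be' beI; have [S [p p'] [bS outS]] := move_garcs IIs agree sq sq' Is_apart Is_sum b e.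
have q := cdet_inner p sI; have q' := cdet_inner p' sI'; exists S; split=> //.
- by split; apply: gdet_perm.
- split; first by rewrite -(perm_uniq (perm_map st q)); exact: garcs_uniq be.
  by rewrite -(perm_uniq (perm_map st q')); exact: garcs_uniq be'.
move=> x /outS[->|[/hasPn h1 /hasPn h2 /hasPn h3]] J JI.
  by have [bJ eJ] := beI J JI; rewrite /outside bJ eJ.
by rewrite /outside h1 ?h2 ?h3.
Qed.

End Setup.

Lemma ex_surrounds_strands (R : realType) (D D' : diagram R) (Is : seq (R * R)) :
  exists b e, [/\ surrounds D b e, surrounds D' b e &
    {in Is, forall J, b \notin dom J /\ e \notin dom J}].
Proof.
have [b [e [be be' bex]]] := ex_surrounds2 D D' (map fst Is ++ map snd Is).
exists b, e; split=> // J JI.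
have /andP[b1 _] : b < J.1 < e by apply: bex; rewrite mem_cat map_f.
have /andP[_ e2] : b < J.2 < e by apply: bex; rewrite mem_cat map_f ?orbT.
by rewrite !mem_dom !negb_and -!leNgt (ltW b1) (ltW e2) orbT.
Qed.

Lemma cross_swap2 (R : realType) (a b c d : R * R) :
  cross a b * cross c d < 0 -> cross b a * cross d c < 0.
Proof. by rewrite (cross_anti a) (cross_anti c) mulrNN. Qed.

Lemma opposite_sides (R : realType) (a b c d : R * R) : cross a b * cross c d < 0 ->
  (if cross b a < 0 then 1 else -1 : int) = - (if cross d c < 0 then 1 else -1 : int).
Proof.
rewrite (cross_anti a) (cross_anti c) mulrNN; move: (cross b a) (cross d c) => x y xy.
have [x0|x0] := ltP x 0; have [y0|y0] := ltP y 0; rewrite ?opprK //.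
  by move: xy; rewrite nmulr_rlt0 // => /(lt_trans y0); rewrite ltxx.
by have := le_lt_trans (mulr_ge0 x0 y0) xy; rewrite ltxx.
Qed.

Lemma int_cancel (a b c d : int) : a + b = 0 -> c + d = 0 -> a + c = 0 -> b + d = 0.
Proof. by lia. Qed.

Lemma step_opp (R : realType) (D : diagram R) s1 r1 s2 r2 :
  cross (velocity D s1) (velocity D r1) * cross (velocity D s2) (velocity D r2) < 0 ->
  (if left_to_right D r1 s1 then 1 else -1 : int) = - (if left_to_right D r2 s2 then 1 else -1 : int).
Proof. exact: opposite_sides. Qed.

Section SecondMoveZeta.
Variables (R : realType) (D D' : diagram R).

Lemma second_move_zeta : second_move D D' -> same_zeta D D'.
Proof.
move=> [I1 [I2 [[I12 agree] [sq sq'] [c1 c2 c2'] [y0 ypos ysg] [k kE]]]].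
have I21 : apart I2 I1 by rewrite apart_sym.
have [s1 [s2 [r1 [r2 [[s1I s2I r1I r2I] [s12 r12] [E1 E2] only c12]]]]] :=
  second_move_crossings I12 agree c1 c2' y0 ysg.
have [sg1 d1] := chord_directed c1; have d1' := agree_directed agree I21 d1.
have [sg2 d2] := chord_directed c2; have [sg2' d2'] := chord_directed c2'.
pose Is := [:: I1; I2]; have IIs : I2 \in Is by rewrite !inE eqxx orbT.
have apI : pairwise (@apart R) Is by rewrite /= I12.
have UE t : inside Is t = (t \in dom I1) || (t \in dom I2) by rewrite /inside /= orbF.
have Dself t u : t != u -> curve D t = curve D u -> ~~ inside Is t.
  move=> ntu E; apply/negP => tI; have uI : inside Is u by rewrite -(inside_partner sq E).
  move: tI uI; rewrite !UE => /orP[] tI /orP[] uI.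
  - by move: ntu; rewrite (directed_inj d1 tI uI) ?E ?eqxx.
  - by have := ypos u uI; rewrite -E y0 ?ltxx.
  - by have := ypos t tI; rewrite E y0 ?ltxx.
  by move: ntu; rewrite (directed_inj d2 tI uI) ?E ?eqxx.
have D'self t u : t != u -> curve D' t = curve D' u -> inside Is t ->
    (t \in dom I1 /\ u \in dom I2) \/ (u \in dom I1 /\ t \in dom I2).
  move=> ntu E tI; have uI : inside Is u by rewrite -(inside_partner sq' E).
  move: tI uI; rewrite !UE => /orP[] tI /orP[] uI; [|by left|by right|].
    by move: ntu; rewrite (directed_inj d1' tI uI) ?E ?eqxx.
  by move: ntu; rewrite (directed_inj d2' tI uI) ?E ?eqxx.
have VD J v : J \in Is -> (v \in virtual_times D) && (v \in dom J) = (v \in [::]).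
  move=> JIs; apply/negP => /andP[/virtual_timeP[u [vu E _ _]]] vJ.
  by have /hasPn/(_ J JIs) := Dself v u vu E; rewrite vJ.
have sumD J : J \in Is -> \sum_(v <- virtual_times D | v \in dom J) degree_step D v = 0.
  by move=> JIs; rewrite (@sum_virtual _ _ _ [::]) ?big_nil // => v; apply: VD.
have innerD : perm_eq (inner Is D) [::].
  apply: inner_perm => // c; apply/negP => /andP[/classical_crossing/crossing_curve[ne E]].
  by apply/negP; exact: Dself E.
have ne_dom t u : t \in dom I1 -> u \in dom I2 -> t != u.
  by move=> tI uI; apply: contraTneq tI => ->; apply: apart_dom uI.
have [b [e [be be' beI]]] := ex_surrounds_strands D D' Is.
have [clas|virt] : (exists2 kc : crossing_kind, k = kc & kc <> Virtual) \/ k = Virtual.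
  by case: k {kE}; [left; exists Over|left; exists Under|right].
- case: clas => k0 kk0 k0V; subst k0.
  have VD' J v : J \in Is -> (v \in virtual_times D') && (v \in dom J) = (v \in [::]).
    move=> JIs; apply/negP => /andP[/virtual_timeP[u [vu E n1 n2]]] vJ.
    have vI : inside Is v by apply/hasP; exists J.
    case: (D'self v u vu E vI) => -[tI uI].
      by have := kE v u tI uI E; case: k k0V {kE} => // _; [move: n1 => /negP|move: n2 => /negP].
    by have := kE u v tI uI (esym E); case: k k0V {kE} => // _; [move: n2 => /negP|move: n1 => /negP].
  have sumD' J : J \in Is -> \sum_(v <- virtual_times D' | v \in dom J) degree_step D' v = 0.
    by move=> JIs; rewrite (@sum_virtual _ _ _ [::]) ?big_nil // => v; apply: VD'.
  have VI : {in virtual_times D', forall v, v \notin dom I1 /\ v \notin dom I2}.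
    by move=> v vV; split; apply/negP => vI; [have := VD' I1 v|have := VD' I2 v];
      rewrite vV vI /= !inE eqxx ?orbT /= => /(_ isT).
  have IsumD J : J \in Is -> \sum_(v <- virtual_times D | v \in dom J) degree_step D v =
      \sum_(v <- virtual_times D' | v \in dom J) degree_step D' v.
    by move=> JIs; rewrite sumD ?sumD'.
  (* [Jo] is the upper strand and [Ju] the lower one, which treats both kinds of classical crossings
     at once; exchanging the strands changes both signs and keeps their product. *)
  have [x1 [x2 [y1 [y2 [Jo [Ju [JJ [x1J x2J y1J y2J] [x12 y12] c12' inE']]]]]]] :
      exists x1 x2 y1 y2 Jo Ju, [/\ [/\ Jo \in Is, Ju \in Is & apart Jo Ju],
      [/\ x1 \in dom Jo, x2 \in dom Jo, y1 \in dom Ju & y2 \in dom Ju], x1 != x2 /\ y1 != y2,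
      cross (velocity D' x1) (velocity D' y1) * cross (velocity D' x2) (velocity D' y2) < 0 &
      forall c, (c \in classical D') && inside Is c.1 = (c \in [:: (x1, y1); (x2, y2)])].
    have I1s : I1 \in Is by rewrite !inE eqxx.
    have asym x y : (x, y) \in classical D' -> (y, x) \notin classical D'.
      by move=> /classical_crossing/crossing_asym n; apply/negP => /classical_crossing; apply/negP.
    case: k k0V kE => // _ kE.
      exists s1, s2, r1, r2, I1, I2; split; [by split|by split|by split|exact: c12|].
      move=> [x y]; rewrite !inE.
      apply/andP/orP => [[cD xI]|].
        have [/= ne E] := crossing_curve (classical_crossing cD).
        case: (D'self x y ne E xI) => -[h1 h2].
          by case: (only x y h1 h2 E) => -[-> ->]; [left|right].
        by have := asym _ _ cD; rewrite (kE y x h1 h2 (esym E)).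
      by case=> /eqP[-> ->]; rewrite UE /= ?s1I ?s2I kE.
    exists r1, r2, s1, s2, I2, I1; split; [by split|by split|by split|exact: cross_swap2 c12|].
    move=> [x y]; rewrite !inE; apply/andP/orP => [[cD xI]|].
      have [/= ne E] := crossing_curve (classical_crossing cD).
      case: (D'self x y ne E xI) => -[h1 h2].
        by have := asym _ _ cD; rewrite (kE x y h1 h2 E).
      by case: (only y x h1 h2 (esym E)) => -[-> ->]; [left|right].
    by case=> /eqP[-> ->]; rewrite UE /= ?r1I ?r2I orbT kE.
  have innerD' : perm_eq (inner Is D') [:: (x1, y1); (x2, y2)].
    by apply: inner_perm => //; rewrite /= !inE xpair_eqE (negPf x12).
  have [S [[E E'] [_ U'] bS outS]] := local_move IIs agree sq sq' apI IsumD innerD innerD' be be' beI.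
  have [JoI JuI Jou] := JJ.
  apply: (same_zetaE be be' E E'); apply: unit_related_sym; apply: unit_related_eq.
  apply: (bigon_gdet x1J x2J y1J y2J Jou be' x12 y12 _ _ _ U' bS).
  + move=> v vV; split; apply/negP => vJ; [have := VD' Jo v JoI|have := VD' Ju v JuI];
    by rewrite vV vJ.
  + exact: bigon_weight x1J x2J y1J y2J Jou c12'.
  + have : ((x1, y1) \in classical D') && inside Is (x1, y1).1 by rewrite inE' mem_head.
    by case/andP.
  by move=> x xS; have /and3P[? ? ?] := outS x xS Ju JuI; have /and3P[? _ _] := outS x xS Jo JoI; split.
have n12 t u : t \in dom I1 -> u \in dom I2 -> curve D' t = curve D' u ->
    (t, u) \notin classical D' /\ (u, t) \notin classical D'.
  by move=> tI uI E; move: kE; rewrite virt => /(_ t u tI uI E).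
have innerD' : perm_eq (inner Is D') [::].
  apply: inner_perm => // -[x y]; apply/negP => /andP[cD xI].
  have [/= ne E] := crossing_curve (classical_crossing cD).
  case: (D'self x y ne E xI) => -[h1 h2]; first by have [/negP] := n12 _ _ h1 h2 E.
  by have [_ /negP] := n12 _ _ h1 h2 (esym E).
have V1 v : (v \in virtual_times D') && (v \in dom I1) = (v \in [:: s1; s2]).
  rewrite mem_seq2; apply/andP/orP => [[/virtual_timeP[u [vu E _ _]] vI]|].
    have vU : inside Is v by rewrite UE vI.
    case: (D'self v u vu E vU) => -[h1 h2]; last by rewrite (negPf (apart_dom I12 vI)) in h2.
    by case: (only v u h1 h2 E) => -[-> _]; [left|right].
  case=> /eqP->; split=> //; apply/virtual_timeP.
    by have [? ?] := n12 _ _ s1I r1I E1; exists r1; split=> //; exact: ne_dom.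
  by have [? ?] := n12 _ _ s2I r2I E2; exists r2; split=> //; exact: ne_dom.
have V2 v : (v \in virtual_times D') && (v \in dom I2) = (v \in [:: r1; r2]).
  rewrite mem_seq2; apply/andP/orP => [[/virtual_timeP[u [vu E _ _]] vI]|].
    have vU : inside Is v by rewrite UE vI orbT.
    case: (D'self v u vu E vU) => -[h1 h2]; first by rewrite (negPf (apart_dom I21 vI)) in h1.
    by case: (only u v h1 h2 (esym E)) => -[_ ->]; [left|right].
  case=> /eqP->; split=> //; apply/virtual_timeP.
    by have [? ?] := n12 _ _ s1I r1I E1; exists s1; split=> //; rewrite eq_sym; exact: ne_dom.
  by have [? ?] := n12 _ _ s2I r2I E2; exists s2; split=> //; rewrite eq_sym; exact: ne_dom.
have st1 : degree_step D' s1 + degree_step D' r1 = 0.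
  by have [? ?] := n12 _ _ s1I r1I E1; apply: virtual_step_pair => //; exact: ne_dom.
have st2 : degree_step D' s2 + degree_step D' r2 = 0.
  by have [? ?] := n12 _ _ s2I r2I E2; apply: virtual_step_pair => //; exact: ne_dom.
(* The strands cross with opposite signs, so the two steps along each strand cancel and the heights
   beyond it are unchanged. *)
have st12 : degree_step D' s1 + degree_step D' s2 = 0.
  have [n1 n1'] := n12 _ _ s1I r1I E1; have [n2 n2'] := n12 _ _ s2I r2I E2.
  rewrite (virtual_step (ne_dom _ _ s1I r1I) E1 n1 n1').
  rewrite (virtual_step (ne_dom _ _ s2I r2I) E2 n2 n2').
  by rewrite -[X in _ + X]opprK -(step_opp c12) subrr.
have st3 : degree_step D' r1 + degree_step D' r2 = 0.
  exact: int_cancel st1 st2 st12.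
have IsumD J : J \in Is -> \sum_(v <- virtual_times D | v \in dom J) degree_step D v =
    \sum_(v <- virtual_times D' | v \in dom J) degree_step D' v.
  move=> JIs; rewrite (sumD J JIs); move: JIs; rewrite !inE => /orP[] /eqP->.
    by rewrite (sum_virtual _ V1) ?big_cons ?big_nil ?addr0 //= inE s12.
  by rewrite (sum_virtual _ V2) ?big_cons ?big_nil ?addr0 //= inE r12.
have [S [[E E'] _ _ _]] := local_move IIs agree sq sq' apI IsumD innerD innerD' be be' beI.
have {}E : cdet D b e = gdet S := E; have {}E' : cdet D' b e = gdet S := E'.
exact: (same_zetaE be be' E E' (unit_related_refl _)).
Qed.

End SecondMoveZeta.

(** * The third move *)

Section TriangleCoefficients.
Variables (A : comNzRingType) (wb wf wl : A) (kab kac kbc : int).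
Hypothesis kE : kac = kab + kbc.
Local Notation cb := ((1 - lcst wb) * lmonom A kab).
Local Notation cf := ((1 - lcst wf) * lmonom A kac).
Local Notation cl := ((1 - lcst wl) * lmonom A kbc).

(** Height differences add up by [kE], so both identities are multiples of the hypothesis on
    weights. [triangle_coef_inv] does the same for the other order of the crossings on the middle
    strand. *)
Lemma triangle_coef_eq : (wf - wb) * (1 - wl) = 0 ->
  cl * lcst wf = cl * lcst wb /\ cf * (1 - lcst wl) = cl * cb.
Proof.
move=> H; have {}H : (lcst wf - lcst wb) * (1 - lcst wl) = 0.
  by rewrite -(rmorph1 (@lcst A)) -!rmorphB -rmorphM H rmorph0.
split; apply/eqP; rewrite -subr_eq0; apply/eqP.
  transitivity ((lcst wf - lcst wb) * (1 - lcst wl) * lmonom A kbc); first by ring.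
  by rewrite H mul0r.
rewrite kE lmonomD.
transitivity ((lcst wf - lcst wb) * (1 - lcst wl) * - (lmonom A kab * lmonom A kbc)); first by ring.
by rewrite H mul0r.
Qed.

Lemma triangle_coef_inv : (wf * wb - 1) * (1 - wl) = 0 ->
  lcst wf * lcst wb * cl = cl /\ cf * (1 - lcst wl) = - (lcst wf * cl * cb).
Proof.
move=> H; have {}H : (lcst wf * lcst wb - 1) * (1 - lcst wl) = 0.
  by rewrite -(rmorph1 (@lcst A)) -(rmorphM (@lcst A) wf) -!rmorphB -rmorphM H rmorph0.
split; apply/eqP; rewrite -subr_eq0; apply/eqP.
  transitivity ((lcst wf * lcst wb - 1) * (1 - lcst wl) * lmonom A kbc); first by ring.
  by rewrite H mul0r.
rewrite kE lmonomD.
transitivity ((lcst wf * lcst wb - 1) * (1 - lcst wl) * - (lmonom A kab * lmonom A kbc)); first by ring.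
by rewrite H mul0r.
Qed.

End TriangleCoefficients.

Lemma sub_inv_eq0 (A : comNzRingType) (x y y' w : A) : y * y' = 1 ->
  (x - y) * w = 0 -> (x * y' - 1) * w = 0.
Proof.
move=> yy H; transitivity (y' * ((x - y) * w)); last by rewrite H mulr0.
by rewrite -yy; ring.
Qed.

Lemma opp_sub_eq0 (A : comNzRingType) (x y w : A) : (x - y) * w = 0 -> (y - x) * w = 0.
Proof. by rewrite -opprB mulNr => /eqP; rewrite oppr_eq0 => /eqP. Qed.

Lemma self_sub_eq0 (A : comNzRingType) (x w : A) : (x - x) * w = 0.
Proof. by rewrite subrr mul0r. Qed.

Section TriangleWeights.
Variables (R : realType) (D : diagram R) (b f l : R * R).

(* The weights of [f] and [b] may be powers of different variables, one p and
   the other q; the relations of T make them interchangeable here. *)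
Lemma T_weight0 s : (p_pow s - q_pow s) * (1 - weight D l) = 0.
Proof.
apply: (eq_ind_r (fun w => _ * (1 - w) = 0) _ (weightE D l)).
exact: (T_pq0 s (aug_zweight D l)).
Qed.

Lemma triangle_weight_eq : writhe D f = writhe D b ->
  (weight D f - weight D b) * (1 - weight D l) = 0.
Proof.
move=> E; rewrite {1 2}/weight E; case: ifP => _; case: ifP => _.
- exact: self_sub_eq0.
- exact: T_weight0.
- exact: opp_sub_eq0 (T_weight0 _).
exact: self_sub_eq0.
Qed.

Lemma triangle_weight_inv : writhe D f = - writhe D b ->
  (weight D f * weight D b - 1) * (1 - weight D l) = 0.
Proof.
move=> E; have {}E : writhe D b = - writhe D f by rewrite E opprK.
rewrite {1 2}/weight E; case: ifP => _; case: ifP => _.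
- exact: sub_inv_eq0 (p_powV _) (self_sub_eq0 _ _).
- exact: sub_inv_eq0 (q_powV _) (T_weight0 _).
- exact: sub_inv_eq0 (p_powV _) (opp_sub_eq0 (T_weight0 _)).
exact: sub_inv_eq0 (q_powV _) (self_sub_eq0 _ _).
Qed.

End TriangleWeights.

(** Weight and height difference are explicit here, so that rows of two diagrams can be given
    literally the same coefficients. *)
Definition row_at (R : realType) (A : comNzRingType) (w : A) (k : int) (c : R * R) : garc R (laurent A) :=
  ((c.2, c.2, c.1), (lcst w, (1 - lcst w) * lmonom A k)).

Lemma row_atE (R : realType) (D : diagram R) (s t : R) (w : T_ring) (h k : int) :
  weight D (s, t) = w -> height D s = h -> height D t = k ->
  garc_of D (weight D) (s, t) = row_at w (h - k) (s, t).
Proof. by move=> <- <- <-. Qed.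

Section TriangleRows.
Variables (R : realType) (L : comNzRingType) (A B C : R * R).
Variables (ab ba ac ca bc cb ab' ba' ac' ca' bc' cb' : R) (hA hB hC : int) (X : bool).
Hypotheses (AB : apart A B) (AC : apart A C) (BC : apart B C).
Hypotheses (abA : ab \in dom A) (acA : ac \in dom A) (ab'A : ab' \in dom A) (ac'A : ac' \in dom A)
  (baB : ba \in dom B) (bcB : bc \in dom B) (ba'B : ba' \in dom B) (bc'B : bc' \in dom B)
  (caC : ca \in dom C) (cbC : cb \in dom C) (ca'C : ca' \in dom C) (cb'C : cb' \in dom C).
Hypotheses (first_A : ca < cb) (first_B : cb' < ca')
  (order_B : (ba < bc) = X) (order_B' : (ba' < bc') = ~~ X).
Variables wab wac wbc : L.
Hypothesis wE : if X then (wac - wab) * (1 - wbc) = 0 else (wac * wab - 1) * (1 - wbc) = 0.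

Lemma triangle_rows S :
  let b := row_at wab (hA - hB) (ab, ba) in let b' := row_at wab (hA - hB) (ab', ba') in
  let f := row_at wac (hA - hC) (ac, ca) in let l' := row_at wac (hA - hC) (ac', ca') in
  let l := row_at wbc (hB - hC) (bc, cb) in let f' := row_at wbc (hB - hC) (bc', cb') in
  uniq (map st [:: b, f, l & S]) -> uniq (map st [:: b', f', l' & S]) ->
  {in S, forall x, [/\ outside A x, outside B x & outside C x]} ->
  gdet [:: b, f, l & S] = gdet [:: b', f', l' & S].
Proof.
move=> b b' f l' l f' U U' outS.
have kE : hA - hC = (hA - hB) + (hB - hC) by rewrite addrA subrK.
apply: (@gdet_triangle _ _ S b f l b' f' l' A B C X (if X then - ct l else wt f * ct l)) => //=.
  by rewrite !eqxx.
case: (X) wE => H.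
  by have [? ?] := triangle_coef_eq kE H.
by have [? ?] := triangle_coef_inv kE H.
Qed.

End TriangleRows.

Lemma writhe_neq (R : realType) (D : diagram R) c c' : writhe D c != writhe D c' ->
  writhe D c = - writhe D c'.
Proof.
have W c0 : writhe D c0 = 1 \/ writhe D c0 = -1 by rewrite /writhe; case: ifP; auto.
by case: (W c) (W c') => -> [] ->; rewrite ?eqxx ?opprK.
Qed.

Section TriangleZeta.
Variables (R : realType) (D D' : diagram R) (A B C : R * R).
Variables (ab ba ac ca bc cb ab' ba' ac' ca' bc' cb' : R) (hA hB hC : int).
Hypotheses (AB : apart A B) (AC : apart A C) (BC : apart B C).
Hypotheses (abA : ab \in dom A) (acA : ac \in dom A) (ab'A : ab' \in dom A) (ac'A : ac' \in dom A)
  (baB : ba \in dom B) (bcB : bc \in dom B) (ba'B : ba' \in dom B) (bc'B : bc' \in dom B)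
  (caC : ca \in dom C) (cbC : cb \in dom C) (ca'C : ca' \in dom C) (cb'C : cb' \in dom C).
Hypotheses (HA : {in dom A, forall t, height D t = hA /\ height D' t = hA})
  (HB : {in dom B, forall t, height D t = hB /\ height D' t = hB})
  (HC : {in dom C, forall t, height D t = hC /\ height D' t = hC}).
Hypotheses (wab : writhe D' (ab', ba') = writhe D (ab, ba))
  (wac : writhe D' (ac', ca') = writhe D (ac, ca))
  (wbc : writhe D' (bc', cb') = writhe D (bc, cb)).
Hypotheses (first_A : ca < cb) (first_B : cb' < ca').
Hypotheses (order_B : (ba < bc) = (writhe D (ac, ca) == writhe D (ab, ba)))
  (order_B' : (ba' < bc') = ~~ (writhe D (ac, ca) == writhe D (ab, ba))).

Lemma weight_same (I J : R * R) s t s' t' : apart I J -> s \in dom I -> s' \in dom I ->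
  t \in dom J -> t' \in dom J -> writhe D' (s', t') = writhe D (s, t) ->
  weight D' (s', t') = weight D (s, t).
Proof.
move=> IJ sI s'I tJ t'J wE.
have eE : early_overcrossing (s', t') = early_overcrossing (s, t).
  exact: (apart_lt IJ s'I sI t'J tJ).
by rewrite /weight eE wE.
Qed.

Lemma triangle_gdet S : 
  uniq (map st (map (garc_of D (weight D)) [:: (ab, ba); (ac, ca); (bc, cb)] ++ S)) ->
  uniq (map st (map (garc_of D' (weight D')) [:: (ab', ba'); (bc', cb'); (ac', ca')] ++ S)) ->
  {in S, forall x, [/\ outside A x, outside B x & outside C x]} ->
  gdet (map (garc_of D (weight D)) [:: (ab, ba); (ac, ca); (bc, cb)] ++ S) =
  gdet (map (garc_of D' (weight D')) [:: (ab', ba'); (bc', cb'); (ac', ca')] ++ S).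
Proof.
move=> U U' outS.
have [[hab _] [_ hab']] := (HA abA, HA ab'A); have [[hac _] [_ hac']] := (HA acA, HA ac'A).
have [[hba _] [_ hba']] := (HB baB, HB ba'B); have [[hbc _] [_ hbc']] := (HB bcB, HB bc'B).
have [[hca _] [_ hca']] := (HC caC, HC ca'C); have [[hcb _] [_ hcb']] := (HC cbC, HC cb'C).
have [Wab Wac Wbc] : [/\ weight D' (ab', ba') = weight D (ab, ba),
    weight D' (ac', ca') = weight D (ac, ca) & weight D' (bc', cb') = weight D (bc, cb)].
  by split; [exact: weight_same AB _ _ _ _ wab|exact: weight_same AC _ _ _ _ wac|
    exact: weight_same BC _ _ _ _ wbc].
have E : map (garc_of D (weight D)) [:: (ab, ba); (ac, ca); (bc, cb)] =
    [:: row_at (weight D (ab, ba)) (hA - hB) (ab, ba); row_at (weight D (ac, ca)) (hA - hC) (ac, ca);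
        row_at (weight D (bc, cb)) (hB - hC) (bc, cb)].
  rewrite /map (row_atE (erefl _) hab hba) (row_atE (erefl _) hac hca).
  by rewrite (row_atE (erefl _) hbc hcb).
have E' : map (garc_of D' (weight D')) [:: (ab', ba'); (bc', cb'); (ac', ca')] =
    [:: row_at (weight D (ab, ba)) (hA - hB) (ab', ba'); row_at (weight D (bc, cb)) (hB - hC) (bc', cb');
        row_at (weight D (ac, ca)) (hA - hC) (ac', ca')].
  by rewrite /map (row_atE Wab hab' hba') (row_atE Wac hac' hca') (row_atE Wbc hbc' hcb').
have wE : if writhe D (ac, ca) == writhe D (ab, ba)
    then (weight D (ac, ca) - weight D (ab, ba)) * (1 - weight D (bc, cb)) = 0
    else (weight D (ac, ca) * weight D (ab, ba) - 1) * (1 - weight D (bc, cb)) = 0.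
  have [H|H] := eqVneq (writhe D (ac, ca)) (writhe D (ab, ba)).
    exact: triangle_weight_eq H.
  exact: triangle_weight_inv (writhe_neq H).
have {}U := eq_ind _ (fun s => uniq (map st (s ++ S))) U _ E.
have {}U' := eq_ind _ (fun s => uniq (map st (s ++ S))) U' _ E'.
apply: (eq_ind_r (fun s => gdet (s ++ S) = _) _ E).
apply: (eq_ind_r (fun s => _ = gdet (s ++ S)) _ E').
exact: (triangle_rows AB AC BC abA acA ab'A ac'A baB bcB ba'B bc'B caC cbC ca'C cb'C
  first_A first_B order_B order_B' wE U U' outS).
Qed.

End TriangleZeta.

Section RealSigns.
Variable R : realType.
Implicit Types s x y v : R.

Definition is_sign s := s = 1 \/ s = -1.

Lemma slope_pos s x y : is_sign s -> 0 < s * x -> `|y| < `|x| ->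
  0 < s * x + s * y /\ 0 < s * x + - s * y.
Proof.
move=> [->|->]; rewrite ?opprK ?mulN1r ?mul1r.
  by move=> x0; rewrite (gtr0_norm x0) ltr_norml => /andP[? ?]; split; lra.
by rewrite oppr_gt0 => x0; rewrite (ltr0_norm x0) ltr_norml => /andP[? ?]; split; lra.
Qed.

Lemma sign_mul s s' x y : is_sign s -> is_sign s' -> 0 < s * x -> 0 < s' * y ->
  (0 < x * y) = (0 < s * s') /\ (x * y < 0) = (s * s' < 0).
Proof.
move=> ss ss' sx sy; have P : 0 < (s * s') * (x * y) by rewrite mulrACA mulr_gt0.
have S2 : s * s' = 1 \/ s * s' = -1.
  by case: ss ss' => -> [] ->; rewrite ?mul1r ?mulN1r ?opprK; auto.
move: P S2; move: (s * s') (x * y) => a b P [] E; move: P; rewrite E.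
  by rewrite mul1r => b0; rewrite b0 ltr01 !ltNge ler01 ltW.
by rewrite mulN1r oppr_gt0 => b0; rewrite b0 ltrN10 !ltNge lerN10 ltW.
Qed.

Lemma sign_order s (q x : R) : is_sign s -> is_sign q -> 0 < q * x ->
  (0 < s * x) = (0 < s * q) /\ (s * x < 0) = (s * q < 0).
Proof.
move=> [->|->] [->|->]; rewrite ?mulN1r ?mul1r ?opprK => x0; split; apply/idP/idP; lra.
Qed.

Lemma sign_follow s (q x y : R) : is_sign s -> is_sign q -> 0 < q * y -> x != 0 ->
  (0 < s * x) = (0 < s * y) -> 0 < q * x.
Proof.
move=> [->|->] [->|->]; rewrite ?mulN1r ?mul1r ?oppr_gt0 => y0 x0.
- by rewrite y0.
- by move=> E; rewrite lt_neqAle x0 leNgt E -leNgt ltW.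
- by move=> E; rewrite lt_neqAle eq_sym x0 leNgt E -leNgt ltW.
by rewrite y0.
Qed.

Lemma sign_sub_lt s (q x x' : R) : is_sign s -> is_sign q -> 0 < q * x -> q * x' < 0 ->
  (s * x < s * x') = (s * q < 0).
Proof.
move=> [->|->] [->|->]; rewrite ?mulN1r ?mul1r ?opprK => h h'; apply/idP/idP; lra.
Qed.

End RealSigns.

Lemma lin_mono (R : realType) (E : diagram R) a b (J : R * R) s t :
  (forall r, r \in dom J -> 0 < dlin E a b r) -> s \in dom J -> t \in dom J ->
  (s < t) = (lin E a b s < lin E a b t).
Proof.
move=> pos sJ tJ.
have incr x y : x \in dom J -> y \in dom J -> x < y -> lin E a b x < lin E a b y.
  move=> xJ yJ xy; apply: lin_incr xy => r /andP[xr ry]; apply: pos.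
  by apply: (dom_between xJ yJ); rewrite !ltW.
apply/idP/idP; first exact: incr.
have [//|ts|->] := ltgtP s t; last by rewrite ltxx.
by move=> l; have := lt_trans l (incr _ _ tJ sJ ts); rewrite ltxx.
Qed.

Lemma lin_mono_inj (R : realType) (E : diagram R) a b (J : R * R) s t :
  (forall r, r \in dom J -> 0 < dlin E a b r) -> s \in dom J -> t \in dom J ->
  lin E a b s = lin E a b t -> s = t.
Proof.
move=> pos sJ tJ le; have := lin_mono pos sJ tJ; have := lin_mono pos tJ sJ.
by rewrite le ltxx; case: ltgtP.
Qed.

(** * Crossings of two diagonals with a flat third strand *)

Section ThirdGeometry.
Variables (R : realType) (E : diagram R) (I1 I2 I3 : R * R) (s1 s2 s3 q : R).
Hypotheses (d1 : directed E I1 s1) (d2 : directed E I2 s2) (d3 : directed E I3 s3).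
Hypotheses (sq : meets_square_in E [:: I1; I2; I3]).
Hypotheses (y1 : forall t, t \in dom I1 -> (curve E t).2 = (curve E t).1)
  (y2 : forall t, t \in dom I2 -> (curve E t).2 = - (curve E t).1)
  (v3 : forall t, t \in dom I3 -> `|(velocity E t).2| < `|(velocity E t).1|).
Hypotheses (q1 : is_sign q)
  (y3 : forall t, t \in dom I3 -> (curve E t).1 = 0 -> 0 < q * (curve E t).2).
Hypotheses (p_ends : lin E s3 (- s3) I3.1 < 0 < lin E s3 (- s3) I3.2)
  (m_ends : lin E s3 s3 I3.1 < 0 < lin E s3 s3 I3.2).

Let ss1 : is_sign s1. Proof. by case: d1. Qed.
Let ss2 : is_sign s2. Proof. by case: d2. Qed.
Let ss3 : is_sign s3. Proof. by case: d3. Qed.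
Let J12 : I3.1 < I3.2. Proof. by case: d3. Qed.

(* With [s3] the direction of the strand, [lin E s3 (- s3)] vanishes on the
   diagonal [I1], [lin E s3 s3] on [I2], and both increase along [I3]. *)
Lemma lin_plus_pos t : t \in dom I3 -> 0 < dlin E s3 s3 t.
Proof. by move=> tI; have [] := slope_pos ss3 (directed_velocity d3 tI) (v3 tI). Qed.

Lemma lin_minus_pos t : t \in dom I3 -> 0 < dlin E s3 (- s3) t.
Proof. by move=> tI; have [] := slope_pos ss3 (directed_velocity d3 tI) (v3 tI). Qed.

Lemma lin_plus_eq0 t : lin E s3 s3 t = 0 <-> (curve E t).2 = - (curve E t).1.
Proof. by rewrite /lin; case: ss3 => ->; split; lra. Qed.

Lemma lin_minus_eq0 t : lin E s3 (- s3) t = 0 <-> (curve E t).2 = (curve E t).1.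
Proof. by rewrite /lin; case: ss3 => ->; split; lra. Qed.

Lemma in_square_fst (J : R * R) t : J \in [:: I1; I2; I3] -> t \in dom J -> -1 < (curve E t).1 < 1.
Proof.
move=> JI tJ; have : in_square (curve E t) by rewrite sq; apply/hasP; exists J.
by case/andP; rewrite ltr_norml.
Qed.

(** Times [a], [b], [c] lie on [I1], [I2], [I3], and the digit names the other strand. The diagonals
    meet at abscissa 0. The sign [q] of the side on which [I3] passes the centre gives the sides of
    its two crossings, hence all the orders; the signs of the crossings depend on the directions
    alone. *)
Lemma third_crossings : exists a2 a3 b1 b3 c1 c2,
  [/\ [/\ a2 \in dom I1, a3 \in dom I1, b1 \in dom I2 & b3 \in dom I2] /\
      (c1 \in dom I3 /\ c2 \in dom I3),
    [/\ curve E a2 = curve E b1, curve E a3 = curve E c1 & curve E b3 = curve E c2],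
    [/\ forall t u, t \in dom I1 -> u \in dom I2 -> curve E t = curve E u -> t = a2 /\ u = b1,
      forall t u, t \in dom I1 -> u \in dom I3 -> curve E t = curve E u -> t = a3 /\ u = c1 &
      forall t u, t \in dom I2 -> u \in dom I3 -> curve E t = curve E u -> t = b3 /\ u = c2],
    [/\ (a2 < a3) = (0 < s1 * q), (b1 < b3) = (s2 * q < 0) & (c1 < c2) = (s3 * q < 0)] &
    [/\ (0 < cross (velocity E a2) (velocity E b1)) = (s1 * s2 < 0),
      (0 < cross (velocity E a3) (velocity E c1)) = (s1 * s3 < 0) &
      (0 < cross (velocity E b3) (velocity E c2)) = (0 < s2 * s3)]].
Proof.
have z1 : -1 < (0 : R) < 1 by rewrite ltrN10 ltr01.
have [t0 t0I x0] := directed_ivt d3 z1; have q0 := y3 t0I x0.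
have [c1 c1I p1] := lin_ivt J12 p_ends; have [c2 c2I m2] := lin_ivt J12 m_ends.
rewrite -mem_dom in c1I; rewrite -mem_dom in c2I.
have yc1 := (lin_minus_eq0 c1).1 p1; have yc2 := (lin_plus_eq0 c2).1 m2.
have xn t : t \in dom I3 -> (curve E t).2 = (curve E t).1 \/ (curve E t).2 = - (curve E t).1 ->
    (curve E t).1 != 0.
  move=> tI yt; apply/eqP => xt; have := y3 tI xt.
  by case: yt => ->; rewrite xt ?oppr0 mulr0 ltxx.
(* At abscissa 0 the strand lies on the side [q] and its slope is less than 1 in absolute value. It
   therefore meets y = x where the abscissa has the sign of [q], and y = - x where it has the
   opposite sign. *)
have qc1 : 0 < q * (curve E c1).1.
  apply: (sign_follow ss3 q1 q0 (xn _ c1I (or_introl yc1))).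
  have := directed_lt d3 t0I c1I; rewrite x0 mulr0 => <-.
  rewrite (lin_mono lin_minus_pos t0I c1I) p1 /lin x0 mulr0 add0r mulNr.
  by rewrite oppr_lt0.
have qc2 : q * (curve E c2).1 < 0.
  rewrite -oppr_gt0 -mulrN; apply: (sign_follow ss3 q1 q0).
    by rewrite oppr_eq0 (xn _ c2I (or_intror yc2)).
  have := directed_lt d3 c2I t0I; rewrite x0 mulr0 mulrN oppr_gt0 => <-.
  by rewrite (lin_mono lin_plus_pos c2I t0I) m2 /lin x0 mulr0 add0r.
have I1s : I1 \in [:: I1; I2; I3] by rewrite inE eqxx.
have I2s : I2 \in [:: I1; I2; I3] by rewrite !inE eqxx orbT.
have I3s : I3 \in [:: I1; I2; I3] by rewrite !inE eqxx !orbT.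
have [a3 a3I xa3] := directed_ivt d1 (in_square_fst I3s c1I).
have [b3 b3I xb3] := directed_ivt d2 (in_square_fst I3s c2I).
have [a2 a2I xa2] := directed_ivt d1 z1; have [b1 b1I xb1] := directed_ivt d2 z1.
exists a2, a3, b1, b3, c1, c2; split; [by split| | | |].
- split; rewrite [LHS]surjective_pairing [RHS]surjective_pairing.
  + by rewrite xa2 xb1 y1 // y2 // xa2 xb1 oppr0.
  + by rewrite y1 // yc1 xa3.
  by rewrite y2 // yc2 xb3.
- split=> t u tI uI e.
  + have x : (curve E t).1 = 0.
      by have := y1 tI; rewrite e y2 // => /eqP; rewrite -subr_eq0 -opprD oppr_eq0 -mulr2n mulrn_eq0 => /eqP.
    split; first by apply: (directed_inj d1 tI a2I); rewrite x.
    by apply: (directed_inj d2 uI b1I); rewrite -e x.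
  + have uc : u = c1.
      by apply: (lin_mono_inj lin_minus_pos uI c1I); rewrite p1; apply/lin_minus_eq0; rewrite -e y1.
    by split=> //; apply: (directed_inj d1 tI a3I); rewrite e uc.
  have uc : u = c2.
    by apply: (lin_mono_inj lin_plus_pos uI c2I); rewrite m2; apply/lin_plus_eq0; rewrite -e y2.
  by split=> //; apply: (directed_inj d2 tI b3I); rewrite e uc.
- split.
  + rewrite (directed_lt d1 a2I a3I) xa2 xa3 mulr0.
    by have [] := sign_order ss1 q1 qc1.
  + rewrite (directed_lt d2 b1I b3I) xb1 xb3 mulr0.
    rewrite -oppr_gt0 -mulrN in qc2.
    by have [_ <-] := sign_order ss2 q1 qc2; rewrite mulrN oppr_lt0.
  rewrite (directed_lt d3 c1I c2I).
  exact: sign_sub_lt.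
have v1 t : t \in dom I1 -> (velocity E t).2 = (velocity E t).1.
  move=> tI; have := @dlin_zero _ E 1 (-1) I1 t.
  rewrite /dlin mul1r mulN1r => H; apply/eqP; rewrite eq_sym -subr_eq0; apply/eqP; apply: H => //.
  by move=> s sI; rewrite /lin y1 // mul1r mulN1r subrr.
have v2 t : t \in dom I2 -> (velocity E t).2 = - (velocity E t).1.
  move=> tI; have := @dlin_zero _ E 1 1 I2 t.
  rewrite /dlin !mul1r => H; apply/eqP; rewrite -addr_eq0 addrC; apply/eqP; apply: H => //.
  by move=> s sI; rewrite /lin y2 // !mul1r subrr.
have V1 := directed_velocity d1; have V2 := directed_velocity d2.
have Vp := lin_plus_pos c2I; have Vm := lin_minus_pos c1I.
have := V1 _ a2I; have := V1 _ a3I; have := V2 _ b1I; have := V2 _ b3I.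
have := v1 _ a2I; have := v1 _ a3I; have := v2 _ b1I; have := v2 _ b3I.
move: Vp Vm; rewrite /dlin /cross.
move: (velocity E a2) (velocity E a3) (velocity E b1) (velocity E b3) (velocity E c1) (velocity E c2).
move=> [x2 z2] [x3 z3] [u1 w1] [u3 w3] [k1 l1] [k2 l2] /= Vp Vm -> -> -> -> U3 U1 X3 X2.
split.
- have [_ <-] := sign_mul ss1 ss2 X2 U1.
  by rewrite (_ : x2 * - u1 - x2 * u1 = - (x2 * u1) *+ 2) ?pmulrn_lgt0 ?oppr_gt0 //; ring.
- rewrite mulNr -mulrBr in Vm; have [_ <-] := sign_mul ss1 ss3 X3 Vm.
  by rewrite -oppr_gt0; congr (_ < _); ring.
rewrite -mulrDr in Vp; have [<- _] := sign_mul ss2 ss3 U3 Vp.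
by congr (_ < _); ring.
Qed.

End ThirdGeometry.

Lemma sign_anti (R : realType) (x y : R * R) : cross x y != 0 ->
  (if 0 < cross y x then 1 else -1 : int) = - (if 0 < cross x y then 1 else -1 : int).
Proof. by rewrite (cross_anti y) oppr_gt0; case: ltgtP => // _ _; rewrite opprK. Qed.

Section MeetsOnce.
Variables (R : realType) (E : diagram R).
Implicit Types (I J : R * R) (s t : R).

Definition meets_once I J s t : Prop :=
  [/\ s \in dom I, t \in dom J, curve E s = curve E t &
    forall s' t', s' \in dom I -> t' \in dom J -> curve E s' = curve E t' -> s' = s /\ t' = t].

Lemma meets_once_sym I J s t : meets_once I J s t -> meets_once J I t s.
Proof.
move=> [sI tJ e only]; split=> // t' s' t'J s'I /esym e'.
by have [-> ->] := only s' t' s'I t'J e'.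
Qed.

Lemma crosses_as_sym I J : crosses_as Under E I J -> crosses_as Over E J I.
Proof. by move=> H t s tJ sI e; apply: (H s t sI tJ (esym e)). Qed.

Lemma writhe_swap s t : s != t -> curve E s = curve E t -> writhe E (t, s) = - writhe E (s, t).
Proof. by move=> st e; exact: sign_anti (curve_transverse st e). Qed.

Lemma classical_asym s t : (s, t) \in classical E -> (t, s) \notin classical E.
Proof. by move=> /classical_crossing/crossing_asym n; apply/negP => /classical_crossing; apply/negP. Qed.

End MeetsOnce.

Section ClassicalTriangle.
Variables (R : realType) (E : diagram R) (Is : seq (R * R)) (A B C : R * R) (ab ba ac ca bc cb : R).
Hypotheses (UE : forall t, inside Is t = [|| t \in dom A, t \in dom B | t \in dom C])
  (sq : meets_square_in E Is).
Hypotheses (iA : {in dom A &, injective (curve E)}) (iB : {in dom B &, injective (curve E)})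
  (iC : {in dom C &, injective (curve E)}).
Hypotheses (AB : apart A B) (AC : apart A C) (BC : apart B C).
Hypotheses (mAB : meets_once E A B ab ba) (mAC : meets_once E A C ac ca) (mBC : meets_once E B C bc cb).

(** Each strand is embedded, so a double point in the square lies on two different strands, and each
    pair of strands meets once. *)
Lemma double_points s t : s != t -> curve E s = curve E t -> inside Is s ->
  [\/ (s, t) = (ab, ba) \/ (t, s) = (ab, ba), (s, t) = (ac, ca) \/ (t, s) = (ac, ca) |
      (s, t) = (bc, cb) \/ (t, s) = (bc, cb)].
Proof.
move=> st e sI; have tI : inside Is t by rewrite -(inside_partner sq e).
have [_ _ _ oAB] := mAB; have [_ _ _ oAC] := mAC; have [_ _ _ oBC] := mBC.
move: sI tI; rewrite !UE => /or3P[] sI /or3P[] tI;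
  try (by move: st; rewrite (iA sI tI e) eqxx); try (by move: st; rewrite (iB sI tI e) eqxx);
  try (by move: st; rewrite (iC sI tI e) eqxx).
- by have [-> ->] := oAB _ _ sI tI e; apply: Or31; left.
- by have [-> ->] := oAC _ _ sI tI e; apply: Or32; left.
- by have [-> ->] := oAB _ _ tI sI (esym e); apply: Or31; right.
- by have [-> ->] := oBC _ _ sI tI e; apply: Or33; left.
- by have [-> ->] := oAC _ _ tI sI (esym e); apply: Or32; right.
by have [-> ->] := oBC _ _ tI sI (esym e); apply: Or33; right.
Qed.

Hypotheses (kAB : crosses_as Over E A B) (kAC : crosses_as Over E A C) (kBC : crosses_as Over E B C).

Lemma over_crossings : [/\ (ab, ba) \in classical E, (ac, ca) \in classical E & (bc, cb) \in classical E].
Proof.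
have [? ? ? _] := mAB; have [? ? ? _] := mAC; have [? ? ? _] := mBC.
by split; [apply: kAB|apply: kAC|apply: kBC].
Qed.

Lemma no_virtual_inside : {in virtual_times E, forall v, ~~ inside Is v}.
Proof.
move=> v /virtual_timeP[u [vu e n1 n2]]; apply/negP => vI.
have [c1 c2 c3] := over_crossings.
by case: (double_points vu e vI) => -[] E'; move: E' n1 n2 => [-> ->]; rewrite ?c1 ?c2 ?c3.
Qed.

Lemma inside_classical c : (c \in classical E) && inside Is c.1 = (c \in [:: (ab, ba); (ac, ca); (bc, cb)]).
Proof.
have [c1 c2 c3] := over_crossings; have [abA _ _ _] := mAB; have [acA _ _ _] := mAC.
have [bcB _ _ _] := mBC.
case: c => s t; apply/andP/idP => [[cE sI]|].
  have [/= ne e] := crossing_curve (classical_crossing cE).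
  case: (double_points ne e sI) => -[] st; rewrite ?st ?inE ?eqxx ?orbT //;
    by move: st (classical_asym cE) => ->; rewrite ?c1 ?c2 ?c3.
by rewrite !inE => /or3P[] /eqP[-> ->]; rewrite UE /= ?abA ?acA ?bcB ?orbT.
Qed.

(** A double point has a single partner, whereas this time would be paired with times on two
    disjoint strands. *)
Lemma under_neq : ca != cb.
Proof.
have [acA caC e1 _] := mAC; have [bcB _ e2 _] := mBC; apply/eqP => E'.
have n1 : ca != ac by apply: contraTneq acA => <-; apply: apart_dom caC; rewrite apart_sym.
have n2 : ca != bc by apply: contraTneq bcB => <-; apply: apart_dom caC; rewrite apart_sym.
have e2' : curve E ca = curve E bc by rewrite E' e2.
have acE := partner_uniq n1 n2 (esym e1) e2'.
by have := apart_dom AB acA; rewrite acE bcB.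
Qed.

Lemma triangle_inner : perm_eq (inner Is E) [:: (ab, ba); (ac, ca); (bc, cb)].
Proof.
apply: inner_perm; last exact: inside_classical.
have [c1 c2 c3] := over_crossings; have [abA baB _ _] := mAB; have [acA caC _ _] := mAC.
have [bcB cbC _ _] := mBC.
have n1 : ba != ca by apply: contraTneq baB => ->; apply: apart_dom caC; rewrite apart_sym.
have n2 : ba != cb by apply: contraTneq baB => ->; apply: apart_dom cbC; rewrite apart_sym.
have n3 : ac != bc by apply: contraTneq bcB => <-; apply: apart_dom acA.
by rewrite /= !inE !xpair_eqE (negPf n1) (negPf n2) (negPf n3) !andbF.
Qed.

End ClassicalTriangle.

(** The constant height is read at the end of the strand, a time outside the open strands, where the
    two diagrams can be compared. *)
Lemma height_strand (R : realType) (E : diagram R) (J : R * R) t : t \in dom J ->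
  {in virtual_times E, forall v, v \notin dom J} -> height E t = height E J.2.
Proof.
rewrite mem_dom => /andP[t1 t2] VJ; rewrite /height big_seq_cond [RHS]big_seq_cond.
apply: eq_bigl => v; case vV : (v \in virtual_times E) => //=.
have := VJ v vV; rewrite mem_dom negb_and -!leNgt => /orP[] h.
  by rewrite (le_lt_trans h t1) (le_lt_trans h (lt_trans t1 t2)).
by rewrite !ltNge h (ltW (lt_le_trans t2 h)).
Qed.

Lemma strand_end_outside (R : realType) (Is : seq (R * R)) (J : R * R) : pairwise (@apart R) Is ->
  {in Is, forall J, J.1 < J.2} -> J \in Is -> ~~ inside Is J.2.
Proof.
move=> apI lt_ends JIs; apply/hasPn => K KIs; rewrite mem_dom; apply/negP => /andP[h1 h2].
have h3 := lt_ends J JIs.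
have apJK : J != K -> apart J K \/ apart K J.
  move: apI JIs KIs; elim: (Is) => //= L Ls IHL /andP[/allP h apLs].
  rewrite !inE => /predU1P[->|JL] /predU1P[->|KL] ne.
  - by rewrite eqxx in ne.
  - by left; exact: h.
  - by right; exact: h.
  exact: IHL.
have [E|ne] := eqVneq J K; first by rewrite E ltxx in h2.
have {}apJK : apart J K by case: (apJK ne) => //; rewrite apart_sym.
by move: apJK => /orP[] h; [move: (lt_le_trans h1 h)|move: (lt_trans h2 (le_lt_trans h h3))]; rewrite ltxx.
Qed.

(** * The third move with three classical crossings *)

Section ThirdClassical.
Variables (R : realType) (D D' : diagram R) (Is : seq (R * R)) (I A B C : R * R).
Variables (ab ba ac ca bc cb ab' ba' ac' ca' bc' cb' : R).
Hypotheses (IIs : I \in Is) (agree : agree_off I D D') (apI : pairwise (@apart R) Is).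
Hypotheses (sq : meets_square_in D Is) (sq' : meets_square_in D' Is)
  (AIs : A \in Is) (BIs : B \in Is) (CIs : C \in Is) (lt_ends : {in Is, forall J, J.1 < J.2})
  (UE : forall t, inside Is t = [|| t \in dom A, t \in dom B | t \in dom C]).
Hypotheses (inj : {in Is, forall J, {in dom J &, injective (curve D)}})
  (inj' : {in Is, forall J, {in dom J &, injective (curve D')}}).
Hypotheses (AB : apart A B) (AC : apart A C) (BC : apart B C).
Hypotheses (mAB : meets_once D A B ab ba) (mAC : meets_once D A C ac ca) (mBC : meets_once D B C bc cb)
  (mAB' : meets_once D' A B ab' ba') (mAC' : meets_once D' A C ac' ca') (mBC' : meets_once D' B C bc' cb').
Hypotheses (kAB : crosses_as Over D A B) (kAC : crosses_as Over D A C) (kBC : crosses_as Over D B C)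
  (kAB' : crosses_as Over D' A B) (kAC' : crosses_as Over D' A C) (kBC' : crosses_as Over D' B C).
Variables (oB oC xab xac xbc : bool).
Hypotheses (order_B : (ba < bc) = oB) (order_B' : (ba' < bc') = ~~ oB)
  (order_C : (ca < cb) = oC) (order_C' : (ca' < cb') = ~~ oC).
Local Notation sign x := (if x then 1 else -1 : int).
Hypotheses (wab : writhe D (ab, ba) = sign xab) (wab' : writhe D' (ab', ba') = sign xab)
  (wac : writhe D (ac, ca) = sign xac) (wac' : writhe D' (ac', ca') = sign xac)
  (wbc : writhe D (bc, cb) = sign xbc) (wbc' : writhe D' (bc', cb') = sign xbc).
(* The constraint imposed by the plane on the writhes of the two crossings of
   [A] and the orders of the crossings on [B] and [C]. *)
Hypothesis pattern : (xac == xab) = (oB == oC).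

Lemma sign_inj_eq (x y : bool) : (sign x == sign y) = (x == y).
Proof. by case: x; case: y. Qed.

(** The bottom strand meets the other two in opposite orders before and after the move. The formal
    move starts from the diagram in which the top strand comes first on it, so [D] and [D'] exchange
    roles according to [oC]; [pattern] gives the order required on the middle strand. *)
Lemma third_classical_zeta : same_zeta D D'.
Proof.
have V := no_virtual_inside UE sq (inj AIs) (inj BIs) (inj CIs) mAB mAC mBC kAB kAC kBC.
have V' := no_virtual_inside UE sq' (inj' AIs) (inj' BIs) (inj' CIs) mAB' mAC' mBC' kAB' kAC' kBC'.
have VJ J : J \in Is -> {in virtual_times D, forall v, v \notin dom J}.
  by move=> JIs v /V/hasPn/(_ J JIs).
have VJ' J : J \in Is -> {in virtual_times D', forall v, v \notin dom J}.
  by move=> JIs v /V'/hasPn/(_ J JIs).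
have Isum : {in Is, forall J, \sum_(v <- virtual_times D | v \in dom J) degree_step D v =
    \sum_(v <- virtual_times D' | v \in dom J) degree_step D' v}.
  move=> J JIs; rewrite (@sum_virtual _ D J [::]) ?(@sum_virtual _ D' J [::]) ?big_nil // => v.
    by apply/negP => /andP[/(VJ' J JIs)/negP].
  by apply/negP => /andP[/(VJ J JIs)/negP].
have H J : J \in Is -> {in dom J, forall t, height D t = height D J.2 /\ height D' t = height D J.2}.
  move=> JIs t tJ; split; first exact: height_strand tJ (VJ J JIs).
  rewrite (height_strand tJ (VJ' J JIs)); apply/esym.
  exact: (outside_height IIs agree sq sq' apI Isum (strand_end_outside apI lt_ends JIs)).
have in1 := triangle_inner UE sq (inj AIs) (inj BIs) (inj CIs) AB BC mAB mAC mBC kAB kAC kBC.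
have in2 := triangle_inner UE sq' (inj' AIs) (inj' BIs) (inj' CIs) AB BC mAB' mAC' mBC' kAB' kAC' kBC'.
have swap (T : eqType) (x y z : T) : perm_eq [:: x; y; z] [:: x; z; y].
  by rewrite perm_cons; exact/permPl/(perm_catC [:: y] [:: z]).
have [abA baB _ _] := mAB; have [acA caC _ _] := mAC; have [bcB cbC _ _] := mBC.
have [ab'A ba'B _ _] := mAB'; have [ac'A ca'C _ _] := mAC'; have [bc'B cb'C _ _] := mBC'.
have [b [e [be be' beI]]] := ex_surrounds_strands D D' Is.
have neC := under_neq AB AC BC mAC mBC; have neC' := under_neq AB AC BC mAC' mBC'.
case OC : oC.
  have fA : ca < cb by rewrite order_C.
  have fB : cb' < ca'.
    by rewrite lt_neqAle leNgt order_C' OC andbT eq_sym.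
  have [S [[E E'] [U U'] _ outS]] :=
    local_move IIs agree sq sq' apI Isum in1 (perm_trans in2 (swap _ _ _ _)) be be' beI.
  apply: (same_zetaE be be' E E'); apply: unit_related_eq.
  apply: (triangle_gdet AB AC BC abA acA ab'A ac'A baB bcB ba'B bc'B caC cbC ca'C cb'C
    (H A AIs) (H B BIs) (H C CIs) _ _ _ fA fB _ _ U U').
  + by rewrite wab wab'.
  + by rewrite wac wac'.
  + by rewrite wbc wbc'.
  + by rewrite wab wac sign_inj_eq pattern order_B OC; case: (oB).
  + by rewrite wab wac sign_inj_eq pattern order_B' OC; case: (oB).
  by move=> x xS; split; [exact: outS xS A AIs|exact: outS xS B BIs|exact: outS xS C CIs].
have fA : ca' < cb' by rewrite order_C' OC.
have fB : cb < ca.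
  by rewrite lt_neqAle leNgt order_C OC andbT eq_sym.
have [S [[E E'] [U U'] _ outS]] :=
  local_move IIs agree sq sq' apI Isum (perm_trans in1 (swap _ _ _ _)) in2 be be' beI.
apply: (same_zetaE be be' E E'); apply: unit_related_eq; apply: esym.
have H' J : J \in Is -> {in dom J, forall t, height D' t = height D J.2 /\ height D t = height D J.2}.
  by move=> JIs t tJ; have [] := H J JIs t tJ.
apply: (triangle_gdet AB AC BC ab'A ac'A abA acA ba'B bc'B baB bcB ca'C cb'C caC cbC
  (H' A AIs) (H' B BIs) (H' C CIs) _ _ _ fA fB _ _ U' U).
+ by rewrite wab wab'.
+ by rewrite wac wac'.
+ by rewrite wbc wbc'.
+ by rewrite wab' wac' sign_inj_eq pattern order_B' OC; case: (oB).
+ by rewrite wab' wac' sign_inj_eq pattern order_B OC; case: (oB).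
by move=> x xS; split; [exact: outS xS A AIs|exact: outS xS B BIs|exact: outS xS C CIs].
Qed.

End ThirdClassical.

Lemma lin_bounds (R : realType) (E : diagram R) a b (J : R * R) t :
  (forall r, r \in dom J -> 0 < dlin E a b r) -> t \in dom J -> lin E a b J.1 < lin E a b t < lin E a b J.2.
Proof.
move=> pos; rewrite mem_dom => /andP[t1 t2]; apply/andP; split; apply: lin_incr => // r /andP[h1 h2];
  apply: pos; rewrite mem_dom; first by rewrite h1 (lt_trans h2 t2).
by rewrite h2 (lt_trans t1 h1).
Qed.

(** One of [s * y] and [s * y'] is negative and the other positive, and both lie strictly between
    [l] and [r]. *)
Lemma ends_combine (R : realType) (s l r y y' : R) : is_sign s -> 0 < y -> y' < 0 ->
  l < s * y < r -> l < s * y' < r -> l < 0 < r.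
Proof. by move=> [->|->] ? ? /andP[? ?] /andP[? ?]; apply/andP; split; lra. Qed.

Section ThirdEnds.
Variables (R : realType) (D D' : diagram R) (J : R * R) (s : R).
Hypotheses (d : directed D J s) (d' : directed D' J s).
Hypotheses (v : forall t, t \in dom J -> `|(velocity D t).2| < `|(velocity D t).1|)
  (v' : forall t, t \in dom J -> `|(velocity D' t).2| < `|(velocity D' t).1|).
Hypotheses (e1 : curve D J.1 = curve D' J.1) (e2 : curve D J.2 = curve D' J.2).
Hypotheses (y : forall t, t \in dom J -> (curve D t).1 = 0 -> 0 < (curve D t).2)
  (y' : forall t, t \in dom J -> (curve D' t).1 = 0 -> (curve D' t).2 < 0).

(* Before and after the move the strand has the same end points but passes the
   centre on opposite sides, so its end points lie on opposite sides of both
   diagonals. *)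
Lemma third_ends : [/\ lin D s (- s) J.1 < 0 < lin D s (- s) J.2, lin D s s J.1 < 0 < lin D s s J.2,
  lin D' s (- s) J.1 < 0 < lin D' s (- s) J.2 & lin D' s s J.1 < 0 < lin D' s s J.2].
Proof.
have ss : is_sign s by case: d.
have ss' : is_sign (- s) by case: ss => ->; [right|left]; rewrite ?opprK.
have z1 : -1 < (0 : R) < 1 by rewrite ltrN10 ltr01.
have [t tJ xt] := directed_ivt d z1; have [t' t'J xt'] := directed_ivt d' z1.
have eqlin a b : lin D' a b J.1 = lin D a b J.1 /\ lin D' a b J.2 = lin D a b J.2.
  by rewrite /lin e1 e2.
have P (E : diagram R) k u : u \in dom J -> (curve E u).1 = 0 ->
    (forall r, r \in dom J -> 0 < dlin E s k r) ->
    lin E s k J.1 < k * (curve E u).2 < lin E s k J.2.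
  by move=> uJ xu pos; have := lin_bounds pos uJ; rewrite {2 3}/lin xu mulr0 add0r.
have Mp : lin D s (- s) J.1 < 0 < lin D s (- s) J.2.
  apply: (ends_combine ss' (y tJ xt) (y' t'J xt') (P _ _ _ tJ xt (lin_minus_pos d v))).
  by have [<- <-] := eqlin s (- s); exact: (P _ _ _ t'J xt' (lin_minus_pos d' v')).
have Mm : lin D s s J.1 < 0 < lin D s s J.2.
  apply: (ends_combine ss (y tJ xt) (y' t'J xt') (P _ _ _ tJ xt (lin_plus_pos d v))).
  by have [<- <-] := eqlin s s; exact: (P _ _ _ t'J xt' (lin_plus_pos d' v')).
by have [-> ->] := eqlin s (- s); have [-> ->] := eqlin s s.
Qed.

End ThirdEnds.

Section ThirdData.
Variables (R : realType) (E : diagram R) (I1 I2 I3 : R * R).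
Local Notation sign x := (if x then 1 else -1 : int).

(** [z1], [z2], [z3] tell whether the strands run to the right, and [f] whether strand 3 passes
    below the centre. The move changes [f] only, so it reverses all three orders and keeps all three
    signs. *)
Definition third_data (z1 z2 z3 f : bool) (a2 a3 b1 b3 c1 c2 : R) :=
  [/\ meets_once E I1 I2 a2 b1, meets_once E I1 I3 a3 c1, meets_once E I2 I3 b3 c2,
   [/\ (a2 < a3) = z1 (+) f, (b1 < b3) = ~~ z2 (+) f & (c1 < c2) = ~~ z3 (+) f] &
   [/\ writhe E (a2, b1) = sign (z1 (+) z2), writhe E (a3, c1) = sign (z1 (+) z3) &
       writhe E (b3, c2) = sign (~~ (z2 (+) z3))]].

Lemma writhe_sign s t x : (0 < cross (velocity E s) (velocity E t)) = x -> writhe E (s, t) = sign x.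
Proof. by move=> <-. Qed.

Lemma signs_prod (s s' : R) : is_sign s -> is_sign s' ->
  (s * s' < 0) = (0 < s) (+) (0 < s') /\ (0 < s * s') = ~~ ((0 < s) (+) (0 < s')).
Proof.
by move=> [->|->] [->|->]; rewrite ?mul1r ?mulN1r ?opprK ?oppr_gt0 ?oppr_lt0 ?ltr01 ?ltr10.
Qed.

Lemma ex_third_data s1 s2 s3 q : directed E I1 s1 -> directed E I2 s2 -> directed E I3 s3 ->
  meets_square_in E [:: I1; I2; I3] ->
  (forall t, t \in dom I1 -> (curve E t).2 = (curve E t).1) ->
  (forall t, t \in dom I2 -> (curve E t).2 = - (curve E t).1) ->
  (forall t, t \in dom I3 -> `|(velocity E t).2| < `|(velocity E t).1|) ->
  is_sign q -> (forall t, t \in dom I3 -> (curve E t).1 = 0 -> 0 < q * (curve E t).2) ->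
  lin E s3 (- s3) I3.1 < 0 < lin E s3 (- s3) I3.2 -> lin E s3 s3 I3.1 < 0 < lin E s3 s3 I3.2 ->
  exists a2 a3 b1 b3 c1 c2, third_data (0 < s1) (0 < s2) (0 < s3) (q < 0) a2 a3 b1 b3 c1 c2.
Proof.
move=> d1 d2 d3 sq y1 y2 v3 qs y3 pe me.
have [a2 [a3 [b1 [b3 [c1 [c2 [[[? ? ? ?] [? ?]] [e1 e2 e3] [w1 w2 w3] [r1 r2 r3] [x1 x2 x3]]]]]]]] :=
  third_crossings d1 d2 d3 sq y1 y2 v3 qs y3 pe me.
have [s1s s2s s3s] : [/\ is_sign s1, is_sign s2 & is_sign s3] by case: d1; case: d2; case: d3.
have qn : (0 < q) = ~~ (q < 0) by case: qs => ->; rewrite ?oppr_gt0 ?oppr_lt0 ?ltr01 ?ltr10.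
exists a2, a3, b1, b3, c1, c2; split; [by split|by split|by split| |].
  split; [rewrite r1; have [_ ->] := signs_prod s1s qs|rewrite r2; have [-> _] := signs_prod s2s qs|
    rewrite r3; have [-> _] := signs_prod s3s qs]; rewrite qn; by case: (_ < _) (_ < _) => -[].
have [n12 _] := signs_prod s1s s2s; have [n13 _] := signs_prod s1s s3s; have [_ p23] := signs_prod s2s s3s.
split.
- exact: writhe_sign (etrans x1 n12).
- exact: writhe_sign (etrans x2 n13).
exact: writhe_sign (etrans x3 p23).
Qed.

End ThirdData.

Definition flip_kind (k : crossing_kind) :=
  match k with Over => Under | Under => Over | Virtual => Virtual end.

Definition is_virtual (k : crossing_kind) := if k is Virtual then true else false.

Lemma is_virtual_flip k : is_virtual (flip_kind k) = is_virtual k.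
Proof. by case: k. Qed.

Lemma side_sign (R : realType) (x y : R * R) :
  (if cross x y < 0 then 1 else -1 : int) = (if 0 < cross y x then 1 else -1 : int).
Proof. by rewrite (cross_anti y) oppr_gt0. Qed.

Lemma add_if (b b' c c' : bool) (x x' y y' : int) : (b -> x = y) -> (b' -> x' = y') ->
  (if b && c then x + (if b' && c' then x' + 0 else 0) else if b' && c' then x' + 0 else 0) =
  (if b && c then y else 0) + (if b' && c' then y' else 0).
Proof.
by case: b => xy; case: b' => xy'; case: c; case: c'; rewrite /= ?xy ?xy' ?addr0 ?add0r.
Qed.

Section StrandSums.
Variables (R : realType) (E : diagram R).
Implicit Types (I J K : R * R) (s t : R).

Lemma crosses_as_flip k I J : crosses_as k E I J -> crosses_as (flip_kind k) E J I.
Proof.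
move=> H t s tJ sI e; have := H s t sI tJ (esym e).
by case: k {H} => //= -[].
Qed.

Lemma meets_once_neq I J s t : apart I J -> meets_once E I J s t -> s != t.
Proof. by move=> IJ [sI tJ _ _]; apply: contraTneq sI => ->; rewrite (apart_dom _ tJ) // apart_sym. Qed.

Lemma meets_order I J K s t s' t' : apart I J -> apart I K -> apart J K ->
  meets_once E I J s t -> meets_once E I K s' t' -> (s' < s) = ~~ (s < s').
Proof.
move=> IJ IK JK m m'; have n := meets_once_neq IJ m; have n' := meets_once_neq IK m'.
have [_ tJ e _] := m; have [_ t'K e' _] := m'; case: (ltgtP s s') => [//|//|ss].
by rewrite ss in e n; have := apart_dom JK tJ; rewrite (partner_uniq n n' e e') t'K.
Qed.

Lemma writhe_rev I J s t x : apart I J -> meets_once E I J s t ->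
  writhe E (s, t) = (if x then 1 else -1) -> writhe E (t, s) = (if ~~ x then 1 else -1).
Proof.
move=> IJ m; have [_ _ e _] := m; rewrite (writhe_swap (meets_once_neq IJ m) e) => ->.
by case: x; rewrite ?opprK.
Qed.

Lemma once_virtual k I J s t : apart I J -> meets_once E I J s t -> crosses_as k E I J ->
  (s \in virtual_times E) = is_virtual k.
Proof.
move=> IJ m kE; have n := meets_once_neq IJ m; have [sI tJ e _] := m.
have := kE s t sI tJ e; case: k {kE} => /= kE; last first.
- have -> : s \in virtual_times E by apply/virtual_timeP; exists t; case: kE.
  by [].
- apply/negbTE/negP => /virtual_timeP[u [su e' n1 n2]]; move: n2.
  by rewrite -(partner_uniq n su e e') kE.
apply/negbTE/negP => /virtual_timeP[u [su e' n1 n2]]; move: n1.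
by rewrite -(partner_uniq n su e e') kE.
Qed.

Lemma once_step I J s t : apart I J -> meets_once E I J s t -> crosses_as Virtual E I J ->
  degree_step E s = writhe E (s, t).
Proof.
move=> IJ m kE; have n := meets_once_neq IJ m; have [sI tJ e _] := m.
have [n1 n2] := kE s t sI tJ e; rewrite (virtual_step n e n1 n2).
exact: side_sign.
Qed.

(** The strand has only two double points, and the step along it at a virtual one is the sign that
    [writhe] gives to the pair of times. The predicate [P] selects the part of the strand after a
    given time. *)
Lemma strand_sum I J K s t s' t' k k' (P : pred R) :
  apart I J -> apart I K -> apart J K ->
  meets_once E I J s t -> meets_once E I K s' t' ->
  crosses_as k E I J -> crosses_as k' E I K ->
  (forall v u, v != u -> curve E v = curve E u -> v \in dom I -> v = s \/ v = s') ->
  \sum_(v <- virtual_times E | (v \in dom I) && P v) degree_step E v =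
  (if is_virtual k && P s then writhe E (s, t) else 0) +
  (if is_virtual k' && P s' then writhe E (s', t') else 0).
Proof.
move=> IJ IK JK m m' kE kE' dbl.
have nss : s != s'.
  have := meets_order IJ IK JK m m'; case: eqP => // ->; by rewrite ltxx.
rewrite -big_filter (perm_big [seq v <- [:: s; s'] | (v \in virtual_times E) && P v]); last first.
  apply: uniq_perm; [by rewrite filter_uniq ?virtual_times_uniq|
    by apply: filter_uniq; rewrite /= inE nss|move=> v].
  rewrite !mem_filter andbC -andbA [X in _ = X]andbC mem_seq2 /=.
  case vV : (v \in virtual_times E); rewrite ?andbF //=; case: (P v); rewrite ?andbF //= !andbT.
  have [sI _ _ _] := m; have [s'I _ _ _] := m'.
  apply/idP/orP => [vI|[] /eqP-> //].
  move/virtual_timeP: vV => [u [vu e _ _]].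
  by case: (dbl v u vu e vI) => ->; [left|right].
rewrite big_filter big_cons big_cons big_nil.
rewrite (once_virtual IJ m kE) (once_virtual IK m' kE').
have S : is_virtual k -> degree_step E s = writhe E (s, t).
  by move=> kv; apply: (once_step IJ m); case: k kv kE.
have S' : is_virtual k' -> degree_step E s' = writhe E (s', t').
  by move=> kv; apply: (once_step IK m'); case: k' kv kE'.
exact: add_if S S'.
Qed.

(** Heights are measured backwards from the end of the strand, where they agree before and after the
    move. *)
Lemma height_from J t : t \in dom J ->
  height E t = height E J.2 - \sum_(v <- virtual_times E | (v \in dom J) && (t <= v)) degree_step E v.
Proof.
rewrite mem_dom => /andP[t1 t2]; rewrite /height [X in _ = X - _](bigID (fun v => v < t)) /=.
rewrite -addrA (_ : \sum_(v <- virtual_times E | (v < J.2) && ~~ (v < t)) _ - _ = 0) ?addr0.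
  by apply: eq_bigl => v; apply/idP/andP => [vt|[]//]; rewrite vt (lt_trans vt t2).
apply/eqP; rewrite subr_eq0; apply/eqP; apply: eq_bigl => v; rewrite -leNgt mem_dom.
apply/andP/andP => [[v2 tv]|[/andP[_ ?] ?]//]; by rewrite v2 (lt_le_trans t1 tv).
Qed.

End StrandSums.

Section ThirdStrands.
Variables (R : realType) (E : diagram R) (I1 I2 I3 : R * R) (k12 k13 k23 : crossing_kind).
Variables (z1 z2 z3 f : bool) (a2 a3 b1 b3 c1 c2 : R).
Hypotheses (I12 : apart I1 I2) (I13 : apart I1 I3) (I23 : apart I2 I3).
Hypothesis (sq : meets_square_in E [:: I1; I2; I3]).
Hypotheses (i1 : {in dom I1 &, injective (curve E)}) (i2 : {in dom I2 &, injective (curve E)})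
  (i3 : {in dom I3 &, injective (curve E)}).
Hypotheses (K12 : crosses_as k12 E I1 I2) (K13 : crosses_as k13 E I1 I3) (K23 : crosses_as k23 E I2 I3).
Hypothesis data : third_data E I1 I2 I3 z1 z2 z3 f a2 a3 b1 b3 c1 c2.
Local Notation sign x := (if x then 1 else -1 : int).

Lemma inside3 t : inside [:: I1; I2; I3] t = [|| t \in dom I1, t \in dom I2 | t \in dom I3].
Proof. by rewrite /inside /= orbF. Qed.

Let I21 : apart I2 I1. Proof. by rewrite apart_sym. Qed.
Let I31 : apart I3 I1. Proof. by rewrite apart_sym. Qed.
Let I32 : apart I3 I2. Proof. by rewrite apart_sym. Qed.

Lemma strand_double v u : v != u -> curve E v = curve E u ->
  [/\ v \in dom I1 -> v = a2 \/ v = a3, v \in dom I2 -> v = b1 \/ v = b3 &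
      v \in dom I3 -> v = c1 \/ v = c2].
Proof.
have [m12 m13 m23 _ _] := data; have [a2I b1I _ _] := m12; have [a3I c1I _ _] := m13.
have [b3I c2I _ _] := m23; move=> vu e.
have D := double_points inside3 sq i1 i2 i3 m12 m13 m23 vu e.
split=> vI; have vU : inside [:: I1; I2; I3] v by rewrite inside3 vI ?orbT.
- case: (D vU) => -[[vE _]|[_ vE]]; try (by left); try (by right); rewrite vE in vI.
  + by have := apart_dom I12 vI; rewrite b1I.
  + by have := apart_dom I13 vI; rewrite c1I.
  + by have := apart_dom I12 vI; rewrite b3I.
  by have := apart_dom I13 vI; rewrite c2I.
- case: (D vU) => -[[vE _]|[_ vE]]; try (by left); try (by right); rewrite vE in vI.
  + by have := apart_dom I21 vI; rewrite a2I.
  + by have := apart_dom I21 vI; rewrite a3I.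
  + by have := apart_dom I23 vI; rewrite c1I.
  by have := apart_dom I23 vI; rewrite c2I.
case: (D vU) => -[[vE _]|[_ vE]]; try (by left); try (by right); rewrite vE in vI.
- by have := apart_dom I31 vI; rewrite a2I.
- by have := apart_dom I32 vI; rewrite b1I.
- by have := apart_dom I31 vI; rewrite a3I.
by have := apart_dom I32 vI; rewrite b3I.
Qed.

Lemma strand1_sum (P : pred R) :
  \sum_(v <- virtual_times E | (v \in dom I1) && P v) degree_step E v =
  (if is_virtual k12 && P a2 then sign (z1 (+) z2) else 0) +
  (if is_virtual k13 && P a3 then sign (z1 (+) z3) else 0).
Proof.
have [m12 m13 m23 _ [w12 w13 w23]] := data.
rewrite (strand_sum P I12 I13 I23 m12 m13 K12 K13) ?w12 ?w13 // => v u vu e.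
by have [H _ _] := strand_double vu e.
Qed.

Lemma strand2_sum (P : pred R) :
  \sum_(v <- virtual_times E | (v \in dom I2) && P v) degree_step E v =
  (if is_virtual k12 && P b1 then sign (~~ (z1 (+) z2)) else 0) +
  (if is_virtual k23 && P b3 then sign (~~ (z2 (+) z3)) else 0).
Proof.
have [m12 m13 m23 _ [w12 w13 w23]] := data; have m21 := meets_once_sym m12.
rewrite (strand_sum P I21 I23 I13 m21 m23 (crosses_as_flip K12) K23) ?is_virtual_flip.
  by rewrite w23 (writhe_rev I12 m12 w12).
by move=> v u vu e; have [_ H _] := strand_double vu e.
Qed.

Lemma strand3_sum (P : pred R) :
  \sum_(v <- virtual_times E | (v \in dom I3) && P v) degree_step E v =
  (if is_virtual k13 && P c1 then sign (~~ (z1 (+) z3)) else 0) +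
  (if is_virtual k23 && P c2 then sign (z2 (+) z3) else 0).
Proof.
have [m12 m13 m23 _ [w12 w13 w23]] := data.
have m31 := meets_once_sym m13; have m32 := meets_once_sym m23.
rewrite (strand_sum P I31 I32 I12 m31 m32 (crosses_as_flip K13) (crosses_as_flip K23)).
  by rewrite !is_virtual_flip (writhe_rev I13 m13 w13) (writhe_rev I23 m23 w23) negbK.
by move=> v u vu e; have [_ _ H] := strand_double vu e.
Qed.

End ThirdStrands.

Lemma int_sub_swap (a b c d : int) : a - b = c - d -> b - a = d - c.
Proof. by lia. Qed.

(** * The three kinds of third move *)

Section ThirdZeta.
Variables (R : realType) (D D' : diagram R) (I1 I2 I3 : R * R) (k12 k13 k23 : crossing_kind).
Variables (z1 z2 z3 : bool) (a2 a3 b1 b3 c1 c2 a2' a3' b1' b3' c1' c2' : R).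
Hypotheses (I12 : apart I1 I2) (I13 : apart I1 I3) (I23 : apart I2 I3) (agree : agree_off I3 D D').
Let Is := [:: I1; I2; I3].
Hypotheses (sq : meets_square_in D Is) (sq' : meets_square_in D' Is)
  (lt_ends : {in Is, forall J, J.1 < J.2}).
Hypotheses (inj : {in Is, forall J, {in dom J &, injective (curve D)}})
  (inj' : {in Is, forall J, {in dom J &, injective (curve D')}}).
Hypotheses (K12 : crosses_as k12 D I1 I2) (K13 : crosses_as k13 D I1 I3) (K23 : crosses_as k23 D I2 I3)
  (K12' : crosses_as k12 D' I1 I2) (K13' : crosses_as k13 D' I1 I3) (K23' : crosses_as k23 D' I2 I3).
Hypotheses (data : third_data D I1 I2 I3 z1 z2 z3 false a2 a3 b1 b3 c1 c2)
  (data' : third_data D' I1 I2 I3 z1 z2 z3 true a2' a3' b1' b3' c1' c2').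
Local Notation sign x := (if x then 1 else -1 : int).

Let I1s : I1 \in Is. Proof. by rewrite inE eqxx. Qed.
Let I2s : I2 \in Is. Proof. by rewrite !inE eqxx orbT. Qed.
Let I3s : I3 \in Is. Proof. by rewrite !inE eqxx !orbT. Qed.
Let I21 : apart I2 I1. Proof. by rewrite apart_sym. Qed.
Let I31 : apart I3 I1. Proof. by rewrite apart_sym. Qed.
Let I32 : apart I3 I2. Proof. by rewrite apart_sym. Qed.
Let apI : pairwise (@apart R) Is. Proof. by rewrite /= I12 I13 I23. Qed.

Let sum1 P := strand1_sum I12 I13 I23 sq (inj I1s) (inj I2s) (inj I3s) K12 K13 data P.
Let sum1' P := strand1_sum I12 I13 I23 sq' (inj' I1s) (inj' I2s) (inj' I3s) K12' K13' data' P.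
Let sum2 P := strand2_sum I12 I13 I23 sq (inj I1s) (inj I2s) (inj I3s) K12 K23 data P.
Let sum2' P := strand2_sum I12 I13 I23 sq' (inj' I1s) (inj' I2s) (inj' I3s) K12' K23' data' P.
Let sum3 P := strand3_sum I12 I13 I23 sq (inj I1s) (inj I2s) (inj I3s) K13 K23 data P.
Let sum3' P := strand3_sum I12 I13 I23 sq' (inj' I1s) (inj' I2s) (inj' I3s) K13' K23' data' P.

Lemma sum_predT (E : diagram R) (J : R * R) :
  \sum_(v <- virtual_times E | v \in dom J) degree_step E v =
  \sum_(v <- virtual_times E | (v \in dom J) && xpredT v) degree_step E v.
Proof. by apply: eq_bigl => v; rewrite andbT. Qed.

Let Isum : {in Is, forall J, \sum_(v <- virtual_times D | v \in dom J) degree_step D v =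
    \sum_(v <- virtual_times D' | v \in dom J) degree_step D' v}.
Proof.
move=> J; rewrite !inE !sum_predT => /or3P[] /eqP->.
- exact: etrans (sum1 xpredT) (esym (sum1' xpredT)).
- exact: etrans (sum2 xpredT) (esym (sum2' xpredT)).
exact: etrans (sum3 xpredT) (esym (sum3' xpredT)).
Qed.

Let dbl := let: And5 m12 m13 m23 _ _ := data in
  double_points (@inside3 R I1 I2 I3) sq (inj I1s) (inj I2s) (inj I3s) m12 m13 m23.
Let dbl' := let: And5 m12 m13 m23 _ _ := data' in
  double_points (@inside3 R I1 I2 I3) sq' (inj' I1s) (inj' I2s) (inj' I3s) m12 m13 m23.

Lemma inner_virtual (E : diagram R) (x2 x3 y1 y3 w1 w2 : R) : 
  (forall s t, s != t -> curve E s = curve E t -> inside Is s ->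
  [\/ (s, t) = (x2, y1) \/ (t, s) = (x2, y1), (s, t) = (x3, w1) \/ (t, s) = (x3, w1) |
      (s, t) = (y3, w2) \/ (t, s) = (y3, w2)]) ->
  ((x2, y1) \notin classical E /\ (y1, x2) \notin classical E) ->
  ((x3, w1) \notin classical E /\ (w1, x3) \notin classical E) ->
  ((y3, w2) \notin classical E /\ (w2, y3) \notin classical E) ->
  perm_eq (inner Is E) [::].
Proof.
move=> H [n1 n1'] [n2 n2'] [n3 n3']; apply: inner_perm => // -[s t].
apply/negP => /andP[cE sI]; have [/= ne e] := crossing_curve (classical_crossing cE).
case: (H s t ne e sI) => -[] [E1 E2]; move: cE n1 n1' n2 n2' n3 n3';
  by rewrite E1 E2 => ->.
Qed.

Let not_classical (E : diagram R) (J K : R * R) (s t : R) : meets_once E J K s t -> crosses_as Virtual E J K ->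
  (s, t) \notin classical E /\ (t, s) \notin classical E.
Proof. by move=> [sJ tK e _] H; exact: (H s t sJ tK e). Qed.

Lemma third_virtual_zeta : k12 = Virtual -> k13 = Virtual -> k23 = Virtual -> same_zeta D D'.
Proof.
move=> e12 e13 e23; move: K12 K13 K23 K12' K13' K23'; rewrite e12 e13 e23 => v1 v2 v3 v1' v2' v3'.
have [m12 m13 m23 _ _] := data; have [m12' m13' m23' _ _] := data'.
have in1 : perm_eq (inner Is D) [::].
  exact: inner_virtual dbl (not_classical m12 v1) (not_classical m13 v2) (not_classical m23 v3).
have in2 : perm_eq (inner Is D') [::].
  exact: inner_virtual dbl' (not_classical m12' v1') (not_classical m13' v2') (not_classical m23' v3').
have [b [e [be be' beI]]] := ex_surrounds_strands D D' Is.
have [S [[E E'] _ _ _]] := local_move I3s agree sq sq' apI Isum in1 in2 be be' beI.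
have {}E : cdet D b e = gdet S := E; have {}E' : cdet D' b e = gdet S := E'.
exact: (same_zetaE be be' E E' (unit_related_refl _)).
Qed.

Lemma third_kind_inner (E : diagram R) k (x2 x3 y1 y3 w1 w2 : R) :
  (forall s t, s != t -> curve E s = curve E t -> inside Is s ->
  [\/ (s, t) = (x2, y1) \/ (t, s) = (x2, y1), (s, t) = (x3, w1) \/ (t, s) = (x3, w1) |
      (s, t) = (y3, w2) \/ (t, s) = (y3, w2)]) ->
  meets_once E I1 I2 x2 y1 -> crosses_as k E I1 I2 ->
  ((x3, w1) \notin classical E /\ (w1, x3) \notin classical E) ->
  ((y3, w2) \notin classical E /\ (w2, y3) \notin classical E) -> k <> Virtual ->
  perm_eq (inner Is E) [:: if k is Over then (x2, y1) else (y1, x2)].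
Proof.
move=> H [x2I y1I e _] kE [n2 n2'] [n3 n3'] kV.
have cl : (if k is Over then (x2, y1) else (y1, x2)) \in classical E.
  by have := kE x2 y1 x2I y1I e; case: k kV {kE}.
have asym s t : (s, t) \in classical E -> (t, s) \notin classical E by exact: classical_asym.
apply: inner_perm => // -[s t]; rewrite inE; apply/andP/eqP => [[cE sI]|->]; last first.
  by split=> //; rewrite inside3; case: (k); rewrite /= ?x2I ?y1I ?orbT.
have [/= ne e'] := crossing_curve (classical_crossing cE).
case: (H s t ne e' sI) => -[] [E1 E2]; subst s t; rewrite ?(negPf n2) ?(negPf n2') ?(negPf n3) ?(negPf n3') // in cE;
  by case: k kV {kE} cl => // _ cl; rewrite ?(negPf (asym _ _ cl)) in cE.
Qed.

Lemma garc_of_eq (w w' : T_ring) (k k' : int) (c : R * R) : w = w' -> k = k' ->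
  row_at w k c = row_at w' k' c.
Proof. by move=> -> ->. Qed.

(* The virtual crossings of the moved strand pass from one side to the other of
   the classical crossing on both [I1] and [I2]; the two height changes cancel. *)
Lemma semivirtual_heights (h1 h2 : int) :
  (h1 - (0 + (if z1 then sign (z1 (+) z3) else 0))) - (h2 - (0 + (if ~~ z2 then sign (~~ (z2 (+) z3)) else 0)))
  = (h1 - (0 + (if ~~ z1 then sign (z1 (+) z3) else 0))) - (h2 - (0 + (if ~~ ~~ z2 then sign (~~ (z2 (+) z3)) else 0))).
Proof. by case: z1; case: z2; case: z3 => /=; ring. Qed.

Let sq_ends J : J \in Is -> ~~ inside Is J.2.
Proof. exact: strand_end_outside apI lt_ends. Qed.

(** [I1] and [I2] are not moved, so their classical crossing keeps its times and its weight. Its row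
    contains the two heights only through their difference. *)
Lemma third_semivirtual_zeta : k12 <> Virtual -> k13 = Virtual -> k23 = Virtual -> same_zeta D D'.
Proof.
move=> n12 e13 e23; have [v2 v3 v2' v3'] : [/\ crosses_as Virtual D I1 I3, crosses_as Virtual D I2 I3,
    crosses_as Virtual D' I1 I3 & crosses_as Virtual D' I2 I3] by rewrite -{1 3}e13 -e23.
have [m12 m13 m23 ord wr] := data; have [m12' m13' m23' ord' wr'] := data'.
have in1 := third_kind_inner dbl m12 K12 (not_classical m13 v2) (not_classical m23 v3) n12.
have in2 := third_kind_inner dbl' m12' K12' (not_classical m13' v2') (not_classical m23' v3') n12.
have [b [e [be be' beI]]] := ex_surrounds_strands D D' Is.
have [S [[E E'] _ _ _]] := local_move I3s agree sq sq' apI Isum in1 in2 be be' beI.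
have [a2I b1I _ only] := m12; have [a2I' b1I' ab' _] := m12'.
have c_eq t : t \notin dom I3 -> curve D t = curve D' t by apply: agree.1.
have a2n := apart_dom I13 a2I; have b1n := apart_dom I23 b1I.
have [Ea Eb] : a2' = a2 /\ b1' = b1.
  apply: (only a2' b1' a2I' b1I').
  by rewrite (c_eq _ (apart_dom I13 a2I')) (c_eq _ (apart_dom I23 b1I')) ab'.
have [w1 w2 _] := ord; have [w1' w2' _] := ord'.
have le_a : (a2 <= a3) = z1 by rewrite leNgt (meets_order I12 I13 I23 m12 m13) negbK w1 addbF.
have le_b : (b1 <= b3) = ~~ z2.
  by rewrite leNgt (meets_order I21 I23 I13 (meets_once_sym m12) m23) negbK w2 addbF.
have le_a' : (a2 <= a3') = ~~ z1.
  by rewrite leNgt -Ea (meets_order I12 I13 I23 m12' m13') negbK w1' addbT.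
have le_b' : (b1 <= b3') = ~~ ~~ z2.
  by rewrite leNgt -Eb (meets_order I21 I23 I13 (meets_once_sym m12') m23') negbK w2' addbT.
have V12 : is_virtual k12 = false by case: k12 n12.
have V13 : is_virtual k13 = true by rewrite e13.
have V23 : is_virtual k23 = true by rewrite e23.
have Ha : height D a2 = height D I1.2 - (0 + (if z1 then sign (z1 (+) z3) else 0)).
  by rewrite (height_from D a2I) (sum1 (fun v => a2 <= v)) V12 V13 /= le_a.
have Hb : height D b1 = height D I2.2 - (0 + (if ~~ z2 then sign (~~ (z2 (+) z3)) else 0)).
  by rewrite (height_from D b1I) (sum2 (fun v => b1 <= v)) V12 V23 /= le_b.
have Ha' : height D' a2 = height D I1.2 - (0 + (if ~~ z1 then sign (z1 (+) z3) else 0)).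
  rewrite (height_from D' a2I) (sum1' (fun v => a2 <= v)) V12 V13 /= le_a'.
  by rewrite (outside_height I3s agree sq sq' apI Isum (sq_ends I1s)).
have Hb' : height D' b1 = height D I2.2 - (0 + (if ~~ ~~ z2 then sign (~~ (z2 (+) z3)) else 0)).
  rewrite (height_from D' b1I) (sum2' (fun v => b1 <= v)) V12 V23 /= le_b'.
  by rewrite (outside_height I3s agree sq sq' apI Isum (sq_ends I2s)).
have k_eq : height D a2 - height D b1 = height D' a2 - height D' b1.
  by rewrite Ha Hb Ha' Hb'; exact: semivirtual_heights.
have va := velocity_agree agree a2n; have vb := velocity_agree agree b1n.
pose c := if k12 is Over then (a2, b1) else (b1, a2).
have Ec : (if k12 is Over then (a2', b1') else (b1', a2')) = c by rewrite Ea Eb.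
have W : weight D c = weight D' c.
  by rewrite /c; case: (k12); [exact: (weight_eq (c := (a2, b1)) va vb)|exact: (weight_eq (c := (b1, a2)) vb va)|
    exact: (weight_eq (c := (b1, a2)) vb va)].
have K : height D c.1 - height D c.2 = height D' c.1 - height D' c.2.
  by rewrite /c; case: (k12) => /=; [exact: k_eq|exact: int_sub_swap k_eq|exact: int_sub_swap k_eq].
have G : garc_of D (weight D) c = garc_of D' (weight D') c := garc_of_eq c W K.
have {}E : cdet D b e = gdet (garc_of D (weight D) c :: S) := E.
have {}E' : cdet D' b e = gdet (garc_of D' (weight D') c :: S) :=
  eq_ind _ (fun x => cdet D' b e = gdet (garc_of D' (weight D') x :: S)) E' _ Ec.
have {}E' : cdet D' b e = gdet (garc_of D (weight D) c :: S) :=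
  eq_ind_r (fun g => cdet D' b e = gdet (g :: S)) E' G.
exact: (same_zetaE be be' E E' (unit_related_refl _)).
Qed.

Let over_by (E : diagram R) J K h h' : crosses_as (by_height h h') E J K -> (h' < h)%N -> crosses_as Over E J K.
Proof. by move=> H hh; move: H; rewrite /by_height hh. Qed.

Let under_by (E : diagram R) J K h h' : crosses_as (by_height h h') E J K -> (h < h')%N -> crosses_as Over E K J.
Proof. by move=> H hh; move: H; rewrite /by_height ltnNge ltnW //=; exact: crosses_as_sym. Qed.

Let insideE t : inside Is t = [|| t \in dom I1, t \in dom I2 | t \in dom I3].
Proof. exact: inside3. Qed.

Let orR (E : diagram R) (J K L : R * R) s t s' t' x : apart J K -> apart J L -> apart K L ->
  meets_once E J K s t -> meets_once E J L s' t' -> (s < s') = x -> (s' < s) = ~~ x.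
Proof. by move=> JK JL KL m m' <-; exact: meets_order m m'. Qed.

(** The six orders of the heights are [third_classical_zeta] with the strands permuted into top,
    middle and bottom. In each case the planar constraint on signs and orders is a Boolean identity
    in [z1], [z2], [z3]. *)
Lemma third_classical_case h1 h2 h3 : uniq [:: h1; h2; h3] -> k12 = by_height h1 h2 ->
  k13 = by_height h1 h3 -> k23 = by_height h2 h3 -> same_zeta D D'.
Proof.
move=> Uh e12 e13 e23; move: K12 K13 K23 K12' K13' K23'; rewrite e12 e13 e23 => q12 q13 q23 q12' q13' q23'.
have [m12 m13 m23 [r1 r2 r3] [w12 w13 w23]] := data.
have [m12' m13' m23' [r1' r2' r3'] [w12' w13' w23']] := data'.
have m21 := meets_once_sym m12; have m31 := meets_once_sym m13; have m32 := meets_once_sym m23.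
have m21' := meets_once_sym m12'; have m31' := meets_once_sym m13'; have m32' := meets_once_sym m23'.
have w21 := writhe_rev I12 m12 w12; have w31 := writhe_rev I13 m13 w13; have w32 := writhe_rev I23 m23 w23.
have w21' := writhe_rev I12 m12' w12'; have w31' := writhe_rev I13 m13' w13'.
have w32' := writhe_rev I23 m23' w23'.
rewrite addbF in r1; rewrite addbF in r2; rewrite addbF in r3.
rewrite addbT in r1'; rewrite addbT in r2'; rewrite addbT in r3'.
have t1 := orR I12 I13 I23 m12 m13 r1; have t1' := orR I12 I13 I23 m12' m13' r1'.
have t2 := orR I21 I23 I13 m21 m23 r2; have t2' := orR I21 I23 I13 m21' m23' r2'.
have t3 := orR I31 I32 I12 m31 m32 r3; have t3' := orR I31 I32 I12 m31' m32' r3'.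
have zeta A B C (AIs : A \in Is) (BIs : B \in Is) (CIs : C \in Is)
    (UE : forall t, inside Is t = [|| t \in dom A, t \in dom B | t \in dom C])
    ab ba ac ca bc cb ab' ba' ac' ca' bc' cb' :=
  @third_classical_zeta R D D' Is I3 A B C ab ba ac ca bc cb ab' ba' ac' ca' bc' cb'
  I3s agree apI sq sq' AIs BIs CIs lt_ends UE inj inj'.
have [n12|n12|n12] := ltngtP h1 h2; last by move: Uh; rewrite /= n12 !inE eqxx.
  have [n13|n13|n13] := ltngtP h1 h3; last by move: Uh; rewrite /= n13 !inE eqxx orbT.
    have [n23|n23|n23] := ltngtP h2 h3; last by move: Uh; rewrite /= n23 !inE eqxx andbF.
      apply: (zeta I3 I2 I1 I3s I2s I1s _ _ _ _ _ _ _ _ _ _ _ _ _ I32 I31 I21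
      m32 m31 m21 m32' m31' m21'
      (under_by q23 n23) (under_by q13 n13) (under_by q12 n12)
      (under_by q23' n23) (under_by q13' n13) (under_by q12' n12)
      _ _ _ _ _ t2 t2' t1 t1' w32 w32' w31 w31' w21 w21');
      first (by move=> t; rewrite insideE;
        case: (t \in dom I1) (t \in dom I2) (t \in dom I3) => -[] []);
      by case: (z1) (z2) (z3) => -[] [].
    apply: (zeta I2 I3 I1 I2s I3s I1s _ _ _ _ _ _ _ _ _ _ _ _ _ I23 I21 I31
      m23 m21 m31 m23' m21' m31'
      (over_by q23 n23) (under_by q12 n12) (under_by q13 n13)
      (over_by q23' n23) (under_by q12' n12) (under_by q13' n13)
      _ _ _ _ _ t3 t3' r1 r1' w23 w23' w21 w21' w31 w31');
      first (by move=> t; rewrite insideE;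
        case: (t \in dom I1) (t \in dom I2) (t \in dom I3) => -[] []);
      by case: (z1) (z2) (z3) => -[] [].
  have n23 := ltn_trans n13 n12.
  apply: (zeta I2 I1 I3 I2s I1s I3s _ _ _ _ _ _ _ _ _ _ _ _ _ I21 I23 I13
      m21 m23 m13 m21' m23' m13'
      (under_by q12 n12) (over_by q23 n23) (over_by q13 n13)
      (under_by q12' n12) (over_by q23' n23) (over_by q13' n13)
      _ _ _ _ _ r1 r1' t3 t3' w21 w21' w23 w23' w13 w13');
      first (by move=> t; rewrite insideE;
        case: (t \in dom I1) (t \in dom I2) (t \in dom I3) => -[] []);
      by case: (z1) (z2) (z3) => -[] [].
have [n13|n13|n13] := ltngtP h1 h3; last by move: Uh; rewrite /= n13 !inE eqxx orbT.
  have n23 := ltn_trans n12 n13.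
  apply: (zeta I3 I1 I2 I3s I1s I2s _ _ _ _ _ _ _ _ _ _ _ _ _ I31 I32 I12
      m31 m32 m12 m31' m32' m12'
      (under_by q13 n13) (under_by q23 n23) (over_by q12 n12)
      (under_by q13' n13) (under_by q23' n23) (over_by q12' n12)
      _ _ _ _ _ t1 t1' t2 t2' w31 w31' w32 w32' w12 w12');
      first (by move=> t; rewrite insideE;
        case: (t \in dom I1) (t \in dom I2) (t \in dom I3) => -[] []);
      by case: (z1) (z2) (z3) => -[] [].
have [n23|n23|n23] := ltngtP h2 h3; last by move: Uh; rewrite /= n23 !inE eqxx andbF.
  apply: (zeta I1 I3 I2 I1s I3s I2s _ _ _ _ _ _ _ _ _ _ _ _ _ I13 I12 I32
      m13 m12 m32 m13' m12' m32'
      (over_by q13 n13) (over_by q12 n12) (under_by q23 n23)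
      (over_by q13' n13) (over_by q12' n12) (under_by q23' n23)
      _ _ _ _ _ r3 r3' r2 r2' w13 w13' w12 w12' w32 w32');
      first (by move=> t; rewrite insideE;
        case: (t \in dom I1) (t \in dom I2) (t \in dom I3) => -[] []);
      by case: (z1) (z2) (z3) => -[] [].
apply: (zeta I1 I2 I3 I1s I2s I3s _ _ _ _ _ _ _ _ _ _ _ _ _ I12 I13 I23
      m12 m13 m23 m12' m13' m23'
      (over_by q12 n12) (over_by q13 n13) (over_by q23 n23)
      (over_by q12' n12) (over_by q13' n13) (over_by q23' n23)
      _ _ _ _ _ r2 r2' r3 r3' w12 w12' w13 w13' w23 w23');
      first (by move=> t; rewrite insideE;
        case: (t \in dom I1) (t \in dom I2) (t \in dom I3) => -[] []);
      by case: (z1) (z2) (z3) => -[] [].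
Qed.

End ThirdZeta.

(** The side from which a strand enters the square determines its direction, and the moved strand
    keeps its starting point. *)
Lemma directed_unique (R : realType) (D D' : diagram R) (J : R * R) (s s' : R) :
  curve D J.1 = curve D' J.1 -> directed D J s -> directed D' J s' -> s' = s.
Proof.
move=> e [_ ss _ x1 _] [_ ss' _ x1' _]; move: x1 x1'; rewrite /lin e !mul0r !addr0.
by case: ss ss' => -> [] ->; lra.
Qed.

Section ThirdMove.
Variables (R : realType) (D D' : diagram R).

Lemma third_move_zeta : third_move D D' -> same_zeta D D'.
Proof.
move=> [I1 [I2 [I3 [k12 [k13 [k23 [kinds [I12 I13 I23 agree] pic pic' [up dn]]]]]]]].
have [sq [c1 c2 c3] [y1 y2] v3 [K12 K13 K23]] := pic.
have [sq' [_ _ c3'] [y1' y2'] v3' [K12' K13' K23']] := pic'.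
have I31 : apart I3 I1 by rewrite apart_sym.
have I32 : apart I3 I2 by rewrite apart_sym.
have [s1 d1] := chord_directed c1; have d1' := agree_directed agree I31 d1.
have [s2 d2] := chord_directed c2; have d2' := agree_directed agree I32 d2.
have [s3 d3] := chord_directed c3; have [s3' d3'] := chord_directed c3'.
have J12 : I3.1 < I3.2 by case: c3.
have e1 : curve D I3.1 = curve D' I3.1 by apply: agree.1; rewrite mem_dom ltxx.
have e2 : curve D I3.2 = curve D' I3.2 by apply: agree.1; rewrite mem_dom ltxx andbF.
have s3E := directed_unique e1 d3 d3'; rewrite s3E {s3E} in d3'.
have [pe me pe' me'] := third_ends d3 d3' v3 v3' e1 e2 up dn.
have q1 : is_sign (1 : R) by left.
have qN1 : is_sign (-1 : R) by right.
have up1 t : t \in dom I3 -> (curve D t).1 = 0 -> 0 < 1 * (curve D t).2.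
  by move=> tI xt; rewrite mul1r; exact: up.
have dn1 t : t \in dom I3 -> (curve D' t).1 = 0 -> 0 < -1 * (curve D' t).2.
  by move=> tI xt; rewrite mulN1r oppr_gt0; exact: dn.
have [a2 [a3 [b1 [b3 [w1 [w2 data]]]]]] := ex_third_data d1 d2 d3 sq y1 y2 v3 q1 up1 pe me.
have [a2' [a3' [b1' [b3' [w1' [w2' data']]]]]] :=
  ex_third_data d1' d2' d3' sq' y1' y2' v3' qN1 dn1 pe' me'.
rewrite ltr10 in data; rewrite ltrN10 in data'.
have lt_ends : {in [:: I1; I2; I3], forall J, J.1 < J.2}.
  by move=> J; rewrite !inE => /or3P[] /eqP->; [case: c1|case: c2|].
have di (E : diagram R) J s : directed E J s -> {in dom J &, injective (curve E)}.
  by move=> d t u tJ uJ e; apply: (directed_inj d tJ uJ); rewrite e.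
have inj : {in [:: I1; I2; I3], forall J, {in dom J &, injective (curve D)}}.
  by move=> J; rewrite !inE => /or3P[] /eqP->; [exact: di d1|exact: di d2|exact: di d3].
have inj' : {in [:: I1; I2; I3], forall J, {in dom J &, injective (curve D')}}.
  by move=> J; rewrite !inE => /or3P[] /eqP->; [exact: di d1'|exact: di d2'|exact: di d3'].
pose P k12 k13 k23 := [/\ crosses_as k12 D I1 I2, crosses_as k13 D I1 I3, crosses_as k23 D I2 I3 &
  [/\ crosses_as k12 D' I1 I2, crosses_as k13 D' I1 I3 & crosses_as k23 D' I2 I3]].
have PK : P k12 k13 k23 by split.
move: kinds PK; case => [h1 h2 h3 Uh||k kV] [L12 L13 L23 [L12' L13' L23']].
- exact: (third_classical_case I12 I13 I23 agree sq sq' lt_ends inj inj' L12 L13 L23 L12' L13' L23'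
    data data' Uh erefl erefl erefl).
- exact: (third_virtual_zeta I12 I13 I23 agree sq sq' inj inj' L12 L13 L23 L12' L13' L23'
    data data' erefl erefl erefl).
exact: (third_semivirtual_zeta I12 I13 I23 agree sq sq' lt_ends inj inj' L12 L13 L23 L12' L13' L23'
    data data' kV erefl erefl).
Qed.

End ThirdMove.

(** * Planar isotopies *)

Section LinearPlane.
Variable R : realType.
Local Notation plane := (R * R)%type.
Implicit Types (L M : {linear plane -> plane}).

Lemma plane_basis (v : plane) : v = v.1 *: ((1, 0) : plane) + v.2 *: ((0, 1) : plane).
Proof.
case: v => x y; congr pair; rewrite /= ?scaler0 ?addr0 ?add0r; exact: (esym (mulr1 _)).
Qed.

Definition detp L : R := cross (L (1, 0)) (L (0, 1)).

Lemma cross_linear L u v : cross (L u) (L v) = detp L * cross u v.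
Proof.
rewrite [X in L X]plane_basis [X in _ (L X)]plane_basis /detp !linearD !linearZ /=.
move: (L (1, 0)) (L (0, 1)) => [a b] [c d]; rewrite /cross /= -![_ *: _]/(_ * _).
by ring.
Qed.

(** If the determinant vanished, the coordinates of the two images would give linear relations
    between these images. The left inverse turns them into vanishing coefficients, so that the image
    of (1, 0) would be 0. *)
Lemma detp_neq0 L M : (forall v, M (L v) = v) -> detp L != 0.
Proof.
move=> ML; apply/eqP => d0.
have comb x y : x *: L (1, 0) + y *: L (0, 1) = 0 -> x = 0 /\ y = 0.
  rewrite -!linearZ -linearD => /(congr1 M); rewrite ML linear0 => E.
  have := congr1 fst E; have := congr1 snd E.
  rewrite /= !scaler0 add0r addr0 -![_ *: _]/(_ * _) !mulr1 => -> ->; by split.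
have Le := ML (1, 0).
move: d0 comb Le; rewrite /detp /cross; move: (L (1, 0)) (L (0, 1)) => [a b] [c d] /= d0 comb Le.
have [|d1 b1] := comb d (- b).
  by congr pair; rewrite /= -![_ *: _]/(_ * _); [move: d0; lra|ring].
have [|c1 a1] := comb c (- a).
  by congr pair; rewrite /= -![_ *: _]/(_ * _); [ring|move: d0; lra].
have M0 : M (0, 0) = 0 := linear0 M.
move: Le; rewrite -[a]opprK -[b]opprK a1 b1 oppr0 M0.
by move=> /(congr1 fst) /= /eqP; rewrite eq_sym oner_eq0.
Qed.

End LinearPlane.

Lemma positive_path (R : realType) (f : R -> R) : continuous f -> f 0 = 1 ->
  (forall s, f s != 0) -> 0 < f 1.
Proof.
move=> fc f0 fn; rewrite lt_neqAle eq_sym fn leNgt; apply/negP => neg.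
have [||r _ fr] := @IVT R f 0 1 0 ler01.
- by apply: continuous_subspaceT => s; exact: fc.
- by rewrite ge_min le_max (ltW neg) f0 ler01 orbT.
by have := fn r; rewrite fr eqxx.
Qed.

Section Ambient.
Variable R : realType.
Local Notation plane := (R * R)%type.
Variables (H G : R * plane -> plane).
Hypotheses (Hs : smooth H) (Gs : smooth G).
Hypotheses (GH : forall s z, G (s, H (s, z)) = z) (H0 : forall z, H (0, z) = z).

Definition slice (F : R * plane -> plane) s (z : plane) : plane := F (s, z).

Lemma slice_differentiable F s z : smooth F -> differentiable (slice F s) z.
Proof.
move=> Fs; have [Fd _] := Fs 1; rewrite (_ : slice F s = F \o (fun y : plane => (s, y))) //.
by apply: differentiable_comp; [apply: differentiable_pair|exact: Fd].
Qed.

Definition slice_det s z := detp ('d (slice H s) z).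

Lemma slice_det_neq0 s z : slice_det s z != 0.
Proof.
apply: (@detp_neq0 _ _ ('d (slice G s) (slice H s z))) => v.
have dH := slice_differentiable s z Hs; have dG := slice_differentiable s (slice H s z) Gs.
have E := diff_comp dH dG; have -> : 'd (slice G s) (slice H s z) ('d (slice H s) z v) =
   ('d (slice G s) (slice H s z) \o 'd (slice H s) z) v by [].
rewrite -E (_ : slice G s \o slice H s = id); last by apply/funext => y; exact: GH.
by rewrite diff_val.
Qed.

(** Written as a directional derivative of [H] itself, the differential of a slice is seen to vary
    continuously with the isotopy parameter. *)
Lemma slice_diffE s z v : 'd (slice H s) z v = 'D_((0, v) : R * plane) H (s, z).
Proof.
rewrite -deriveE; last exact: slice_differentiable s z Hs.
rewrite /derive; set d := (fun _ : R => _); set d' := (fun _ : R => _).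
suff -> : d = d' by [].
apply/funext => h; rewrite /d /d' /slice /=.
congr (_ *: (H (_, _) - _)).
by rewrite (_ : (h *: (0, v)).1 = 0) ?add0r //; exact: mulr0.
Qed.

Lemma slice_det_continuous z : continuous (fun s => slice_det s z).
Proof.
move=> s; rewrite /slice_det /detp.
have D v : (fun s => 'd (slice H s) z v) @ s --> 'd (slice H s) z v.
  have [_ /(_ ((0, v) : R * plane)) [Dd _]] := Hs 2.
  pose g x := 'D_((0, v) : R * plane) H x.
  have gc : (fun s : R => g (s, z)) @ s --> g (s, z).
    have pd : differentiable (fun s : R => (s, z)) s by apply: differentiable_pair.
    have pc : (fun s : R => (s, z)) @ s --> (s, z) := differentiable_continuous pd.
    exact: (cvg_comp (fun s : R => (s, z)) g pc (differentiable_continuous (Dd (s, z)))).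
  have E : (fun s => 'd (slice H s) z v) = (fun s => g (s, z)).
    by apply/funext => u; exact: slice_diffE.
  have E' : 'd (slice H s) z v = g (s, z) by exact: slice_diffE.
  by rewrite E E'.
have fst_c (w : plane) : fst @ w --> w.1 by apply: cvg_fst; exact: cvg_id.
have snd_c (w : plane) : snd @ w --> w.2 by apply: cvg_snd; exact: cvg_id.
apply: cvgB; apply: cvgM.
- exact: cvg_comp (D _) (fst_c _).
- exact: cvg_comp (D _) (snd_c _).
- exact: cvg_comp (D _) (snd_c _).
exact: cvg_comp (D _) (fst_c _).
Qed.

Lemma slice_det0 z : slice_det 0 z = 1.
Proof.
rewrite /slice_det /detp (_ : slice H 0 = id); last by apply/funext => y; exact: H0.
by rewrite diff_val /cross /= mul1r mul0r subr0.
Qed.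

(* An isotopy starting at the identity preserves the orientation. *)
Lemma slice_det_gt0 z : 0 < slice_det 1 z.
Proof. exact: (positive_path (@slice_det_continuous z) (slice_det0 z) (slice_det_neq0 ^~ z)). Qed.

Lemma slice_velocity (c : R -> plane) (alpha : R -> R) t : differentiable c (alpha t) ->
  differentiable alpha t ->
  derive1 (fun t => H (1, c (alpha t))) t =
  derive1 alpha t *: 'd (slice H 1) (c (alpha t)) (derive1 c (alpha t)).
Proof.
move=> dc da; have dH := slice_differentiable 1 (c (alpha t)) Hs.
have dca : differentiable (c \o alpha) t by exact: differentiable_comp.
have dF : differentiable (slice H 1 \o (c \o alpha)) t by exact: differentiable_comp.
have Ea : derive1 alpha t = 'd alpha t 1 := derive1E' da.
have Ec : derive1 c (alpha t) = 'd c (alpha t) 1 := derive1E' dc.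
set L := 'd (slice H 1) (c (alpha t)).
have E1 : derive1 (slice H 1 \o (c \o alpha)) t = L ('d (c \o alpha) t 1).
  exact: etrans (derive1E' dF) (congr1 (fun f => f 1) (diff_comp dca dH)).
have E2 : 'd (c \o alpha) t 1 = 'd c (alpha t) ('d alpha t 1).
  exact: (congr1 (fun f => f 1) (diff_comp da dc)).
have E3 : 'd c (alpha t) ('d alpha t 1) = 'd alpha t 1 *: 'd c (alpha t) 1.
  move: ('d alpha t 1) => k; have {1}-> : k = k *: (1 : R) by exact: (esym (mulr1 _)).
  exact: linearZ.
have E4 : L ('d alpha t 1 *: 'd c (alpha t) 1) = 'd alpha t 1 *: L ('d c (alpha t) 1) by exact: linearZ.
have E5 := congr1 L (etrans E2 E3).
exact: etrans E1 (etrans E5 (etrans E4 (f_equal2 (fun a w => a *: L w) (esym Ea) (esym Ec)))).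
Qed.

End Ambient.

Lemma cross_scale (R : realType) (a b : R) (u v : R * R) :
  cross (a *: u) (b *: v) = (a * b) * cross u v.
Proof. by rewrite /cross /= -![_ *: _]/(_ * _); ring. Qed.

Section Reparametrisation.
Variables (R : realType) (alpha : R -> R).
Hypotheses (alpha_s : smooth alpha) (alpha_pos : forall t, 0 < derive1 alpha t)
  (alpha_out : exists r : R, forall t : R, r <= `|t| -> alpha t = t).

Lemma alpha_differentiable t : differentiable alpha t.
Proof. by have [d _] := alpha_s 1; exact: d. Qed.

Lemma alpha_continuous : continuous alpha.
Proof. by move=> t; apply: differentiable_continuous; exact: alpha_differentiable. Qed.

Lemma alpha_mono : {mono alpha : x y / x < y}.
Proof.
apply/leW_mono/le_mono => x y xy; apply: (@gtr0_derive1_lt_cc _ alpha x y); rewrite ?in_itv /= ?lexx ?ltW //.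
  by move=> t _; apply/derivable1_diffP/alpha_differentiable.
by apply: continuous_subspaceT => t; exact: alpha_continuous.
Qed.

Lemma alpha_inj : injective alpha.
Proof. by move=> x y e; have := alpha_mono x y; have := alpha_mono y x; rewrite e ltxx; case: ltgtP. Qed.

Lemma alpha_surj y : exists t, alpha t = y.
Proof.
have [r rP] := alpha_out; pose m := `|r| + `|y| + 1.
have m0 : 0 <= m by rewrite /m !addr_ge0.
have rm : r <= m.
  by rewrite /m -addrA; apply: le_trans (ler_norm r) _; rewrite lerDl addr_ge0.
have ym : `|y| <= m by rewrite /m addrAC addrC lerDl addr_ge0.
have mm : - m <= m by rewrite ge0_cp.
have [||t _ tE] := @IVT R alpha (- m) m y mm.
- by apply: continuous_subspaceT => s; exact: alpha_continuous.
- rewrite !rP ?normrN ?ger0_norm // ge_min le_max.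
  by move: ym; rewrite ler_norml => /andP[-> ->]; rewrite orbT.
by exists t.
Qed.

End Reparametrisation.

Section Isotopy.
Variables (R : realType) (D D' : diagram R).
Local Notation plane := (R * R)%type.
Variables (H G : R * plane -> plane) (alpha : R -> R).
Hypotheses (Hs : smooth H) (Gs : smooth G).
Hypotheses (GH : forall s z, G (s, H (s, z)) = z) (H0 : forall z, H (0, z) = z).
Hypotheses (alpha_s : smooth alpha) (alpha_pos : forall t, 0 < derive1 alpha t)
  (alpha_out : exists r : R, forall t : R, r <= `|t| -> alpha t = t).
Hypotheses (curveE : forall t, curve D' t = H (1, curve D (alpha t)))
  (classicalE : forall t u, ((t, u) \in classical D') = ((alpha t, alpha u) \in classical D)).

Let mono := alpha_mono alpha_s alpha_pos.
Let inj := alpha_inj alpha_s alpha_pos.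

Lemma isotopy_curve t u : curve D' t = curve D' u <-> curve D (alpha t) = curve D (alpha u).
Proof.
rewrite !curveE; split=> [e|->//].
by rewrite -(GH 1 (curve D (alpha t))) e GH.
Qed.

Lemma isotopy_velocity t : velocity D' t =
  derive1 alpha t *: 'd (slice H 1) (curve D (alpha t)) (velocity D (alpha t)).
Proof.
have E : curve D' = fun t => H (1, curve D (alpha t)) by apply/funext => s; exact: curveE.
have [cd _] := curve_smooth D 1.
exact: etrans (congr1 (fun f => derive1 f t) E) (slice_velocity Hs (cd _) (alpha_differentiable alpha_s t)).
Qed.

(** At a double point both velocities are transformed by the same differential, of positive
    determinant, and rescaled by positive derivatives of [alpha]. *)
Lemma isotopy_cross t u : curve D (alpha t) = curve D (alpha u) -> exists2 k, 0 < k &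
  cross (velocity D' t) (velocity D' u) = k * cross (velocity D (alpha t)) (velocity D (alpha u)).
Proof.
move=> e; set L := 'd (slice H 1) (curve D (alpha t)).
have Eu : velocity D' u = derive1 alpha u *: L (velocity D (alpha u)).
  by apply: etrans (isotopy_velocity u) _; rewrite /L e.
exists (derive1 alpha t * derive1 alpha u * slice_det H 1 (curve D (alpha t))).
  by rewrite !mulr_gt0 //; exact: slice_det_gt0 Hs Gs GH H0 _.
apply: etrans (f_equal2 (@cross R) (isotopy_velocity t) Eu) _.
by rewrite cross_scale cross_linear mulrA.
Qed.

Lemma isotopy_writhe t u : curve D (alpha t) = curve D (alpha u) ->
  writhe D' (t, u) = writhe D (alpha t, alpha u).
Proof.
move=> /isotopy_cross[k k0 E]; have E' := pmulr_rgt0 (cross (velocity D (alpha t)) (velocity D (alpha u))) k0.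
exact: (congr1 (fun b : bool => if b then 1 else -1 : int) (etrans (congr1 (fun x => 0 < x) E) E')).
Qed.

Lemma isotopy_left t u : curve D (alpha t) = curve D (alpha u) ->
  left_to_right D' t u = left_to_right D (alpha t) (alpha u).
Proof.
move=> /isotopy_cross[k k0 E]; have E' := pmulr_rlt0 (cross (velocity D (alpha t)) (velocity D (alpha u))) k0.
exact: etrans (congr1 (fun x => x < 0) E) E'.
Qed.

Lemma isotopy_virtual_time t : (t \in virtual_times D') = (alpha t \in virtual_times D).
Proof.
apply/idP/idP => /virtual_timeP[u [tu e n1 n2]]; apply/virtual_timeP.
  exists (alpha u); rewrite -!classicalE (inj_eq inj) n1 n2 tu; split=> //.
  exact/isotopy_curve.
have [v vE] := alpha_surj alpha_s alpha_out u; subst u.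
exists v; rewrite !classicalE n1 n2 -(inj_eq inj) tu; split=> //.
exact/isotopy_curve.
Qed.

Lemma isotopy_step t : t \in virtual_times D' -> degree_step D' t = degree_step D (alpha t).
Proof.
move=> /virtual_timeP[u [tu e n1 n2]]; have e' := (isotopy_curve t u).1 e.
have tu' : alpha t != alpha u by rewrite (inj_eq inj).
have n1' : (alpha t, alpha u) \notin classical D by rewrite -classicalE.
have n2' : (alpha u, alpha t) \notin classical D by rewrite -classicalE.
apply: etrans (virtual_step tu e n1 n2) (etrans _ (esym (virtual_step tu' e' n1' n2'))).
exact: (congr1 (fun b : bool => if b then 1 else -1 : int) (isotopy_left (esym e'))).
Qed.

Lemma perm_map_alpha (T : eqType) (f : T -> T) (s s' : seq T) : injective f ->
  (forall y, exists x, f x = y) -> uniq s -> uniq s' -> (forall x, (x \in s') = (f x \in s)) ->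
  perm_eq (map f s') s.
Proof.
move=> fI fS us us' fE; apply: uniq_perm; rewrite ?map_inj_uniq // => y.
have [x <-] := fS y; by rewrite mem_map // fE.
Qed.

Lemma isotopy_height t : height D' t = height D (alpha t).
Proof.
have p : perm_eq (map alpha (virtual_times D')) (virtual_times D).
  apply: perm_map_alpha inj (alpha_surj alpha_s alpha_out) _ _ isotopy_virtual_time;
    exact: virtual_times_uniq.
rewrite /height -(perm_big _ p) big_map /= big_seq_cond [RHS]big_seq_cond.
under [RHS]eq_bigl do rewrite mono.
by apply: eq_bigr => v /andP[vV _]; exact: isotopy_step.
Qed.

Lemma isotopy_weight c : c \in classical D' -> weight D' c = weight D (pair_map alpha c).
Proof.
case: c => t u cD'; have [/= _ e] := crossing_curve (classical_crossing cD').
have W : writhe D' (t, u) = writhe D (pair_map alpha (t, u)) := isotopy_writhe ((isotopy_curve t u).1 e).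
have O : early_overcrossing (pair_map alpha (t, u)) = early_overcrossing (t, u) := mono t u.
by rewrite /weight W O.
Qed.

Lemma isotopy_zeta : same_zeta D D'.
Proof.
have p : perm_eq (map (pair_map alpha) (classical D')) (classical D).
  apply: perm_map_alpha.
  - by move=> [x y] [x' y'] [/inj-> /inj->].
  - move=> [x y]; have [x' <-] := alpha_surj alpha_s alpha_out x.
    by have [y' <-] := alpha_surj alpha_s alpha_out y; exists (x', y').
  - exact: classical_uniq.
  - exact: classical_uniq.
  by move=> [x y]; exact: classicalE.
have [b [e [be _]]] := ex_surrounds D' 0.
have be' : surrounds D (alpha b) (alpha e).
  have [lt_be bc bv] := be; split; first by rewrite mono.
    move=> c; rewrite -(perm_mem p) => /mapP[[x y] /bc /= [h1 h2] ->].
    by rewrite /= !mono.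
  move=> v vD; have [t tE] := alpha_surj alpha_s alpha_out v; subst v.
  by rewrite !mono; apply: bv; rewrite isotopy_virtual_time.
have U : uniq (b :: map snd (classical D')).
  by have := garcs_uniq (weight D') be; rewrite /garcs /= -map_comp.
have E : cdet D' b e = gdet (base T_ring (alpha b) (alpha e) ::
    map (garc_of D (weight D)) (map (pair_map alpha) (classical D'))).
  apply: gdet_rename mono _ U => c cD'; split.
  - exact: isotopy_weight.
  - exact: isotopy_height.
  exact: isotopy_height.
have E' : gdet (base T_ring (alpha b) (alpha e) ::
    map (garc_of D (weight D)) (map (pair_map alpha) (classical D'))) = cdet D (alpha b) (alpha e).
  by apply: gdet_perm; rewrite /garcs perm_cons; exact: perm_map p.
exact: same_zetaI be' be (unit_related_eq (esym (etrans E E'))).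
Qed.

End Isotopy.

Lemma planar_isotopic_zeta (R : realType) (D D' : diagram R) :
  planar_isotopic D D' -> same_zeta D D'.
Proof.
move=> [H [G [alpha [[Hs Gs] inv [H0 _] [as_ ap ao] [cE clE]]]]].
exact: (isotopy_zeta Hs Gs (fun s z => (inv s z).1) H0 as_ ap ao cE clE).
Qed.

(** * Minimality *)

(** A finite supremum of integer exponents is attained: otherwise [n - 1] would be an upper bound
    too. *)
Lemma lcoef_deg_s (A : comNzRingType) (z : laurent A) (n : int) : deg_s z = n%:E%E -> lcoef z n != 0.
Proof.
rewrite /deg_s /supremum; case: ifP => // _; case: xgetP => // y yE [ub least] yn.
rewrite {y}yn in yE ub least; apply/negP => /eqP z0.
have : (n%:E <= (n - 1)%:E)%E.
  apply: least => _ [k /= kz <-]; have : (k%:E <= n%:E)%E by apply: ub; exists k.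
  rewrite !lee_fin; suff : k != n by lia.
  by apply: contraNneq kz => ->; rewrite z0.
by rewrite lee_fin; lia.
Qed.

Lemma equivalent_zeta (R : realType) (D D' : diagram R) : equivalent D D' -> same_zeta D D'.
Proof.
elim=> [E E'|E|E E' _|E E' E'' _ H _ H'].
- case; [exact: planar_isotopic_zeta|exact: first_move_zeta|exact: second_move_zeta|exact: third_move_zeta].
- exact: same_zeta_refl.
- exact: same_zeta_sym.
exact: same_zeta_trans H H'.
Qed.

(** The determinants of the two diagrams differ by a constant factor, so a coefficient beyond the
    bound for [D'] vanishes for [D] as well. *)
Lemma equivalent_lcoef (R : realType) (D D' : diagram R) (k : int) : equivalent D D' ->
  (0 < size (classical D))%N -> lcoef (zeta D) k != 0 -> k <= (size (virtual D'))%:Z.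
Proof.
move=> /equivalent_zeta DD' D0 zk; rewrite leNgt; apply/negP => k_lt.
have [b [e [be _]]] := ex_surrounds D 0; have [b' [e' [be' _]]] := ex_surrounds D' 0.
have [u [v [_ E]]] := DD' _ _ _ _ be be'; move/negP: zk; apply; apply/eqP.
have EZ : zeta D = lcst u * cdet D' b' e' := etrans (zetaE be D0) E.
apply: (eq_ind_r (fun z => lcoef z k = 0) _ EZ); apply: etrans (lcoef_cstM u _ k) _.
have E2 : lcoef (cdet D' b' e') k = 0 := gdet_bound (weight D') be' k_lt.
by rewrite E2 mulr0.
Qed.

(** The constant factor multiplies each coefficient separately, and by [T_regular] it annihilates
    only 0. *)
Lemma product_lcoef (R : realType) (D K : diagram R) (k : int) : virtual K = [::] ->
  (0 < size (classical D))%N -> lcoef (zeta D) k != 0 -> lcoef (zeta (product D K)) k != 0.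
Proof.
move=> K0 D0; have [Delta E aug1] := zeta_product K0 D0.
apply: contraNneq => z0; apply/eqP; apply: T_regular aug1 _.
have E' : lcst (tpi Delta) * zeta D = zeta (product D K) := etrans (mulrC _ _) (esym E).
apply: etrans (esym (lcoef_cstM (tpi Delta) (zeta D) k)) _.
exact: (eq_ind_r (fun z => lcoef z k = 0) z0 E').
Qed.

Theorem theorem1p4 (R : realType) (D K : diagram R) :
  (0 < size (classical D))%N ->
  minimal D ->
  deg_s (zeta D) = (size (virtual D))%:Z%:E%E ->
  virtual K = [::] ->
  minimal (product D K).
Proof.
move=> D0 _ /lcoef_deg_s zN K0 D' PD'.
have P0 : (0 < size (classical (product D K)))%N by rewrite /= size_cat size_map ltn_addr.
by have := equivalent_lcoef PD' P0 (product_lcoef K0 D0 zN); rewrite product_virtual.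
Qed.
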